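(* For $c=0$ one has $$D(0,s)=D_2(0,s)\,\frac{(1-2^{-(s+1)})(1-2^{-(2s+n)})}{1-2^{-(2s+n+1)}}\cdot\frac{\zeta(s+1)\,\zeta(2s+n)}{\zeta(2s+n+1)}.$$ Moreover, for every $\epsilon>0$, $$D_2(0,s)\,\frac{(1-2^{-(s+1)})(1-2^{-(2s+n)})}{1-2^{-(2s+n+1)}}\ll_{n,\epsilon}1\qquad\text{for }\sigma=\mathrm{Re}(s)\ge-n/2+\epsilon.$$
   Context: $n\ge3$ is odd, $J=\mathrm{diag}(b_1,\dots,b_n)$ with $b_i\in\{1,-1\}$, $F(x)=x^tJx$, $e(x)=e^{2\pi i x}$, and for $c\in\mathbb Z^n$, $$S(q,c)=\sum_{a\bmod q}\ \sum_{x_0\in(\mathbb Z/q\mathbb Z)^n}e\left(\frac{aF(x_0)+c\cdot x_0}{q}\right),\qquad D(c,s)=\sum_{q=1}^\infty\frac{S(q,c)}{q^{s+n+1}},$$ which converges absolutely for $\mathrm{Re}(s)>1$ and has an Euler product $D(c,s)=\prod_pD_p(c,s)$ with $D_p(c,s)=\sum_{k\ge0}S(p^k,c)p^{-k(s+n+1)}$. Functions of $s$ are understood through meromorphic continuation from their regions of convergence. $\zeta$ is the Riemann zeta function. *)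

(* Defs.v *)
From Stdlib Require Import Reals ZArith.
From mathcomp Require Import all_boot all_algebra ssrZ.
From Coquelicot Require Import Coquelicot.

Set Implicit Arguments.
Unset Strict Implicit.
Unset Printing Implicit Defensive.

(* Complex analysis is that of Coquelicot, on [C]; the finite sums and the
   integral quadratic form use MathComp's big operators and matrices, over
   [Z] with the ring structure of [ssrZ]. *)

(** * Complex exponentials and powers *)

Definition Cexp (z : C) : C :=
  (RtoC (exp (Re z)) * (cos (Im z), sin (Im z)))%C.

(* [x ^ z] for a real base [x > 0] (the logarithm of Stdlib is [0] for
   [x <= 0]). *)
Definition cpow (x : R) (z : C) : C := Cexp (z * RtoC (ln x))%C.

Definition e (x : R) : C := Cexp (RtoC (2 * PI * x) * Ci)%C.

(** * Meromorphic functions on the complex plane *)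

Definition analytic_at (f : C -> C) (z0 : C) : Prop :=
  exists a : nat -> C, locally z0 (fun z : C => is_pseries a (z - z0)%C (f z)).

(* The value [f z0] at a pole is unconstrained. *)
Definition pole_at (f : C -> C) (z0 : C) : Prop :=
  exists (k : nat) (g : C -> C),
    [/\ (0 < k)%N, analytic_at g z0, g z0 <> RtoC 0 &
        locally' z0 (fun z : C => f z = (g z / (z - z0) ^ k)%C)].

(* There are no removable singularities left: at a point which is not a pole,
   the value of a meromorphic function is its analytic value. *)
Definition meromorphic (f : C -> C) : Prop :=
  forall z0 : C, analytic_at f z0 \/ pole_at f z0.

(* Equality of meromorphic functions: it ignores a closed discrete set of
   points, where a formula involving quotients or products of meromorphic
   functions need not be evaluated correctly by the total operations of [C]. *)
Definition mero_eq (f g : C -> C) : Prop :=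
  forall z0 : C, locally' z0 (fun z : C => f z = g z).

(* [f] is the meromorphic continuation to the whole plane of the sum of the
   series [\sum_k t k s], convergent for [Re s > 1]. By the identity theorem
   [f] is determined by [t] away from its poles. *)
Definition continuation_of_series (t : nat -> C -> C) (f : C -> C) : Prop :=
  meromorphic f /\
  forall s : C, Rlt 1 (Re s) -> is_series (fun k : nat => t k s) (f s).

Definition is_riemann_zeta (zeta : C -> C) : Prop :=
  continuation_of_series (fun (k : nat) (s : C) => (1 / cpow (INR k.+1) s)%C)
    zeta.

(** * The quadratic form, the exponential sums and their Dirichlet series *)

Section QuadraticForm.

Variables (n : nat) (b : 'rV[Z]_n).

Definition signs : Prop :=
  forall i : 'I_n, b ord0 i = 1%R \/ b ord0 i = (-1)%R.

Definition F (x : 'cV[Z]_n) : Z := (x^T *m diag_mx b *m x)%R ord0 ord0.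

(* Residue classes modulo [q] are represented by [0, ..., q - 1]. *)
Definition Ssum (q : nat) (c : 'cV[Z]_n) : C :=
  \big[Cplus/RtoC 0]_(a < q) \big[Cplus/RtoC 0]_(x0 : 'cV['I_q]_n)
    let x := map_mx (fun i : 'I_q => Z.of_nat i) x0 in
    e (Rdiv (IZR (Z.of_nat a * F x + (c^T *m x) ord0 ord0)%R) (INR q)).

(* The index [k] stands for [q = k + 1]. *)
Definition is_D (c : 'cV[Z]_n) (D : C -> C) : Prop :=
  continuation_of_series
    (fun (k : nat) (s : C) =>
       (Ssum k.+1 c / cpow (INR k.+1) (s + RtoC (INR n) + 1))%C) D.

Definition is_Dp (p : nat) (c : 'cV[Z]_n) (Dp : C -> C) : Prop :=
  continuation_of_series
    (fun (k : nat) (s : C) =>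
       (Ssum (p ^ k)%N c *
        cpow (INR p) (- (RtoC (INR k) * (s + RtoC (INR n) + 1))))%C) Dp.

End QuadraticForm.

Definition dyadic_factor (n : nat) (s : C) : C :=
  ((1 - cpow 2 (- (s + 1))) * (1 - cpow 2 (- (2 * s + RtoC (INR n)))) /
   (1 - cpow 2 (- (2 * s + RtoC (INR n) + 1))))%C.

(* Main.v *)
Require Import Defs.
From HB Require Import structures.
From Stdlib Require Import Reals ZArith Lra Lia Classical ClassicalEpsilon.
From mathcomp Require Import all_boot all_algebra cyclic ssrZ zify.
From Coquelicot Require Import Coquelicot.

(** Let A(d) be the sum of e(a F(x) / d) over all x modulo d and all a modulo d that
    are prime to d. Sorting the a modulo q by their gcd g with q gives
    S(q,0) = sum of g^n A(q/g) over the divisors g of q ([Ssum_divisors]), so the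
    factor zeta(s+1) splits off from D(0,s) and there remains the sum of
    A(d) d^(-(s+n+1)).

    As F is diagonal, the sum over x is a product of n one-variable quadratic Gauss
    sums ([gauss_prod]). Since n is odd, A(d) vanishes whenever some substitution
    a -> a u changes the sign of each of these Gauss sums ([prim_sum_twist]). If d is
    not a square there is such a u, or else the Gauss sums vanish: one takes a
    non-residue at an odd prime of odd exponent, or u = 1 + 4 m when d is an odd power
    of 2 times the square of an odd m ([prim_sum_nonsquare]). If d = l^2 the Gauss
    sums are explicit and A(l^2) = w(l) phi(l) l^(n+1), where w(l) = 1 for odd l and
    w(l) = c for even l, with c the real part of the product of the 1 + i b_k
    ([prim_sum_sq]).

    Put t = 2s+n+1. Then D(0,s) / zeta(s+1) is the Dirichlet series of w(l) phi(l) at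
    t, and comparing coefficients ([dconv_weight]) shows that this series times
    zeta(t) (1 - 2^(-t)) is (1 + (c-2) 2^(-t)) zeta(t-1). The same computation
    restricted to powers of 2 consists of geometric series: with v = 2^(-(2s+n)),
      D_2(0,s) = (1 + (c/2 - 1) v) / ((1 - 2^(-(s+1))) (1 - v))
    ([D2_series]). Hence D_2 times the dyadic factor is
    (1 + (c/2 - 1) v) / (1 - v/2), which gives the factorization; and where
    Re s >= -n/2 + eps one has |v| <= 1 and |c| <= 2^n, which gives the bound.

    For the continuation, the germs of meromorphic functions are closed under
    products and reciprocals, because a nonzero analytic germ is a power of z - z0
    times a nonvanishing one ([analytic_factor]). Replacing values by punctured
    limits ([regularize]) turns each of the explicit formulas into a meromorphic
    function, and leaves it unchanged where the formula is analytic. For Re s > 1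
    this requires that zeta be analytic, which follows from the boundedness of its
    series, and nonzero at t, which is elementary as Re t > 3. *)

Set Implicit Arguments.
Unset Strict Implicit.
Unset Printing Implicit Defensive.

Local Open Scope R_scope.
Delimit Scope Z_scope with ZZ.

(** * Finite sums and products in R and C *)

(** The laws that the lemmas on iterated operators ask for, so that they apply
    to sums and products of real and complex numbers. *)
HB.instance Definition _ :=
  Monoid.isComLaw.Build C (RtoC 0) Cplus Cplus_assoc Cplus_comm Cplus_0_l.
HB.instance Definition _ :=
  Monoid.isComLaw.Build C (RtoC 1) Cmult Cmult_assoc Cmult_comm Cmult_1_l.
HB.instance Definition _ :=
  Monoid.isMulLaw.Build C (RtoC 0) Cmult Cmult_0_l Cmult_0_r.
HB.instance Definition _ :=
  Monoid.isAddLaw.Build C Cmult Cplus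
    (fun x y z => Cmult_plus_distr_r x y z) (fun x y z => Cmult_plus_distr_l x y z).

HB.instance Definition _ :=
  Monoid.isComLaw.Build R 0 Rplus (fun x y z => esym (Rplus_assoc x y z)) Rplus_comm Rplus_0_l.
HB.instance Definition _ :=
  Monoid.isComLaw.Build R 1 Rmult (fun x y z => esym (Rmult_assoc x y z)) Rmult_comm Rmult_1_l.
HB.instance Definition _ :=
  Monoid.isMulLaw.Build R 0 Rmult Rmult_0_l Rmult_0_r.
HB.instance Definition _ :=
  Monoid.isAddLaw.Build R Rmult Rplus Rmult_plus_distr_r Rmult_plus_distr_l.

Notation "\csum_ ( i < n | P ) F" := (\big[Cplus/RtoC 0]_(i < n | P%B) F%C)
  (at level 41, F at level 41, i, n at level 50).
Notation "\csum_ ( i < n ) F" := (\big[Cplus/RtoC 0]_(i < n) F%C)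
  (at level 41, F at level 41, i, n at level 50).
Notation "\rsum_ ( i < n ) F" := (\big[Rplus/0]_(i < n) F)
  (at level 41, F at level 41, i, n at level 50).

Lemma csumS (a : nat -> C) n : (\csum_(i < n.+1) a i = \csum_(i < n) a i + a n)%C.
Proof. by rewrite big_ord_recr. Qed.

Lemma rsumS (a : nat -> R) n : \rsum_(i < n.+1) a i = \rsum_(i < n) a i + a n.
Proof. by rewrite big_ord_recr. Qed.

Lemma ler_rsum I (r : seq I) (P : pred I) (f g : I -> R) :
  (forall i, P i -> f i <= g i) ->
  \big[Rplus/0]_(i <- r | P i) f i <= \big[Rplus/0]_(i <- r | P i) g i.
Proof. by move=> H; apply: big_ind2 => //; intros; lra. Qed.

Lemma rsum_ge0 I (r : seq I) (P : pred I) (f : I -> R) :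
  (forall i, P i -> 0 <= f i) -> 0 <= \big[Rplus/0]_(i <- r | P i) f i.
Proof. by move=> H; apply: big_ind => //; intros; lra. Qed.

Lemma Cmod_csum I (r : seq I) (P : pred I) (f : I -> C) :
  Cmod (\big[Cplus/RtoC 0]_(i <- r | P i) f i)
    <= \big[Rplus/0]_(i <- r | P i) Cmod (f i).
Proof.
apply: (big_ind2 (fun x y => Cmod x <= y)) => [|x1 x2 y1 y2 h1 h2|i _].
- by rewrite Cmod_0; lra.
- by have := Cmod_triangle x1 y1; lra.
- lra.
Qed.

Lemma csum_sub I (r : seq I) (P : pred I) (f g : I -> C) :
  (\big[Cplus/RtoC 0]_(i <- r | P i) f i - \big[Cplus/RtoC 0]_(i <- r | P i) g i =
   \big[Cplus/RtoC 0]_(i <- r | P i) (f i - g i))%C.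
Proof. by apply: (big_rec3 (fun x y z => (x - y = z)%C)) => [|i x y z _ <-]; ring. Qed.

Lemma csum_const n (c : C) : (\csum_(i < n) c = RtoC (INR n) * c)%C.
Proof.
elim: n => [|n IH]; first by rewrite big_ord0 /=; ring.
by rewrite S_INR RtoC_plus big_ord_recr /= IH; ring.
Qed.

(** * Convergence in C through partial sums *)

Definition cvs (u : nat -> C) (l : C) :=
  forall eps, 0 < eps -> exists N, forall n, (N <= n)%N -> Cmod (u n - l) < eps.

Definition sums (a : nat -> C) (l : C) := cvs (fun n => \csum_(k < n) a k) l.

Lemma cvs_unique u l l' : cvs u l -> cvs u l' -> l = l'.
Proof.
move=> h h'; apply: NNPP => ne.
have d : 0 < Cmod (l - l').
  by apply/Cmod_gt_0/Cminus_eq_contra.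
have [N HN] := h (Cmod (l - l') / 2) ltac:(lra).
have [N' HN'] := h' (Cmod (l - l') / 2) ltac:(lra).
have := HN (maxn N N') (leq_maxl _ _); have := HN' (maxn N N') (leq_maxr _ _).
set x := u _ => a b.
have := Cmod_triangle (x - l') (- (x - l)); rewrite Cmod_opp.
have -> : ((x - l') + - (x - l) = l - l')%C by ring.
lra.
Qed.

Lemma cvs_ext u v l : (forall n, u n = v n) -> cvs u l -> cvs v l.
Proof. by move=> E h eps /h [N HN]; exists N => n /HN; rewrite E. Qed.

Lemma sums_ext a b l : (forall n, a n = b n) -> sums a l -> sums b l.
Proof. by move=> E; apply: cvs_ext => n; apply: eq_bigr => i _; rewrite E. Qed.

Lemma sums_unique a l l' : sums a l -> sums a l' -> l = l'.
Proof. exact: cvs_unique. Qed.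

Lemma sum_n_big (a : nat -> C) n : sum_n a n = \csum_(k < n.+1) a k.
Proof.
elim: n => [|n IH]; first by rewrite sum_O big_ord_recr big_ord0 /= Cplus_0_l.
by rewrite sum_Sn IH [RHS]big_ord_recr.
Qed.

Lemma is_series_sums (a : nat -> C) (l : C) : is_series a l <-> sums a l.
Proof.
split=> [H eps he|H P [eps HP]].
  have /H [N HN] : locally l (fun z => Cmod (z - l) < eps).
    exact: (locally_le_locally_norm (V := C_NormedModule) l _ (ex_intro _ (mkposreal _ he) (fun
      y h => h))).
  exists N.+1 => -[//|n] hn; rewrite -sum_n_big; apply: HN; exact/leP.
have := H (eps : posreal) (cond_pos eps); case=> N HN.
exists N => n /leP hn; apply: HP.
apply: C_NormedModule_mixin_compat1.
by rewrite sum_n_big; apply: HN; apply: leqW.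
Qed.

Lemma cvs_const l : cvs (fun=> l) l.
Proof. by move=> eps he; exists 0%N => n _;
  rewrite -[(l - l)%C]/(l + - l)%C Cplus_opp_r Cmod_0. Qed.

Lemma cvs_plus u v l m : cvs u l -> cvs v m -> cvs (fun n => u n + v n)%C (l + m).
Proof.
move=> hu hv eps he.
have [N HN] := hu (eps / 2) ltac:(lra); have [M HM] := hv (eps / 2) ltac:(lra).
exists (maxn N M) => n; rewrite geq_max => /andP [/HN h1 /HM h2].
have -> : (u n + v n - (l + m) = (u n - l) + (v n - m))%C by ring.
have := Cmod_triangle (u n - l) (v n - m); lra.
Qed.

Lemma cvs_scal c u l : cvs u l -> cvs (fun n => c * u n)%C (c * l).
Proof.
move=> hu eps he.
have hc := Cmod_ge_0 c.
have [N HN] := hu (eps / (Cmod c + 1)) ltac:(by apply: Rdiv_lt_0_compat; lra).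
exists N => n /HN h.
have -> : (c * u n - c * l = c * (u n - l))%C by ring.
rewrite Cmod_mult.
have h0 := Cmod_ge_0 (u n - l).
apply: (Rle_lt_trans _ ((Cmod c + 1) * Cmod (u n - l))); first nra.
have -> : eps = (Cmod c + 1) * (eps / (Cmod c + 1)) by field; lra.
apply: Rmult_lt_compat_l => //; lra.
Qed.

Lemma sums_plus a b l m : sums a l -> sums b m -> sums (fun n => a n + b n)%C (l + m).
Proof. by move=> ha hb; apply: cvs_ext (cvs_plus ha hb) => n; rewrite big_split. Qed.

Lemma sums_scal c a l : sums a l -> sums (fun n => c * a n)%C (c * l).
Proof. by move=> /(cvs_scal c); apply: cvs_ext => n; rewrite big_distrr. Qed.

Lemma cvs_bound u l c B : (forall n, Cmod (u n - c) <= B) -> cvs u l -> Cmod (l - c) <= B.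
Proof.
move=> hB hu; apply: le_epsilon => eps he.
have [N HN] := hu eps he; have := HN N (leqnn _); have := hB N.
set x := u N => h1 h2.
have := Cmod_triangle (x - c) (- (x - l)); rewrite Cmod_opp.
have -> : ((x - c) + - (x - l) = l - c)%C by ring.
lra.
Qed.

Lemma cvs_bound0 u l B : (forall n, Cmod (u n) <= B) -> cvs u l -> Cmod l <= B.
Proof.
move=> h hu; rewrite -[l]Cplus_0_r -[RtoC 0]Copp_0.
by apply: cvs_bound hu => n; rewrite /Cminus Copp_0 Cplus_0_r.
Qed.

Lemma sums_bound (a : nat -> C) l B : (forall n, \rsum_(k < n) Cmod (a k) <=
  B) -> sums a l -> Cmod l <= B.
Proof.
by move=> h; apply: cvs_bound0 => n; apply: Rle_trans (Cmod_csum _ _ _) (h n).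
Qed.

Lemma rsum_mono (a : nat -> R) m n : (forall k, 0 <= a k) -> (m <= n)%N ->
  \rsum_(k < m) a k <= \rsum_(k < n) a k.
Proof.
move=> ha /subnK <-; elim: (n - m)%N => [|d IH]; first by rewrite add0n; lra.
rewrite addSn rsumS; have := ha (d + m)%N; lra.
Qed.

(** The limit of the partial sums, as their least upper bound: all later tail
    estimates compare a partial sum with [l]. *)
Lemma rsum_cauchy (a : nat -> R) B : (forall k, 0 <= a k) ->
  (forall n, \rsum_(k < n) a k <= B) ->
  exists l, (forall n, \rsum_(k < n) a k <= l) /\
   forall eps, 0 < eps -> exists N, forall n, (N <= n)%N -> l - eps < \rsum_(k < n) a k.
Proof.
move=> ha hB.
have [l [l1 l2]] : { l | is_lub (fun x => exists n, x = \rsum_(k < n) a k) l }.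
  apply: completeness; first by exists B => x [n ->].
  by exists (\rsum_(k < 0) a k), 0%N.
exists l; split=> [n|eps he]; first by apply: l1; exists n.
apply: NNPP => hn.
have : l <= l - eps; last lra.
apply: l2 => x [n ->]; apply: Rnot_lt_le => hlt; apply: hn; exists n => m hm.
exact: Rlt_le_trans hlt (rsum_mono ha hm).
Qed.

(** Absolute convergence, with an explicit bound on the partial sums of the
    moduli. *)
Definition abs_bdd (a : nat -> C) B := forall n, \rsum_(k < n) Cmod (a k) <= B.

Lemma abs_bdd_sums a B : abs_bdd a B -> exists l, sums a l.
Proof.
move=> hB.
have [l [l1 l2]] := rsum_cauchy (fun k => Cmod_ge_0 (a k)) hB.
suff [m hm] : ex_series (V := C_CompleteNormedModule) a by exists m; apply/is_series_sums.
apply: (@ex_series_le C_AbsRing C_CompleteNormedModule a (fun k => Cmod (a k))).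
  by move=> n; exact: Rle_refl.
exists l => P [eps HP].
have [N HN] := l2 eps (cond_pos eps).
exists N => n /leP hn; apply: HP.
have E : sum_n (fun k => Cmod (a k)) n = \rsum_(k < n.+1) Cmod (a k).
  elim: n {hn} => [|n IH]; first by rewrite sum_O big_ord_recr big_ord0 /= Rplus_0_l.
  by rewrite sum_Sn IH [RHS]big_ord_recr.
rewrite E; move: (l1 n.+1) (HN n.+1 (leqW hn)); move: (bigop.body _ _ _) => x h1 h2.
rewrite /ball /= /AbsRing_ball /= /abs /= /minus /plus /opp /=.
by rewrite Rabs_left1; lra.
Qed.

(** * Products of series *)

Lemma Cmult_close (l m : C) eps : 0 < eps ->
  exists d, 0 < d /\ forall x y, Cmod (x - l) < d -> Cmod (y - m) < d ->
    Cmod (x * y - l * m) < eps.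
Proof.
move=> he; have hl := Cmod_ge_0 l; have hm := Cmod_ge_0 m.
pose d := Rmin 1 (eps / (Cmod l + Cmod m + 2)).
have q0 : 0 < eps / (Cmod l + Cmod m + 2) by apply: Rdiv_lt_0_compat; lra.
have d1 : d <= 1 by apply: Rmin_l.
have d2 : d * (Cmod l + Cmod m + 2) <= eps.
  have -> : eps = eps / (Cmod l + Cmod m + 2) * (Cmod l + Cmod m + 2) by field; lra.
  by apply: Rmult_le_compat_r; [lra|apply: Rmin_r].
exists d; split; first by apply: Rmin_glb_lt; lra.
move=> x y h1 h2.
have -> : (x * y - l * m = (x - l) * (y - m) + (l * (y - m) + m * (x - l)))%C by ring.
have := Cmod_triangle ((x - l) * (y - m)) (l * (y - m) + m * (x - l)).
have := Cmod_triangle (l * (y - m)) (m * (x - l)).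
rewrite !Cmod_mult.
have := Cmod_ge_0 (x - l); have := Cmod_ge_0 (y - m).
move: (Cmod (x - l)) (Cmod (y - m)) h1 h2 => p q h1 h2 q1 p1.
nra.
Qed.

Lemma cvs_mult u v l m : cvs u l -> cvs v m -> cvs (fun n => u n * v n)%C (l * m)%C.
Proof.
move=> hu hv eps he; have [d [d0 H]] := Cmult_close l m he.
have [N HN] := hu d d0; have [M HM] := hv d d0.
exists (maxn N M) => n; rewrite geq_max => /andP [/HN h1 /HM h2].
exact: H.
Qed.

Lemma csum_pick N k (x : C) :
  \csum_(m < N | k == m :> nat) x = if (k < N)%N then x else RtoC 0.
Proof.
case: ltnP => hk.
  by rewrite (big_pred1 (Ordinal hk)) // => i; rewrite eq_sym.
by rewrite big_pred0 // => i; apply/negbTE; rewrite neq_ltn (leq_trans (ltn_ord i) hk) orbT.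
Qed.

(** The two inequalities on [h] confine a pair [(i, j)] with [h i j = m] to
    indices at most [m], so that summing the fibres of [h] up to [N] selects
    exactly the pairs with [h i j < N]. *)
Lemma prod_partial (h : nat -> nat -> nat) (a b : nat -> C) N :
  (forall i j, i <= h i j)%N -> (forall i j, j <= h i j)%N ->
  \csum_(m < N) \csum_(i < m.+1) \csum_(j < m.+1 | h i j == m) (a i * b j) =
  \csum_(i < N) \csum_(j < N) (if (h i j < N)%N then a i * b j else RtoC 0).
Proof.
move=> hi hj.
transitivity (\csum_(m < N) \csum_(i < N) \csum_(j < N | h i j == m) (a i * b j)).
  apply: eq_bigr => m _.
  rewrite (big_ord_widen N (fun i => \csum_(j < m.+1 | h i j == m) (a i * b j))) //.
  rewrite big_mkcond; apply: eq_bigr => i _.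
  rewrite (big_ord_widen_cond N (fun j => h i j == m) (fun j => a i * b j)%C) //.
  have E : (fun j : 'I_N => (h i j == m) && (j < m.+1)%N) =1 (fun j : 'I_N => h i j == m).
    by move=> j; case: eqP => //= <-; rewrite ltnS hj.
  rewrite (eq_bigl _ _ E); case: ltnP => // hmi.
  rewrite big_pred0 // => j; apply/negbTE/eqP => e; move: (hi i j); rewrite e.
  by rewrite leqNgt hmi.
rewrite exchange_big /=; apply: eq_bigr => i _.
rewrite (exchange_big_dep predT) //=; apply: eq_bigr => j _.
by rewrite csum_pick.
Qed.

(** Products of absolutely convergent series, regrouped along any [h] with
    finite fibres. The Cauchy product is [h i j = i + j] and the Dirichlet
    product [(i + 1)(j + 1) - 1]; sparse variants such as [i + 2 j] and
    [(i + 1)(j + 1)^2 - 1] serve for series supported on squares. The regrouped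
    partial sum differs from the product of the partial sums by terms with
    [h i j >= N]; for large [N] they lie outside the square [i, j < K], where
    the moduli sum to at most [LA * LB - S_K T_K]. *)
Lemma prod_sums (h : nat -> nat -> nat) (a b : nat -> C) A B alpha beta :
  (forall i j, i <= h i j)%N -> (forall i j, j <= h i j)%N ->
  abs_bdd a alpha -> abs_bdd b beta -> sums a A -> sums b B ->
  sums (fun m => \csum_(i < m.+1) \csum_(j < m.+1 | h i j == m) (a i * b j)) (A * B)%C.
Proof.
move=> hi hj ha hb sa sb.
have [LA [la1 la2]] := rsum_cauchy (fun k => Cmod_ge_0 (a k)) ha.
have [LB [lb1 lb2]] := rsum_cauchy (fun k => Cmod_ge_0 (b k)) hb.
have LA0 : 0 <= LA by have := la1 0%N; rewrite big_ord0.
have LB0 : 0 <= LB by have := lb1 0%N; rewrite big_ord0.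
suff D : cvs (fun N => (\csum_(m < N) \csum_(i < m.+1) \csum_(j < m.+1 | h i j == m) (a i * b j)
            - (\csum_(i < N) a i) * (\csum_(j < N) b j)))%C 0.
  have := cvs_plus D (cvs_mult sa sb); rewrite Cplus_0_l; apply: cvs_ext => n.
  by rewrite /Cminus -Cplus_assoc [(- _ + _)%C]Cplus_comm Cplus_opp_r Cplus_0_r.
move=> eps he.
pose d := eps / (LA + LB + 1).
have d0 : 0 < d by apply: Rdiv_lt_0_compat; lra.
have dE : d * (LA + LB + 1) = eps by rewrite /d; field; lra.
have [K1 hK1] := la2 d d0; have [K2 hK2] := lb2 d d0.
pose K := maxn K1 K2.
have {hK1} k1 := hK1 K (leq_maxl _ _); have {hK2} k2 := hK2 K (leq_maxr _ _).
(* Beyond [N0] every pair of the square [i, j < K] has already been summed. *)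
pose N0 := maxn K (\max_(i < K) \max_(j < K) (h i j).+1).
exists N0 => N hN; rewrite prod_partial // big_distrlr /= csum_sub.
have -> : forall z : C, (z - 0 = z)%C by move=> z; ring.
apply: (Rle_lt_trans _ (\rsum_(i < N) \rsum_(j < N)
   (if (i < K)%N && (j < K)%N then 0 else Cmod (a i) * Cmod (b j)))).
  apply: Rle_trans (Cmod_csum _ _ _) _; apply: ler_rsum => i _.
  rewrite csum_sub; apply: Rle_trans (Cmod_csum _ _ _) _; apply: ler_rsum => j _.
  case: ifP => [hlt|hge].
    rewrite /Cminus Cplus_opp_r Cmod_0; case: ifP => _; first lra.
    by apply: Rmult_le_pos; apply: Cmod_ge_0.
  rewrite /Cminus Cplus_0_l Cmod_opp Cmod_mult; case: ifP => [/andP [iK jK]|]; last by lra.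
  move/negbT: hge; rewrite -leqNgt => hge.
  suff : (h i j < N)%N by rewrite ltnNge hge.
  apply: leq_trans hN; rewrite leq_max; apply/orP; right.
  apply: leq_trans (leq_bigmax (Ordinal iK)).
  exact: (leq_bigmax (F := fun j : 'I_K => (h i j).+1) (Ordinal jK)).
have KN : (K <= N)%N by apply: leq_trans hN; rewrite leq_maxl.
have E : \rsum_(i < N) \rsum_(j < N)
   (if (i < K)%N && (j < K)%N then 0 else Cmod (a i) * Cmod (b j)) +
   (\rsum_(i < K) Cmod (a i)) * (\rsum_(j < K) Cmod (b j)) =
   (\rsum_(i < N) Cmod (a i)) * (\rsum_(j < N) Cmod (b j)).
  rewrite (big_ord_widen N (fun i => Cmod (a i))) // (big_ord_widen N (fun i => Cmod (b i))) //.
  rewrite [X in _ + X * _]big_mkcond [X in _ + _ * X]big_mkcond /= !big_distrlr /= -big_split /=.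
  apply: eq_bigr => i _; rewrite -big_split /=; apply: eq_bigr => j _.
  by case: (i < K)%N; case: (j < K)%N => /=; ring.
move: E (la1 N) (lb1 N) (la1 K) (lb1 K) k1 k2.
have p0 (u : nat -> C) M : 0 <= \rsum_(i < M) Cmod (u i).
  by apply: rsum_ge0 => i _; apply: Cmod_ge_0.
move: (p0 a N) (p0 b N) (p0 a K) (p0 b K).
move: (\rsum_(i < K) Cmod (a i)) (\rsum_(i < K) Cmod (b i)) => aK bK.
move: (\rsum_(i < N) Cmod (a i)) (\rsum_(i < N) Cmod (b i)) => aN bN.
move: (bigop.body _ _ _) => X p1 p2 p3 p4 E h1 h2 h3 h4 h5 h6.
have i1 : aN * bN <= LA * LB by apply: Rmult_le_compat.
have i2 : LA * (LB - bK) <= LA * d by apply: Rmult_le_compat_l; lra.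
have i3 : bK * (LA - aK) <= LB * d by apply: Rmult_le_compat; lra.
lra.
Qed.

(** * Power series and analytic functions *)

Definition near (z0 : C) (P : C -> Prop) :=
  exists r, 0 < r /\ forall z, Cmod (z - z0) < r -> P z.

Lemma locally_near z0 P : locally z0 P <-> near z0 P.
Proof.
split=> [|[r [r0 H]]].
  case=> -[r r0] H; exists r; split=> // z hz; apply: H.
  exact: C_NormedModule_mixin_compat1.
by apply: (locally_le_locally_norm (V := C_NormedModule)); exists (mkposreal r r0) => z; apply: H.
Qed.

Lemma locally'_near z0 P : locally' z0 P <-> near z0 (fun z => z <> z0 -> P z).
Proof. exact: locally_near. Qed.

Lemma near_and z0 P Q : near z0 P -> near z0 Q -> near z0 (fun z => P z /\ Q z).
Proof.
move=> [r [r0 H]] [s [s0 K]]; exists (Rmin r s); split; first exact: Rmin_glb_lt.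
move=> z hz; split; [apply: H|apply: K]; apply: Rlt_le_trans hz _; [exact: Rmin_l|exact: Rmin_r].
Qed.

Lemma near_imp z0 (P Q : C -> Prop) : (forall z, P z -> Q z) -> near z0 P -> near z0 Q.
Proof. by move=> h [r [r0 H]]; exists r; split=> // z /H /h. Qed.

Lemma Cminus_diag (z : C) : (z - z = 0)%C. Proof. by ring. Qed.

Lemma near_at z0 (P : C -> Prop) : near z0 P -> P z0.
Proof. by move=> [r [r0 H]]; apply: H; rewrite Cminus_diag Cmod_0. Qed.

Lemma near_near z0 (P : C -> Prop) : near z0 P -> near z0 (fun z => near z P).
Proof.
move=> [r [r0 H]]; exists (r / 2); split; first lra.
move=> z hz; exists (r / 2); split; first lra.
move=> w hw; apply: H.
have := Cmod_triangle (w - z) (z - z0).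
have -> : (w - z + (z - z0) = w - z0)%C by ring.
lra.
Qed.

Lemma near_neq z0 z : z <> z0 -> near z (fun w => w <> z0).
Proof.
move=> ne; exists (Cmod (z0 - z)); split; first by apply/Cmod_gt_0/Cminus_eq_contra => e;
  apply: ne.
by move=> w hw e; move: hw; rewrite e; lra.
Qed.

Definition pser (a : nat -> C) (w l : C) := sums (fun k => a k * w ^ k)%C l.

Lemma is_pseries_pser (a : nat -> C) (w l : C) :
  is_pseries (K := C_AbsRing) (V := C_NormedModule) a w l <-> pser a w l.
Proof.
have E k : scal (pow_n (K := C_AbsRing) w k) (a k) = (a k * w ^ k)%C.
  by rewrite Cmult_comm.
rewrite /is_pseries is_series_sums.
by split; apply: sums_ext => k; rewrite E.
Qed.

Lemma analytic_pser f z0 :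
  analytic_at f z0 <-> exists a, near z0 (fun z => pser a (z - z0)%C (f z)).
Proof.
split=> -[a H]; exists a; first move/locally_near: H; last apply/locally_near.
  by apply: near_imp => z /is_pseries_pser.
by apply: near_imp H => z /is_pseries_pser.
Qed.

Lemma sums_terms_bdd a l : sums a l -> exists M, 0 < M /\ forall n, Cmod (a n) <= M.
Proof.
move=> h; have [N HN] := h 1 Rlt_0_1.
have p0 m : 0 <= \rsum_(k < m) Cmod (a k) by apply: rsum_ge0 => i _; apply: Cmod_ge_0.
exists (2 + \rsum_(k < N) Cmod (a k)); split; first by have := p0 N; lra.
move=> n; case: (leqP N n) => hn.
  have h1 := HN n hn; have h2 := HN n.+1 (leqW hn); move: h2; rewrite csumS.
  move: (bigop.body _ _ _) h1 => x h1 h2.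
  have := Cmod_triangle (x + a n - l) (- (x - l)); rewrite Cmod_opp.
  have -> : (x + a n - l + - (x - l) = a n)%C by ring.
  by have := p0 N; lra.
apply: (Rle_trans _ (\rsum_(k < n.+1) Cmod (a k))).
  by rewrite (rsumS (fun k => Cmod (a k))); have := p0 n; lra.
by have := rsum_mono (fun k => Cmod_ge_0 (a k)) hn; lra.
Qed.

(** A power series expansion of [f] at [z0] with geometrically bounded
    coefficients. The factor 4 keeps a margin inside the disk of convergence:
    for [4 R |w| < 1] the terms are at most [M / 4^n], which leaves room for
    the factor [n <= 2^n] of a term by term difference quotient. *)
Definition expansion f z0 a M R :=
  [/\ 0 < M, 0 < R, (forall n, Cmod (a n) <= M * R ^ n) &
      forall z, Cmod (z - z0) * (4 * R) < 1 -> pser a (z - z0)%C (f z)].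

Lemma lt_inv4 (r R : R) : 0 < R -> r < / (4 * R) -> r * (4 * R) < 1.
Proof.
move=> R0 h; have -> : 1 = / (4 * R) * (4 * R) by field; lra.
by apply: Rmult_lt_compat_r => //; lra.
Qed.

Lemma near_disk (z0 : C) (R : R) : 0 < R -> near z0 (fun z => Cmod (z - z0) * (4 * R) < 1).
Proof.
move=> R0; exists (/ (4 * R)); split; first by apply: Rinv_0_lt_compat; lra.
by move=> z; apply: lt_inv4.
Qed.

Lemma expansion_mono f z0 a M R M' R' : expansion f z0 a M R -> M <= M' -> R <= R' ->
  expansion f z0 a M' R'.
Proof.
move=> [M0 R0 b s] hM hR; split; [lra|lra| |].
  move=> n; apply: Rle_trans (b n) _.
  apply: Rmult_le_compat => //; [lra|apply: pow_le; lra|apply: pow_incr; lra].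
move=> z hz; apply: s; have := Cmod_ge_0 (z - z0); nra.
Qed.

(** Convergence at one point different from the centre bounds the terms there,
    hence the coefficients geometrically. *)
Lemma analyticP f z0 : analytic_at f z0 <-> exists a M R, expansion f z0 a M R.
Proof.
rewrite analytic_pser; split=> [[a [r [r0 H]]]|[a [M [R [M0 R0 _ s]]]]]; last first.
  by exists a; apply: near_imp (near_disk z0 R0).
have := H (z0 + RtoC (r / 2))%C.
have -> : (z0 + RtoC (r / 2) - z0 = RtoC (r / 2))%C by ring.
rewrite Cmod_R Rabs_pos_eq; last lra.
move=> /(_ ltac:(lra)) /sums_terms_bdd [M [M0 HM]].
(* The series converges at distance [r / 2], so [1 / R = r / 2] is a legitimate radius. *)
exists a, M, (2 / r); have R0 : 0 < 2 / r by apply: Rdiv_lt_0_compat; lra.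
split=> // [n|z hz].
  have := HM n; rewrite Cmod_mult Cmod_pow Cmod_R Rabs_pos_eq; last lra.
  have -> : 2 / r = / (r / 2) by field; lra.
  rewrite pow_inv => hn; have hp : 0 < (r / 2) ^ n by apply: pow_lt; lra.
  apply: (Rmult_le_reg_r _ _ _ hp); rewrite Rmult_assoc Rinv_l; lra.
apply: H.
have e : 2 / r * r = 2 by field; lra.
have := Cmod_ge_0 (z - z0); nra.
Qed.

Lemma geo_bdd M n : 0 <= M -> \rsum_(k < n) (M * (1 / 2) ^ k) <= 2 * M.
Proof.
move=> M0.
suff -> : \rsum_(k < n) (M * (1 / 2) ^ k) = 2 * M * (1 - (1 / 2) ^ n).
  have : 0 < (1 / 2) ^ n by apply: pow_lt; lra.
  nra.
elim: n => [|n IH]; first by rewrite big_ord0 /=; lra.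
rewrite (rsumS (fun k => M * (1 / 2) ^ k)) IH /=; lra.
Qed.

Lemma geo_abs_bdd (u : nat -> C) M : 0 <= M ->
  (forall k, Cmod (u k) <= M * (1 / 2) ^ k) -> abs_bdd u (2 * M).
Proof.
move=> M0 h n; apply: Rle_trans (geo_bdd n M0).
by apply: ler_rsum => i _; apply: h.
Qed.

Lemma term_bdd a M R w : 0 < M -> 0 < R -> (forall n, Cmod (a n) <= M * R ^ n) ->
  Cmod w * (4 * R) < 1 -> forall k, Cmod (a k * w ^ k) <= M * (1 / 2) ^ k.
Proof.
move=> M0 R0 h hw k; rewrite Cmod_mult Cmod_pow.
have w0 := Cmod_ge_0 w.
apply: (Rle_trans _ (M * R ^ k * Cmod w ^ k)).
  by apply: Rmult_le_compat_r => //; apply: pow_le.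
rewrite Rmult_assoc -Rpow_mult_distr; apply: Rmult_le_compat_l; first lra.
by apply: pow_incr; nra.
Qed.

Lemma expansion_abs f z0 a M R z : expansion f z0 a M R -> Cmod (z - z0) * (4 * R) < 1 ->
  abs_bdd (fun k => a k * (z - z0) ^ k)%C (2 * M).
Proof. by move=> [M0 R0 b s] hz; apply: geo_abs_bdd; [lra|exact: (term_bdd M0 R0 b hz)]. Qed.

Lemma sums_finite (a : nat -> C) N : (forall n, (N <= n)%N -> a n =
  0) -> sums a (\csum_(k < N) a k).
Proof.
move=> h eps he; exists N => n /subnK <-.
suff -> : \csum_(k < n - N + N) a k = \csum_(k < N) a k by rewrite Cminus_diag Cmod_0.
elim: (n - N)%N => [|d IH] //.
by rewrite addSn csumS IH h ?Cplus_0_r // leq_addl.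
Qed.

Lemma Cpow0 n : (RtoC 0 ^ n.+1 = 0)%C.
Proof. by rewrite Cpow_S Cmult_0_l. Qed.

Lemma pser0 a l : pser a 0 l -> l = a 0%N.
Proof.
move=> h; apply: sums_unique h _.
have -> : a 0%N = \csum_(k < 1) (a k * 0 ^ k).
  by rewrite big_ord_recr big_ord0 /= Cplus_0_l Cmult_1_r.
by apply: sums_finite => -[|n] // _; rewrite Cpow0 Cmult_0_r.
Qed.

Lemma expansion_at f z0 a M R : expansion f z0 a M R -> f z0 = a 0%N.
Proof.
move=> [_ _ _ /(_ z0)]; rewrite Cminus_diag Cmod_0 Rmult_0_l => /(_ Rlt_0_1).
exact: pser0.
Qed.

Lemma analytic_ext f g z0 : near z0 (fun z => f z = g z) -> analytic_at f z0 -> analytic_at g z0.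
Proof.
move=> h /analytic_pser [a H]; apply/analytic_pser; exists a.
by apply: near_imp (near_and h H) => z [<-].
Qed.

Lemma analytic_const c z0 : analytic_at (fun=> c) z0.
Proof.
pose a n := if n is 0%N then c else RtoC 0.
apply/analytic_pser; exists a; exists 1; split; first lra; move=> z _.
have -> : c = \csum_(k < 1) (a k * (z - z0) ^ k).
  by rewrite big_ord_recr big_ord0 /= Cplus_0_l Cmult_1_r.
by apply: sums_finite => -[|n] // _; rewrite Cmult_0_l.
Qed.

Lemma analytic_plus f g z0 : analytic_at f z0 -> analytic_at g z0 ->
  analytic_at (fun z => f z + g z)%C z0.
Proof.
move=> /analytic_pser [a H] /analytic_pser [b K]; apply/analytic_pser.
exists (fun n => a n + b n)%C; apply: near_imp (near_and H K) => z [h k].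
by apply: sums_ext (sums_plus h k) => n; rewrite Cmult_plus_distr_r.
Qed.

Lemma cauchy_diag (a b : nat -> C) m :
  \csum_(i < m.+1) \csum_(j < m.+1 | (i + j == m)%N) (a i * b j) =
  \csum_(i < m.+1) (a i * b (m - i)%N).
Proof.
apply: eq_bigr => i _.
have h : (m - i < m.+1)%N by rewrite ltnS leq_subr.
rewrite (big_pred1 (Ordinal h)) // => j /=.
have hi : (i <= m)%N by rewrite -ltnS.
by rewrite -val_eqE -[RHS](eqn_add2l i) /= (subnKC hi).
Qed.

Lemma cauchy_prod (a b : nat -> C) A B alpha beta :
  abs_bdd a alpha -> abs_bdd b beta -> sums a A -> sums b B ->
  sums (fun m => \csum_(i < m.+1) (a i * b (m - i)%N)) (A * B)%C.
Proof.
move=> ha hb sa sb; apply: sums_ext (cauchy_diag a b) _.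
by apply: (@prod_sums addn) ha hb sa sb => i j; rewrite ?leq_addr ?leq_addl.
Qed.

Definition conv (a b : nat -> C) m := \csum_(i < m.+1) (a i * b (m - i)%N).

Lemma conv_pser a b w A B alpha beta :
  abs_bdd (fun k => a k * w ^ k)%C alpha -> abs_bdd (fun k => b k * w ^ k)%C beta ->
  pser a w A -> pser b w B -> pser (conv a b) w (A * B)%C.
Proof.
move=> ha hb sa sb; apply: sums_ext (cauchy_prod ha hb sa sb) => m.
rewrite /conv big_distrl; apply: eq_bigr => i _ /=.
have hi : (i <= m)%N by rewrite -ltnS.
by have -> : (w ^ m = w ^ (i + (m - i)))%C; [congr Cpow; rewrite -plusE -minusE; move/leP: hi;
  lia|rewrite Cpow_add_r; ring].
Qed.

Lemma analytic_mult f g z0 : analytic_at f z0 -> analytic_at g z0 ->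
  analytic_at (fun z => f z * g z)%C z0.
Proof.
move=> /analyticP [a [M [R p]]] /analyticP [b [M' [R' q]]]; apply/analytic_pser.
exists (conv a b).
have {}p := expansion_mono p (Rle_refl _) (Rmax_l R R').
have {}q := expansion_mono q (Rle_refl _) (Rmax_r R R').
move: (Rmax R R') p q => S p q.
have [_ S0 _ sa] := p; have [_ _ _ sb] := q.
apply: near_imp (near_disk z0 S0) => z hz.
exact: conv_pser (expansion_abs p hz) (expansion_abs q hz) (sa _ hz) (sb _ hz).
Qed.

(** * Reciprocals of power series *)

(** The coefficients [b] of a reciprocal solve [a_0 b_m = [m = 0] - sum a_i b_(m-i)],
    where only indices below [m] occur on the right. Iterating this map from any
    start fixes the first [k] coefficients after [k] steps, which replaces a
    course-of-values recursion. *)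
Definition recip_step (a b : nat -> C) (m : nat) : C :=
  ((if m == 0%N then RtoC 1 else RtoC 0) - \csum_(i < m) (a i.+1 * b (m - i.+1)%N)) / a 0%N.

Definition recip (a : nat -> C) (m : nat) : C :=
  iter m.+1 (recip_step a) (fun=> RtoC 0) m.

Lemma recip_stable a k m : (m < k)%N -> iter k (recip_step a) (fun=> RtoC 0) m = recip a m.
Proof.
elim/ltn_ind: m k => m IH [//|k] hm; rewrite /recip /= /recip_step.
congr ((_ - _) / _)%C; apply: eq_bigr => i _; congr (_ * _)%C.
have lt : (m - i.+1 < m)%N by rewrite ltn_subrL (leq_ltn_trans _ (ltn_ord i)).
by rewrite !IH // (leq_trans lt).
Qed.

Lemma recip_eq a m : recip a m = recip_step a (recip a) m.
Proof.
rewrite {1}/recip /= {1}/recip_step /recip_step.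
congr ((_ - _) / _)%C; apply: eq_bigr => i _; congr (_ * _)%C.
by apply: recip_stable; rewrite ltn_subrL (leq_ltn_trans _ (ltn_ord i)).
Qed.

Lemma conv_recip (a : nat -> C) m : a 0%N <> 0 -> conv a (recip a) m =
  if m == 0%N then RtoC 1 else RtoC 0.
Proof.
move=> a0; rewrite /conv big_ord_recl subn0 recip_eq /recip_step.
set s := \csum_(i < m) _.
by rewrite /=; field.
Qed.

(** With [B = 1 / |a_0|] the bound [B Q^m] reproduces itself through the
    recursion as soon as [M B] times the sum of [R^i Q^(m-i)] over [1 <= i <= m]
    is at most [Q^m]; this holds by induction for [Q = R (1 + M B)]. *)
Lemma recip_bound (a : nat -> C) M R : a 0%N <> 0 -> 0 < M -> 0 < R -> (forall n, Cmod (a n) <=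
  M * R ^ n) ->
  exists M' R', [/\ 0 < M', 0 < R' & forall n, Cmod (recip a n) <= M' * R' ^ n].
Proof.
move=> a0 M0 R0 h.
have ha0 : 0 < Cmod (a 0%N) by apply/Cmod_gt_0.
pose B := / Cmod (a 0%N); have B0 : 0 < B by apply: Rinv_0_lt_compat.
pose Q := R * (1 + M * B).
have Q0 : 0 < Q by apply: Rmult_lt_0_compat => //; nra.
exists B, Q; split=> //.
have T m : M * B * (\rsum_(i < m) (R ^ i.+1 * Q ^ (m - i.+1))) <= Q ^ m.
  elim: m => [|m IH]; first by rewrite big_ord0 /=; lra.
  rewrite big_ord_recl subSS subn0 /=.
  set t := bigop.body _ _ _.
  have -> : t = R * (\rsum_(i < m) (R ^ i.+1 * Q ^ (m - i.+1))).
    by rewrite big_distrr; apply: eq_bigr => i _; rewrite /= /bump leq0n add1n subSS add0n; ring.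
  have := pow_lt Q m Q0.
  move: IH; move: (\rsum_(i < m) _) (Q ^ m) => x q IH q0.
  have := Rmult_le_compat_l R _ _ (Rlt_le _ _ R0) IH; rewrite /Q; nra.
elim/ltn_ind => -[|m] IH.
  rewrite recip_eq /recip_step big_ord0 eqxx /= Rmult_1_r.
  have -> : ((1 - 0) / a 0%N = / a 0%N)%C by field.
  by rewrite Cmod_inv //; apply: Rle_refl.
rewrite recip_eq /recip_step /= Cmod_div // /Rdiv -/B Rmult_comm.
apply: Rmult_le_compat_l; first lra.
rewrite /Cminus Cplus_0_l Cmod_opp; apply: Rle_trans (Cmod_csum _ _ _) _.
apply: Rle_trans (T m.+1); rewrite big_distrr /=; apply: ler_rsum => i _.
rewrite Cmod_mult.
have := h i.+1; have := IH (m.+1 - i.+1)%N; rewrite subSS ltnS leq_subr => /(_ isT).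
have := Cmod_ge_0 (a i.+1); have := Cmod_ge_0 (recip a (m - i)).
move: (Cmod _) (Cmod _) => x y x0 y0 hx hy.
apply: (Rle_trans _ (M * R ^ i.+1 * (B * Q ^ (m - i)))); first exact: Rmult_le_compat.
by right; rewrite /=; ring.
Qed.

Lemma analytic_inv f z0 : analytic_at f z0 -> f z0 <> 0 -> analytic_at (fun z => / f z)%C z0.
Proof.
move=> /analyticP [a [M [R p]]] f0; apply/analytic_pser; exists (recip a).
have [M0 R0 ha _] := p; have a0 : a 0%N <> 0 by rewrite -(expansion_at p).
have [M' [R' [M'0 R'0 hb]]] := recip_bound a0 M0 R0 ha.
have {}p := expansion_mono p (Rle_refl _) (Rmax_l R R').
have {}hb n : Cmod (recip a n) <= M' * Rmax R R' ^ n.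
  apply: Rle_trans (hb n) _; apply: Rmult_le_compat_l; first lra.
  by apply: pow_incr; split; [lra|exact: Rmax_r].
move: (Rmax R R') p hb => S p hb.
have [_ S0 _ sa] := p.
apply: near_imp (near_disk z0 S0) => z hz.
have bb : abs_bdd (fun k => recip a k * (z - z0) ^ k)%C (2 * M').
  by apply: geo_abs_bdd; [lra|exact: (term_bdd M'0 S0 hb hz)].
have [l sl] := abs_bdd_sums bb.
have := conv_pser (expansion_abs p hz) bb (sa _ hz) sl => s1.
have : (f z * l = 1)%C.
  apply: sums_unique s1 _.
  have -> : RtoC 1 = \csum_(k < 1) (conv a (recip a) k * (z - z0) ^ k).
    by rewrite big_ord_recr big_ord0 /= conv_recip // Cplus_0_l Cmult_1_r.
  by apply: sums_finite => -[|n] // _; rewrite conv_recip // Cmult_0_l.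
move=> e1; have fz : f z <> 0 by move=> e0; move: e1; rewrite e0 Cmult_0_l => /RtoC_inj; lra.
suff -> : (/ f z = l)%C by [].
by rewrite -[l]Cmult_1_l -(Cinv_l _ fz) -Cmult_assoc e1; ring.
Qed.

Lemma analytic_affine f (al be : C) z0 : analytic_at f (al * z0 + be)%C ->
  analytic_at (fun z => f (al * z + be))%C z0.
Proof.
move=> /analytic_pser [a [r [r0 H]]]; apply/analytic_pser.
exists (fun n => a n * al ^ n)%C.
have al0 := Cmod_ge_0 al.
exists (r / (Cmod al + 1)); split; first by apply: Rdiv_lt_0_compat; lra.
move=> z hz.
have E : (al * z + be - (al * z0 + be) = al * (z - z0))%C by ring.
have := H (al * z + be)%C; rewrite E => h.
apply: sums_ext (h _) => [n|]; first by rewrite Cpow_mult_l; ring.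
rewrite Cmod_mult.
have e : r / (Cmod al + 1) * (Cmod al + 1) = r by field; lra.
have := Cmod_ge_0 (z - z0); nra.
Qed.

(** * Continuity and zeros of analytic functions *)

Lemma pow_lip rho x y n : 0 < rho -> Cmod x <= rho -> Cmod y <= rho ->
  rho * Cmod (x ^ n - y ^ n) <= INR n * rho ^ n * Cmod (x - y).
Proof.
move=> r0 hx hy; elim: n => [|n IH].
  by rewrite Cminus_diag Cmod_0 /=; lra.
rewrite S_INR !Cpow_S.
have -> : (x * x ^ n - y * y ^ n = x * (x ^ n - y ^ n) + (x - y) * y ^ n)%C by ring.
have := Cmod_triangle (x * (x ^ n - y ^ n)) ((x - y) * y ^ n).
rewrite !Cmod_mult Cmod_pow => T.
have h1 : Cmod y ^ n <= rho ^ n by apply: pow_incr; split=> //; apply: Cmod_ge_0.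
have := Cmod_ge_0 (x - y); have := Cmod_ge_0 (x ^ n - y ^ n); have := Cmod_ge_0 x.
have := pow_lt rho n r0; rewrite -tech_pow_Rmult.
have : 0 <= Cmod y ^ n by apply: pow_le; apply: Cmod_ge_0.
move: (Cmod (x - y)) (Cmod (x ^ n - y ^ n)) (Cmod x) (Cmod y ^ n) (rho ^ n) hx IH h1 T.
move=> d dn mx yn rn hx IH h1 T yn0 rn0 mx0 dn0 d0.
have i1 : rho * (mx * dn) <= rho * (INR n * rn * d).
  by apply: Rmult_le_compat_l; nra.
have i2 : rho * (d * yn) <= rho * (d * rn) by apply: Rmult_le_compat_l; nra.
nra.
Qed.

Lemma INR_le_pow2 n : INR n <= 2 ^ n.
Proof.
elim: n => [|n IH]; first by simpl; lra.
rewrite S_INR /=; have : 1 <= 2 ^ n by apply: pow_R1_Rle; lra.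
lra.
Qed.

(** Term by term, [|x^k - y^k| <= k rho^(k-1) |x - y|] with [rho = 1 / (4 R)].
    This makes [f] continuous on the whole disk without expanding it again at
    another centre. *)
Lemma expansion_lip f z0 a M R z w : expansion f z0 a M R ->
  Cmod (z - z0) * (4 * R) < 1 -> Cmod (w - z0) * (4 * R) < 1 ->
  Cmod (f z - f w) <= 8 * M * R * Cmod (z - w).
Proof.
move=> [M0 R0 b s] hz hw.
have := sums_plus (s z hz) (sums_scal (-1) (s w hw)).
have -> : (f z + -1 * f w = f z - f w)%C by ring.
apply: sums_bound => n.
have K0 : 0 <= 4 * M * R * Cmod (z - w).
  by apply: Rmult_le_pos; [nra|exact: Cmod_ge_0].
have -> : 8 * M * R * Cmod (z - w) = 2 * (4 * M * R * Cmod (z - w)) by ring.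
apply: Rle_trans (geo_bdd n K0); apply: ler_rsum => k _.
have -> : (a k * (z - z0) ^ k + -1 * (a k * (w - z0) ^ k) =
  a k * ((z - z0) ^ k - (w - z0) ^ k))%C.
  by ring.
rewrite Cmod_mult.
pose rho := / (4 * R); have r0 : 0 < rho by apply: Rinv_0_lt_compat; lra.
have e : rho * (4 * R) = 1 by rewrite /rho; field; lra.
have := @pow_lip rho (z - z0) (w - z0) k r0.
have -> : (z - z0 - (w - z0) = z - w)%C by ring.
move=> /(_ ltac:(nra) ltac:(nra)) h.
have hk := INR_le_pow2 k.
have hb := b k.
have E : rho ^ k = (1 / 2) ^ k * (1 / 2) ^ k * / R ^ k.
  rewrite -pow_inv -!Rpow_mult_distr /rho; congr pow; field; lra.
have p2 : (1 / 2) ^ k * 2 ^ k = 1.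
  by rewrite -Rpow_mult_distr (_ : 1 / 2 * 2 = 1) ?pow1 //; lra.
have pR : 0 < R ^ k by apply: pow_lt.
have ph : 0 < (1 / 2) ^ k by apply: pow_lt; lra.
have d0 := Cmod_ge_0 (z - w).
have x0 := Cmod_ge_0 ((z - z0) ^ k - (w - z0) ^ k).
move: h; rewrite E; move: (Cmod ((z - z0) ^ k - (w - z0) ^ k)) x0 => x x0 h.
have {}h : x <= 4 * R * ((1 / 2) ^ k * / R ^ k * Cmod (z - w)).
  have -> : x = 4 * R * (rho * x) by rewrite -{1}[x]Rmult_1_l -e; ring.
  apply: Rmult_le_compat_l; first lra.
  apply: Rle_trans h _.
  have -> : INR k * ((1 / 2) ^ k * (1 / 2) ^ k * / R ^ k) * Cmod (z - w) =
     (INR k * (1 / 2) ^ k) * ((1 / 2) ^ k * / R ^ k * Cmod (z - w)) by ring.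
  rewrite -[X in _ <= X]Rmult_1_l; apply: Rmult_le_compat_r; last by nra.
  apply: Rmult_le_pos => //; apply: Rmult_le_pos; first lra.
  by left; apply: Rinv_0_lt_compat.
apply: (Rle_trans _ (M * R ^ k * (4 * R * ((1 / 2) ^ k * / R ^ k * Cmod (z - w))))).
  apply: Rmult_le_compat => //; exact: Cmod_ge_0.
right; field; lra.
Qed.

(** Punctured limits: the value of [f] at [z0] is not constrained. *)
Definition plim (f : C -> C) (z0 l : C) :=
  forall eps, 0 < eps -> near z0 (fun z => z <> z0 -> Cmod (f z - l) < eps).

Definition cont (f : C -> C) (z0 : C) := plim f z0 (f z0).

Lemma exists_near z0 (P : C -> Prop) : near z0 P -> exists z, z <> z0 /\ P z.
Proof.
move=> [r [r0 H]]; exists (z0 + RtoC (r / 2))%C.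
have E : (z0 + RtoC (r / 2) - z0 = RtoC (r / 2))%C by ring.
have M : Cmod (RtoC (r / 2)) = r / 2 by rewrite Cmod_R Rabs_pos_eq; lra.
split; last by apply: H; rewrite E M; lra.
move=> e; move: E M; rewrite e Cminus_diag => <-; rewrite Cmod_0; lra.
Qed.

Lemma plim_unique f z0 l l' : plim f z0 l -> plim f z0 l' -> l = l'.
Proof.
move=> h h'; apply: NNPP => ne.
have d : 0 < Cmod (l - l') by apply/Cmod_gt_0/Cminus_eq_contra.
have := near_and (h (Cmod (l - l') / 2) ltac:(lra)) (h' (Cmod (l - l') / 2) ltac:(lra)).
move=> /exists_near [z [nz [/(_ nz) a /(_ nz) b]]].
have := Cmod_triangle (f z - l') (- (f z - l)); rewrite Cmod_opp.
have -> : ((f z - l') + - (f z - l) = l - l')%C by ring.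
lra.
Qed.

Lemma plim_ext f g z0 l : near z0 (fun z => z <> z0 -> f z = g z) -> plim f z0 l -> plim g z0 l.
Proof.
by move=> h H eps /H k; apply: near_imp (near_and h k) => z [e hk] nz; rewrite -e //; apply: hk.
Qed.

Lemma expansion_cont f z0 a M R z : expansion f z0 a M R -> Cmod (z - z0) * (4 * R) < 1 ->
  cont f z.
Proof.
move=> p hz eps he; have [M0 R0 _ _] := p.
have nw : near z (fun w => Cmod (w - z0) * (4 * R) < 1).
  exists (/ (4 * R) - Cmod (z - z0)).
  have e : / (4 * R) * (4 * R) = 1 by field; lra.
  split; first by nra.
  move=> w hw; have := Cmod_triangle (w - z) (z - z0).
  have -> : (w - z + (z - z0) = w - z0)%C by ring.
  nra.
have [r [r0 H]] := nw.
have K0 : 0 < 8 * M * R by nra.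
exists (Rmin r (eps / (8 * M * R))); split.
  by apply: Rmin_glb_lt => //; apply: Rdiv_lt_0_compat.
move=> w hw _.
have h1 : Cmod (w - z) < r by apply: Rlt_le_trans hw (Rmin_l _ _).
have h2 : Cmod (w - z) < eps / (8 * M * R) by apply: Rlt_le_trans hw (Rmin_r _ _).
apply: Rle_lt_trans (expansion_lip p (H _ h1) hz) _.
have -> : eps = 8 * M * R * (eps / (8 * M * R)) by field; lra.
exact: Rmult_lt_compat_l.
Qed.

Lemma analytic_cont_near f z0 : analytic_at f z0 -> near z0 (cont f).
Proof.
move=> /analyticP [a [M [R p]]]; have [M0 R0 _ _] := p.
by apply: near_imp (near_disk z0 R0) => w; apply: expansion_cont p.
Qed.

Lemma analytic_cont f z0 : analytic_at f z0 -> cont f z0.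
Proof. by move=> /analytic_cont_near /near_at. Qed.

Lemma analytic_neq0 f z0 : analytic_at f z0 -> f z0 <> 0 -> near z0 (fun z => f z <> 0).
Proof.
move=> /analytic_cont h f0.
have [r [r0 H]] := h _ (proj1 (Cmod_gt_0 _) f0).
exists r; split=> // z hz e; case: (classic (z = z0)) => [E|nz]; first by apply: f0; rewrite -E.
have := H z hz nz; rewrite e; have -> : (0 - f z0 = - f z0)%C by ring.
rewrite Cmod_opp; lra.
Qed.

(** Either all coefficients vanish, or the first nonzero one gives the order of
    the zero and the shifted series gives the cofactor. *)
Lemma analytic_factor f z0 : analytic_at f z0 ->
  near z0 (fun z => f z = 0) \/
  exists k h, [/\ analytic_at h z0, h z0 <> 0 & near z0 (fun z => f z = h z * (z - z0) ^ k)%C].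
Proof.
move=> /analyticP [a [M [R p]]]; have [M0 R0 b s] := p.
have nr := near_disk z0 R0.
case: (classic (exists k, a k <> 0)) => [ex|nex]; last first.
  left; apply: near_imp nr => z /s h; apply: sums_unique h _.
  have -> : RtoC 0 = \csum_(k < 0) (a k * (z - z0) ^ k) by rewrite big_ord0.
  apply: sums_finite => n _; suff -> : a n = 0 by rewrite Cmult_0_l.
  by apply: NNPP => h; apply: nex; exists n.
right.
have [k [ak low]] : exists k, a k <> 0 /\ forall j, (j < k)%N -> a j = 0.
  case: ex => k; elim/ltn_ind: k => k IH ak.
  case: (classic (exists j, (j < k)%N /\ a j <> 0)) => [[j [jk aj]]|nj]; first exact: IH jk aj.
  by exists k; split=> // j jk; apply: NNPP => aj; apply: nj; exists j.
pose h z := if excluded_middle_informative (z = z0) then a k else (f z / (z - z0) ^ k)%C.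
have hz0 : h z0 = a k by rewrite /h; case: excluded_middle_informative.
have hE z : z <> z0 -> (h z = f z / (z - z0) ^ k)%C.
  by rewrite /h; case: excluded_middle_informative.
have pw z : z <> z0 -> ((z - z0) ^ k <> 0)%C by move=> nz; apply: Cpow_nz;
  apply: Cminus_eq_contra.
have pz : pser (fun n => a (n + k)%N) (z0 - z0) (h z0).
  rewrite Cminus_diag hz0.
  have -> : a k = \csum_(j < 1) (a (j + k)%N * 0 ^ j).
    by rewrite big_ord_recr big_ord0 /= add0n Cplus_0_l Cmult_1_r.
  by apply: sums_finite => -[|n] // _; rewrite Cpow0 Cmult_0_r.
have hs : near z0 (fun z => pser (fun n => a (n + k)%N) (z - z0) (h z)).
  apply: near_imp nr => z hz.
  case: (classic (z = z0)) => [->//|nz].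
  move=> eps he.
  have q0 : 0 < Cmod ((z - z0) ^ k) by apply/Cmod_gt_0; apply: pw.
  have [N HN] := s z hz (eps * Cmod ((z - z0) ^ k)) ltac:(nra).
  exists N => n hn; have := HN (n + k)%N (leq_trans hn (leq_addr _ _)).
  have -> : \csum_(j < n + k) (a j * (z - z0) ^ j) =
            ((z - z0) ^ k * (\csum_(j < n) (a (j + k)%N * (z - z0) ^ j)))%C.
    elim: n {hn} => [|n IH].
      by rewrite big_ord0 Cmult_0_r add0n big1 // => i _; rewrite low // Cmult_0_l.
    rewrite addSn (csumS (fun j => a j * (z - z0) ^ j)%C) IH.
    by rewrite (csumS (fun j => a (j + k)%N * (z - z0) ^ j)%C) Cpow_add_r; ring.
  rewrite hE //; set S := bigop.body _ _ _.
  have -> : ((z - z0) ^ k * S - f z = (S - f z / (z - z0) ^ k) * (z - z0) ^ k)%C.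
    by field; apply: pw.
  by rewrite Cmod_mult; move/Rmult_lt_reg_r; apply.
exists k, h; split; first by apply/analytic_pser; exists (fun n => a (n + k)%N).
  by rewrite hz0.
apply: near_imp nr => z hz; case: (classic (z = z0)) => [->|nz]; last first.
  by rewrite hE //; field; apply: pw.
rewrite Cminus_diag (expansion_at p) hz0; case: (k) ak low => [|j] _ low;
  first by rewrite Cmult_1_r.
by rewrite Cpow0 Cmult_0_r low.
Qed.

(** * The exponential as a power series *)

Definition eterm (w : C) (n : nat) : C := (RtoC (/ INR (fact n)) * w ^ n)%C.

Lemma INR_fact n : 0 < INR (fact n).
Proof. exact: INR_fact_lt_0. Qed.

Lemma INRS_neq0 n : RtoC (INR n.+1) <> 0.
Proof. by move/RtoC_inj; apply: not_0_INR. Qed.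

Lemma csumSl (a : nat -> C) n : (\csum_(i < n.+1) a i = a 0%N + \csum_(i < n) a i.+1)%C.
Proof. by rewrite big_ord_recl. Qed.

Lemma Cmult_cancel (c x y : C) : c <> 0 -> (c * x = c * y)%C -> x = y.
Proof.
move=> c0 E; rewrite -[x]Cmult_1_l -[y]Cmult_1_l -(Cinv_l _ c0) -!Cmult_assoc.
by rewrite E.
Qed.

Lemma eterm_S w n : (RtoC (INR n.+1) * eterm w n.+1 = w * eterm w n)%C.
Proof.
rewrite /eterm (_ : fact n.+1 = (n.+1 * fact n)%N) // mult_INR Cpow_S.
have h := INR_fact n; have h2 := @INRS_neq0 n.
rewrite !RtoC_inv ?RtoC_mult; [|lra|].
  by field; split=> // /RtoC_inj; lra.
by apply: Rmult_integral_contrapositive; split; [apply: not_0_INR|lra].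
Qed.

(** The binomial theorem in the form used by Cauchy products. It follows from
    [(n + 1) c_(n+1) = (x + y) c_n], obtained by splitting the factor [n + 1] as
    [i + (n + 1 - i)] inside the sum. *)
Lemma eterm_binomial x y n :
  \csum_(i < n.+1) (eterm x i * eterm y (n - i)%N) = eterm (x + y) n.
Proof.
elim: n => [|n IH].
  by rewrite big_ord_recr big_ord0 /= Cplus_0_l /eterm /= Rinv_1; ring.
suff E : (RtoC (INR n.+1) * (\csum_(i < n.+2) (eterm x i * eterm y (n.+1 - i)%N)) =
          RtoC (INR n.+1) * eterm (x + y) n.+1)%C.
  exact: Cmult_cancel (@INRS_neq0 n) E.
rewrite eterm_S -IH Cmult_plus_distr_r !big_distrr.
transitivity ((\csum_(i < n.+2) (RtoC (INR i) * eterm x i * eterm y (n.+1 - i)%N)) +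
   \csum_(i < n.+2) (eterm x i * (RtoC (INR (n.+1 - i)) * eterm y (n.+1 - i)%N)))%C.
  rewrite -big_split; apply: eq_bigr => i _;
    rewrite -[LHS]/(RtoC (INR n.+1) * (eterm x i * eterm y (n.+1 - i)%N))%C -[RHS]/(RtoC (INR
    i) * eterm x i * eterm y (n.+1 - i)%N + eterm x i * (RtoC (INR (n.+1 - i)) * eterm y (n.+1
    - i)%N))%C.
  have hi : (i <= n.+1)%N by rewrite -ltnS.
  have -> : INR n.+1 = INR i + INR (n.+1 - i) by rewrite -plus_INR plusE subnKC.
  by rewrite RtoC_plus; ring.
congr (_ + _)%C.
  rewrite (csumSl (fun i => RtoC (INR i) * eterm x i * eterm y (n.+1 - i)%N)%C) !Cmult_0_l
    Cplus_0_l.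
  by apply: eq_bigr => i _; rewrite eterm_S subSS -[RHS]/(x * (eterm x i * eterm y (n -
    i)%N))%C Cmult_assoc.
rewrite (csumS (fun i => eterm x i * (RtoC (INR (n.+1 - i)) * eterm y (n.+1 - i)%N))%C).
rewrite subnn Cmult_0_l Cmult_0_r Cplus_0_r; apply: eq_bigr => i _.
have hi : (i <= n)%N by rewrite -ltnS.
rewrite subSn // eterm_S -[RHS]/(y * (eterm x i * eterm y (n - i)%N))%C; ring.
Qed.

Lemma infinite_sum_sums (a : nat -> R) l : infinite_sum a l ->
  sums (fun k => RtoC (a k)) (RtoC l).
Proof.
move=> h eps he; have [N HN] := h eps he.
exists N.+1 => -[//|n] hn; have := HN n (le_S_n _ _ (elimT leP hn)).
have -> : \csum_(k < n.+1) RtoC (a k) = RtoC (sum_f_R0 a n).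
  elim: n {hn} => [|n IH]; first by rewrite big_ord_recr big_ord0 /= Cplus_0_l.
  by rewrite (csumS (fun k => RtoC (a k))) IH /= RtoC_plus.
by rewrite -RtoC_minus Cmod_R.
Qed.

Lemma eterm_exp (x : R) : sums (eterm x) (exp x).
Proof.
have := infinite_sum_sums (proj2_sig (exist_exp x)).
by apply: sums_ext => n; rewrite /eterm -RtoC_pow -RtoC_mult.
Qed.

Lemma eterm_abs w : abs_bdd (eterm w) (exp (Cmod w)).
Proof.
move=> n; have h := eterm_exp (Cmod w).
have E k : eterm (Cmod w) k = RtoC (Cmod (eterm w k)).
  rewrite /eterm -RtoC_pow -RtoC_mult Cmod_mult Cmod_pow Cmod_R Rabs_pos_eq //.
  by left; apply: Rinv_0_lt_compat; apply: INR_fact.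
have S m : \csum_(k < m) eterm (Cmod w) k = RtoC (\rsum_(k < m) Cmod (eterm w k)).
  elim: m => [|m IH]; first by rewrite !big_ord0.
  by rewrite csumS (rsumS (fun k => Cmod (eterm w k))) IH RtoC_plus E.
apply: le_epsilon => eps he; have [N HN] := h eps he.
have := HN (maxn n N) (leq_maxr _ _); rewrite S -RtoC_minus Cmod_R => /Rabs_def2 [].
have := rsum_mono (fun k => Cmod_ge_0 (eterm w k)) (leq_maxl n N); lra.
Qed.

Lemma eterm_sum w : exists l, sums (eterm w) l.
Proof. exact: abs_bdd_sums (@eterm_abs w). Qed.

Lemma cvs_double u l : cvs u l -> cvs (fun n => u n.*2) l.
Proof.
move=> h eps /h [N HN]; exists N => n hn; apply: HN.
by apply: leq_trans hn _; rewrite -addnn leq_addr.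
Qed.

Lemma Ci2 : (Ci * Ci = -1)%C.
Proof. by rewrite /Ci /Cmult /RtoC /Copp /=; congr pair; ring. Qed.

(** The partial sums of even length separate into those of the cosine and sine
    series; the limit exists by absolute convergence, so these partial sums
    determine it. *)
Lemma eterm_Ci (y : R) : sums (eterm (RtoC y * Ci)) (cos y, sin y).
Proof.
have [l hl] := eterm_sum (RtoC y * Ci)%C.
suff <- : l = (cos y, sin y) by [].
apply: cvs_unique (cvs_double hl) _.
have hc : sums (fun k => RtoC (cos_n k * (Rsqr y) ^ k)) (cos y).
  by apply: infinite_sum_sums; rewrite /cos; case: (exist_cos _) => c hc.
have hs : sums (fun k => Ci * RtoC y * RtoC (sin_n k * (Rsqr y) ^ k))%C (Ci * RtoC (sin y))%C.
  rewrite /sin; case: (exist_sin _) => c hc'; rewrite RtoC_mult Cmult_assoc.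
  exact/sums_scal/infinite_sum_sums.
have -> : (cos y, sin y) = (RtoC (cos y) + Ci * RtoC (sin y))%C.
  by rewrite /Cplus /Cmult /Ci /RtoC /=; congr pair; ring.
apply: cvs_ext (sums_plus hc hs) => n.
have P k : ((RtoC y * Ci) ^ k.*2 = RtoC ((-1) ^ k * Rsqr y ^ k))%C.
  elim: k => [|k IH]; first by rewrite /= Rmult_1_l.
  rewrite doubleS !Cpow_S IH -!tech_pow_Rmult !RtoC_mult.
  have -> : RtoC (-1) = (Ci * Ci)%C by rewrite Ci2.
  ring.
elim: n => [|n IH]; first by rewrite !big_ord0.
rewrite (csumS (fun k => RtoC (cos_n k * Rsqr y ^ k) + Ci * RtoC y * RtoC (sin_n k * Rsqr y ^
  k))%C) IH doubleS !csumS -Cplus_assoc; congr (_ + _)%C.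
rewrite /eterm Cpow_S P /cos_n /sin_n.
have -> : (2 * n)%coq_nat = n.*2 by rewrite multE mul2n.
have -> : (n.*2 + 1)%coq_nat = n.*2.+1 by rewrite plusE addn1.
rewrite /Rdiv !RtoC_mult; ring.
Qed.

Lemma Cexp_sum w : sums (eterm w) (Cexp w).
Proof.
have -> : Cexp w = (RtoC (exp (Re w)) * (cos (Im w), sin (Im w)))%C by [].
have := cauchy_prod (@eterm_abs (Re w)) (@eterm_abs (RtoC (Im w) * Ci)) (eterm_exp (Re w))
  (eterm_Ci (Im w)).
apply: sums_ext => n; rewrite eterm_binomial; congr eterm.
by case: w => x y; rewrite /Cplus /Cmult /Ci /RtoC /=; congr pair; ring.
Qed.

Lemma Cexp_plus x y : Cexp (x + y) = (Cexp x * Cexp y)%C.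
Proof.
apply: sums_unique (Cexp_sum _) _.
apply: sums_ext (cauchy_prod (@eterm_abs x) (@eterm_abs y) (Cexp_sum x) (Cexp_sum y)) => n.
exact: eterm_binomial.
Qed.

Lemma Cmod_Cexp z : Cmod (Cexp z) = exp (Re z).
Proof.
rewrite /Cexp Cmod_mult Cmod_R Rabs_pos_eq; last by left; apply: exp_pos.
rewrite -[RHS]Rmult_1_r; congr Rmult.
rewrite /Cmod /=.
have -> : forall c s, c * (c * 1) + s * (s * 1) = Rsqr s + Rsqr c by rewrite /Rsqr => *; ring.
by rewrite sin2_cos2 sqrt_1.
Qed.

Lemma analytic_Cexp z0 : analytic_at Cexp z0.
Proof.
apply/analytic_pser; exists (fun n => Cexp z0 * RtoC (/ INR (fact n)))%C.
exists 1; split; first lra; move=> z _.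
have -> : Cexp z = (Cexp z0 * Cexp (z - z0))%C by rewrite -Cexp_plus; congr Cexp; ring.
by apply: sums_ext (sums_scal _ (Cexp_sum _)) => n; rewrite /eterm Cmult_assoc.
Qed.

Lemma analytic_cpow x al be z0 : analytic_at (fun z => cpow x (al * z + be)) z0.
Proof.
apply: (analytic_ext (f := fun z => Cexp (al * RtoC (ln x) * z + be * RtoC (ln x)))).
  by exists 1; split; [lra|move=> z _; rewrite /cpow; congr Cexp; ring].
exact/analytic_affine/analytic_Cexp.
Qed.

(** * Meromorphic germs and regularization *)

Lemma analytic_id z0 : analytic_at (fun z => z) z0.
Proof.
pose a (n : nat) : C := if n is 0%N then z0 else if n is 1%N then RtoC 1 else RtoC 0.
apply/analytic_pser; exists a; exists 1; split; first lra; move=> z _.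
have E : \csum_(k < 2) (a k * (z - z0) ^ k) = z by rewrite !big_ord_recr big_ord0 /=; ring.
suff : pser a (z - z0) (\csum_(k < 2) (a k * (z - z0) ^ k)) by rewrite E.
by apply: sums_finite => -[|[|n]] // _; rewrite Cmult_0_l.
Qed.

Lemma analytic_pow f z0 k : analytic_at f z0 -> analytic_at (fun z => f z ^ k)%C z0.
Proof.
move=> h; elim: k => [|k IH]; first exact: analytic_const.
exact: analytic_mult.
Qed.

Lemma analytic_minus_pow c k z0 : analytic_at (fun z => (z - c) ^ k)%C z0.
Proof. exact/analytic_pow/analytic_plus/analytic_const/analytic_id. Qed.

Lemma plim_mult f g z0 l m : plim f z0 l -> plim g z0 m ->
  plim (fun z => f z * g z)%C z0 (l * m)%C.
Proof.
move=> hf hg eps he; have [d [d0 H]] := Cmult_close l m he.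
by apply: near_imp (near_and (hf d d0) (hg d d0)) => z [h1 h2] nz; apply: H;
  [exact: h1|exact: h2].
Qed.

Lemma cont_ext f g z : near z (fun w => f w = g w) -> cont f z -> cont g z.
Proof.
move=> h; rewrite /cont -(near_at h); apply: plim_ext.
by apply: near_imp h.
Qed.

(** The germ of a meromorphic function: zero, or a nonvanishing analytic
    function times a power of [z - z0] of exponent [k - l]. Keeping [k] and [l]
    apart makes products and reciprocals immediate. The zero germ is its own
    reciprocal, because [/ 0 = 0] in [C]. *)
Definition germ (f : C -> C) (z0 : C) :=
  near z0 (fun z => z <> z0 -> f z = 0) \/
  exists k l h, [/\ analytic_at h z0, h z0 <> 0 &
    near z0 (fun z => z <> z0 -> f z = (h z * (z - z0) ^ k / (z - z0) ^ l)%C)].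

Lemma pow_neq0 (z z0 : C) k : z <> z0 -> ((z - z0) ^ k <> 0)%C.
Proof. by move=> nz; apply/Cpow_nz/Cminus_eq_contra. Qed.

Lemma germ_ext f g z0 : near z0 (fun z => z <> z0 -> f z = g z) -> germ f z0 -> germ g z0.
Proof.
move=> e [h|[k [l [h [ah h0 H]]]]].
  by left; apply: near_imp (near_and e h) => z [e1 e2] nz; rewrite -e1 // e2.
right; exists k, l, h; split=> //.
by apply: near_imp (near_and e H) => z [e1 e2] nz; rewrite -e1 // e2.
Qed.

Lemma germ_analytic f z0 : analytic_at f z0 -> germ f z0.
Proof.
move=> /analytic_factor [h|[k [h [ah h0 H]]]]; first by left; apply: near_imp h.
right; exists k, 0%N, h; split=> //; apply: near_imp H => z -> _.
by rewrite /= /Cdiv; field.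
Qed.

Lemma germ_meromorphic f z0 : meromorphic f -> germ f z0.
Proof.
move=> /(_ z0) [/germ_analytic //|[k [g [_ ag g0 /locally'_near H]]]].
right; exists 0%N, k, g; split=> //; apply: near_imp H => z H nz.
by rewrite H // Cmult_1_r.
Qed.

Lemma germ_mult f g z0 : germ f z0 -> germ g z0 -> germ (fun z => f z * g z)%C z0.
Proof.
move=> [h _|].
  by left; apply: near_imp h => z h nz; rewrite h // Cmult_0_l.
move=> [k [l [h [ah h0 H]]]] [K|].
  by left; apply: near_imp K => z K nz; rewrite K // Cmult_0_r.
move=> [k' [l' [h' [ah' h0' H']]]].
right; exists (k + k')%N, (l + l')%N, (fun z => h z * h' z)%C; split.
- exact: analytic_mult.
- exact: Cmult_neq_0.
apply: near_imp (near_and H H') => z [e e'] nz; rewrite e // e' // !Cpow_add_r.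
by field; split; apply: pow_neq0.
Qed.

Lemma Cinv_0 : (/ 0 = 0)%C.
Proof. by rewrite /Cinv /RtoC /=; congr pair; rewrite /Rdiv; ring. Qed.

Lemma germ_inv f z0 : germ f z0 -> germ (fun z => / f z)%C z0.
Proof.
move=> [h|[k [l [h [ah h0 H]]]]].
  by left; apply: near_imp h => z h nz; rewrite h // Cinv_0.
right; exists l, k, (fun z => / h z)%C; split.
- exact: analytic_inv.
- by move=> e; have := Cinv_l _ h0; rewrite e Cmult_0_l => /RtoC_inj; lra.
apply: near_imp (near_and H (analytic_neq0 ah h0)) => z [e hz] nz; rewrite e //.
by field; do !split=> //; apply: pow_neq0.
Qed.

Lemma germ_affine f (al be : C) z0 : al <> 0 -> germ f (al * z0 + be)%C ->
  germ (fun z => f (al * z + be))%C z0.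
Proof.
move=> al0.
have T P : near (al * z0 + be)%C P -> near z0 (fun z => P (al * z + be)%C).
  have a0 : 0 < Cmod al by apply/Cmod_gt_0.
  move=> [r [r0 H]]; exists (r / Cmod al); split; first exact: Rdiv_lt_0_compat.
  move=> z hz; apply: H.
  have -> : (al * z + be - (al * z0 + be) = al * (z - z0))%C by ring.
  rewrite Cmod_mult; have e : r / Cmod al * Cmod al = r by field; lra.
  nra.
have inj z : z <> z0 -> (al * z + be)%C <> (al * z0 + be)%C.
  move=> nz e; apply: nz.
  have : (/ al * (al * z + be - be) = / al * (al * z0 + be - be))%C by rewrite e.
  have E w : (/ al * (al * w + be - be) = w)%C by field.
  by rewrite !E.
move=> [/T h|[k [l [h [ah h0 /T H]]]]].
  by left; apply: near_imp h => z h /inj.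
right; exists k, l, (fun z => h (al * z + be) * (al ^ k / al ^ l))%C; split.
- exact/analytic_mult/analytic_const/analytic_affine.
- apply: Cmult_neq_0 => //; apply: Cmult_neq_0; first exact: Cpow_nz.
  move=> e; have := Cinv_l _ (Cpow_nz al l al0); rewrite e Cmult_0_l => /RtoC_inj; lra.
apply: near_imp H => z H nz; rewrite (H (inj z nz)).
have -> : (al * z + be - (al * z0 + be) = al * (z - z0))%C by ring.
rewrite !Cpow_mult_l; field; split; [exact: Cpow_nz|exact: pow_neq0].
Qed.

(** Away from [z0] the germ is a product of continuous functions. Hence passing to
    punctured limits changes a meromorphic function at isolated points only. *)
Lemma germ_cont f z0 : germ f z0 -> near z0 (fun z => z <> z0 -> cont f z).
Proof.
move=> [h|[k [l [h [ah h0 H]]]]].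
  apply: near_imp (near_near h) => z h' nz.
  apply: (cont_ext (f := fun=> RtoC 0)); last exact: analytic_cont (analytic_const _ _).
  by apply: near_imp (near_and h' (near_neq nz)) => w [e nw]; rewrite e.
apply: near_imp (near_and (near_near H) (analytic_cont_near ah)) => z [H' ch] nz.
apply: (cont_ext (f := fun z => h z * ((z - z0) ^ k / (z - z0) ^ l))%C).
  by apply: near_imp (near_and H' (near_neq nz)) => w [e nw]; rewrite e // /Cdiv Cmult_assoc.
apply: plim_mult ch _; apply: (@analytic_cont (fun z => (z - z0) ^ k / (z - z0) ^ l)%C).
apply: analytic_mult; first exact: analytic_minus_pow.
by apply: analytic_inv; [exact: analytic_minus_pow|exact: pow_neq0].
Qed.

(** The representative of a meromorphic function without removable
    singularities: wherever a punctured limit exists it is the value. *)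
Definition regularize (f : C -> C) (z : C) : C :=
  match excluded_middle_informative (exists l, plim f z l) with
  | left ex => proj1_sig (constructive_indefinite_description _ ex)
  | right _ => f z
  end.

Lemma regularize_lim f z l : plim f z l -> regularize f z = l.
Proof.
rewrite /regularize; case: excluded_middle_informative => [ex|nex] h; last by case: nex; exists l.
by case: constructive_indefinite_description => l' h' /=; apply: plim_unique h' h.
Qed.

Lemma regularize_cont f z : cont f z -> regularize f z = f z.
Proof. exact: regularize_lim. Qed.

Lemma regularize_near f z0 : germ f z0 -> near z0 (fun z => z <> z0 -> regularize f z = f z).
Proof. by move=> /germ_cont; apply: near_imp => z h /h /regularize_cont. Qed.

(** A germ [h (z - z0)^(k - l)] has the limit prescribed by an analytic function
    when [l <= k]; otherwise it has a pole of order [l - k]. *)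
Lemma regularize_meromorphic f : (forall z, germ f z) -> meromorphic (regularize f).
Proof.
move=> G z0; have e := regularize_near (G z0).
suff [[g [ag H]]|[k [h [k0 ah h0 H]]]] : (exists g, analytic_at g z0 /\
     near z0 (fun z => z <> z0 -> f z = g z)) \/
   (exists k h, [/\ (0 < k)%N, analytic_at h z0, h z0 <> 0 &
     near z0 (fun z => z <> z0 -> f z = (h z / (z - z0) ^ k)%C)]).
- left; apply: (analytic_ext (f := g)) => //.
  apply: near_imp (near_and e H) => z [e1 e2].
  case: (classic (z = z0)) => [->|nz]; last by rewrite e1 // e2.
  symmetry; apply: regularize_lim; apply: plim_ext (analytic_cont ag).
  by apply: near_imp H => w h nw; rewrite h.
- right; exists k, h; split=> //; apply/locally'_near.
  by apply: near_imp (near_and e H) => z [e1 e2] nz; rewrite e1 // e2.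
case: (G z0) => [h|[k [l [h [ah h0 H]]]]].
  by left; exists (fun=> RtoC 0); split; first exact: analytic_const.
case: (leqP l k) => kl.
  left; exists (fun z => h z * (z - z0) ^ (k - l))%C; split.
    exact/analytic_mult/analytic_minus_pow.
  apply: near_imp H => z H nz; rewrite H // -{1}(subnK kl) Cpow_add_r.
  by field; apply: pow_neq0.
right; exists (l - k)%N, h; split=> //; first by rewrite subn_gt0.
apply: near_imp H => z H nz; rewrite H // -{1}(subnK (ltnW kl)) Cpow_add_r.
by field; split; apply: pow_neq0.
Qed.

Lemma regularize_mero_eq f : (forall z, germ f z) -> mero_eq (regularize f) f.
Proof. by move=> G z0; apply/locally'_near/regularize_near. Qed.

(** * Additive characters *)

Lemma e_plus x y : e (x + y) = (e x * e y)%C.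
Proof.
rewrite /e -Cexp_plus; congr Cexp.
by rewrite Rmult_plus_distr_l RtoC_plus; ring.
Qed.

Lemma eE x : e x = (cos (2 * PI * x), sin (2 * PI * x)).
Proof.
rewrite /e; have -> : (RtoC (2 * PI * x) * Ci)%C = (0, 2 * PI * x).
  by rewrite /Cmult /Ci /RtoC /=; congr pair; ring.
by rewrite /Cexp /= exp_0 Cmult_1_l.
Qed.

Lemma e_IZR k : e (IZR k) = 1.
Proof.
have h m : e (INR m) = 1.
  elim: m => [|m IH]; first by rewrite eE /= Rmult_0_r cos_0 sin_0.
  by rewrite S_INR e_plus IH eE Rmult_1_r cos_2PI sin_2PI -[(1, 0)]/(RtoC 1) Cmult_1_l.
case: k => [|p|p]; first exact: (h 0%N).
  by rewrite -[IZR (Z.pos p)]/(IPR p) -INR_IPR h.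
rewrite -[RtoC 1](h 0%N).
have -> : INR 0 = IZR (Z.neg p) + IZR (Z.pos p) by rewrite -plus_IZR -Pos2Z.opp_pos
  Z.add_opp_diag_l.
by rewrite e_plus -[IZR (Z.pos p)]/(IPR p) -INR_IPR h Cmult_1_r.
Qed.

Lemma e_half : e (1 / 2) = -1.
Proof.
have E : 2 * PI * (1 / 2) = PI by field.
by rewrite eE E cos_PI sin_PI.
Qed.

(** From [cos (2 PI x) = 1 - 2 sin^2 (PI x)]. *)
Lemma e_eq1 x : e x = 1 -> exists k, x = IZR k.
Proof.
rewrite eE => -[hc _].
have : sin (PI * x) = 0.
  have h := cos_2a_sin (PI * x).
  have E : 2 * (PI * x) = 2 * PI * x by ring.
  rewrite E hc in h; nra.
move=> /sin_eq_0_0 [k hk]; exists k.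
have := PI_RGT_0; nra.
Qed.

Lemma Cmod_e x : Cmod (e x) = 1.
Proof. by rewrite /e Cmod_Cexp /= Rmult_0_r Rmult_0_l Rminus_0_r exp_0. Qed.

(** The additive character [z |-> e(z / q)] of [Z / q]. *)
Definition echar (q : nat) (z : Z) : C := e (IZR z / INR q).

Lemma INR_gt0 q : (0 < q)%N -> 0 < INR q.
Proof. by move=> /ltP /lt_0_INR. Qed.

Lemma echar_add q z w : echar q (z + w)%ZZ = (echar q z * echar q w)%C.
Proof. by rewrite /echar plus_IZR Rdiv_plus_distr e_plus. Qed.

Lemma echar_mul_q q k : (0 < q)%N -> echar q (Z.of_nat q * k)%ZZ = 1.
Proof.
move=> /INR_gt0 q0; rewrite /echar mult_IZR -INR_IZR_INZ.
have -> : INR q * IZR k / INR q = IZR k by field; lra.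
exact: e_IZR.
Qed.

Lemma echar_period q z k : (0 < q)%N -> echar q (z + Z.of_nat q * k)%ZZ = echar q z.
Proof. by move=> q0; rewrite echar_add echar_mul_q // Cmult_1_r. Qed.

Lemma echar0 q : echar q 0 = 1.
Proof. by rewrite /echar /Rdiv Rmult_0_l (e_IZR 0). Qed.

Lemma echar_eqmod q z w : (0 < q)%N -> (Z.of_nat q | z - w)%ZZ -> echar q z = echar q w.
Proof. by move=> q0 [k hk]; rewrite -(echar_period w k q0); congr echar; lia. Qed.

Lemma echar_scale m q z : (0 < m)%N -> (0 < q)%N -> echar (m * q) (Z.of_nat m * z) = echar q z.
Proof.
move=> /INR_gt0 m0 /INR_gt0 q0; rewrite /echar mult_IZR -multE mult_INR -INR_IZR_INZ.
by congr e; field; lra.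
Qed.

Lemma echar_eq1 q z : (0 < q)%N -> echar q z = 1 -> (Z.of_nat q | z)%ZZ.
Proof.
move=> /INR_gt0 q0 /e_eq1 [k hk]; exists k; apply: eq_IZR.
rewrite mult_IZR -INR_IZR_INZ -hk; field; lra.
Qed.

Lemma ZofM m k : Z.of_nat (m * k)%N = (Z.of_nat m * Z.of_nat k)%ZZ.
Proof. exact: Nat2Z.inj_mul. Qed.
Lemma ZofD m k : Z.of_nat (m + k)%N = (Z.of_nat m + Z.of_nat k)%ZZ.
Proof. exact: Nat2Z.inj_add. Qed.

Lemma echar_sum0 q b : (0 < q)%N -> ~ (Z.of_nat q | b)%ZZ ->
  \csum_(x < q) echar q (b * Z.of_nat x) = 0.
Proof.
move=> q0 nd; set s := bigop.body _ _ _.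
have ne : (1 - echar q b <> 0)%C.
  move=> h; apply: nd; apply: echar_eq1 => //.
  by rewrite (proj2 (Ceq_minus _ _) h).
rewrite -[RHS]/(RtoC 0); apply: (Cmult_cancel ne); rewrite Cmult_0_r.
have T m : ((1 - echar q b) * (\csum_(x < m) echar q (b * Z.of_nat x)) =
  1 - echar q (b * Z.of_nat m))%C.
  elim: m => [|m IH]; first by rewrite big_ord0 Z.mul_0_r echar0; ring.
  rewrite (csumS (fun x => echar q (b * Z.of_nat x))) Cmult_plus_distr_l IH.
  have -> : (b * Z.of_nat m.+1 = b * Z.of_nat m + b)%ZZ by lia.
  by rewrite echar_add; ring.
by rewrite T Z.mul_comm echar_mul_q //; ring.
Qed.

Lemma echar_sum1 q b : (0 < q)%N -> (Z.of_nat q | b)%ZZ ->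
  \csum_(x < q) echar q (b * Z.of_nat x) = RtoC (INR q).
Proof.
move=> q0 [k ->]; rewrite -[RHS]Cmult_1_r -csum_const; apply: eq_bigr => x _.
by rewrite -(echar_mul_q (k * Z.of_nat x) q0); congr echar; lia.
Qed.

(** * Sums over residue classes *)

Lemma csum_add (f : nat -> C) m n :
  \csum_(x < m + n) f x = (\csum_(x < m) f x + \csum_(x < n) f (m + x)%N)%C.
Proof. exact: big_split_ord. Qed.

Lemma csum_block (f : nat -> C) d m :
  \csum_(x < d * m) f x = \csum_(y < d) \csum_(z < m) f (y + d * z)%N.
Proof.
elim: m => [|m IH]; first by rewrite muln0 big_ord0 big1 // => i _; rewrite big_ord0.
rewrite mulnS addnC csum_add IH -big_split; apply: eq_bigr => y _.
by rewrite (csumS (fun z => f (y + d * z)%N)) addnC.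
Qed.

Lemma csum_multiples (f : nat -> C) m t : (0 < m)%N ->
  \csum_(y < m * t | (m %| y)%N) f y = \csum_(y < t) f (m * y)%N.
Proof.
move=> m0; rewrite big_mkcond (csum_block (fun y => if (m %| y)%N then f y else RtoC 0)).
case: m m0 => // m _; rewrite big_ord_recl [X in (_ + X)%C]big1 ?Cplus_0_r => [|i _].
  by apply: eq_bigr => z _; rewrite add0n dvdn_mulr.
apply: big1 => z _; rewrite dvdn_addl ?dvdn_mulr // gtnNdvd //.
Qed.

Lemma csum_reindex q (f : nat -> C) (P : pred nat) (g : nat -> nat) :
  (forall x, f (x %% q)%N = f x) -> (forall x, P (x %% q)%N = P x) ->
  (forall x y, (x < q)%N -> (y < q)%N -> g x = g y %[mod q] -> x = y) ->
  \csum_(x < q | P (g x)) f (g x) = \csum_(x < q | P x) f x.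
Proof.
case: q => [|q] hf hP hg; first by rewrite !big_ord0.
pose s (x : 'I_q.+1) : 'I_q.+1 := inord (g x %% q.+1).
have sE x : s x = (g x %% q.+1)%N :> nat by rewrite inordK // ltn_mod.
have si : injective s.
  by move=> x y /(congr1 val) /=; rewrite !sE => /hg h; apply: val_inj; apply: h.
rewrite [RHS](reindex s) /=; last exact: (onW_bij _ (injF_bij si)).
by apply: eq_big => x; rewrite sE ?hP // hf.
Qed.

Lemma mulmod_inj q u : coprime u q ->
  forall x y, (x < q)%N -> (y < q)%N -> (x * u = y * u %[mod q])%N -> x = y.
Proof.
move=> cu x y hx hy /eqP; wlog xy : x y hx hy / (x <= y)%N => [H h|].
  by case/orP: (leq_total x y) => hxy; [apply: H|symmetry; apply: H => //; rewrite eq_sym].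
rewrite eq_sym eqn_mod_dvd ?leq_mul2r ?xy ?orbT // -mulnBl Gauss_dvdl 1?coprime_sym //.
rewrite -eqn_mod_dvd // !modn_small // => /eqP; by [].
Qed.

(** * Quadratic Gauss sums *)

Ltac zring := rewrite ?ZofD ?ZofM; change (Z.of_nat 2) with 2%ZZ;
  change (Z.of_nat 4) with 4%ZZ; ring.

Definition gauss (a : Z) (q : nat) : C :=
  \csum_(x < q) echar q (a * (Z.of_nat x * Z.of_nat x)).

Lemma gauss_eqmod a b q : (Z.of_nat q | a - b)%ZZ -> gauss a q = gauss b q.
Proof.
move=> [k hk]; case: q hk => [|q] hk; first by rewrite /gauss !big_ord0.
apply: eq_bigr => x _; apply: echar_eqmod => //.
by exists (k * (Z.of_nat x * Z.of_nat x))%ZZ; rewrite -Z.mul_sub_distr_r hk; lia.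
Qed.

Lemma csum_scale_const (I : finType) (P : pred I) (c : C) (f : I -> C) :
  (\big[Cplus/RtoC 0]_(i | P i) (c * f i) = c * \big[Cplus/RtoC 0]_(i | P i) f i)%C.
Proof. by rewrite big_distrr. Qed.

(** Write [x = y + m t z]: the square is [y^2 + 2 m t y z] modulo [m^2 t], and the
    sum over [z] modulo [m] vanishes unless [m] divides [2 a y], that is, [y]. *)
Lemma gauss_odd_square a m t : (0 < m)%N -> (0 < t)%N ->
  (forall y, (Z.of_nat m | 2 * a * Z.of_nat y)%ZZ -> (m %| y)%N) ->
  gauss a (m * m * t) = (RtoC (INR m) * gauss a t)%C.
Proof.
move=> m0 t0 hm; rewrite /gauss.
have -> : (m * m * t = m * t * m)%N by rewrite -mulnA [(m * t)%N]mulnC mulnA [(m * t)%N]mulnC.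
have d0 : (0 < m * t * m)%N by rewrite !muln_gt0 m0 t0.
set d := (m * t * m)%N in d0 *.
rewrite (csum_block (fun x => echar d (a * (Z.of_nat x * Z.of_nat x)))).
transitivity (\csum_(y < m * t | (m %| y)%N) (RtoC (INR m) * echar d (a * (Z.of_nat y *
  Z.of_nat y)))).
  rewrite [RHS]big_mkcond; apply: eq_bigr => y _.
  transitivity (echar d (a * (Z.of_nat y * Z.of_nat y)) *
     \csum_(z < m) echar m (2 * a * Z.of_nat y * Z.of_nat z))%C.
    rewrite -csum_scale_const; apply: eq_bigr => z _.
    rewrite -(@echar_scale (m * t) m) ?muln_gt0 ?m0 ?t0 // -echar_add.
    apply: echar_eqmod => //; exists (a * Z.of_nat t * (Z.of_nat z * Z.of_nat z))%ZZ.
    by rewrite /d !ZofD !ZofM; ring.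
  case: ifP => hy; last by rewrite echar_sum0 ?Cmult_0_r // => /hm; rewrite hy.
  rewrite echar_sum1 1?Cmult_comm //.
  by case/dvdnP: hy => k ->; exists (2 * a * Z.of_nat k)%ZZ; rewrite ZofM; ring.
rewrite csum_scale_const; congr (_ * _)%C.
rewrite (csum_multiples (fun y => echar d (a * (Z.of_nat y * Z.of_nat y)))) //.
apply: eq_bigr => y _.
rewrite -(@echar_scale (m * m) t) ?muln_gt0 ?m0 //.
have -> : d = (m * m * t)%N by rewrite /d mulnAC.
by congr echar; rewrite !ZofM; ring.
Qed.

Lemma echar2_odd a : Z.odd a = true -> echar 2 a = -1.
Proof.
move=> h; have [k ->] : exists k, a = (1 + Z.of_nat 2 * k)%ZZ.
  by move/Z.odd_spec: h => [k ->]; exists k; lia.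
by rewrite echar_period // /echar e_half.
Qed.

Lemma gauss_2 a : Z.odd a = true -> gauss a 2 = 0.
Proof.
move=> h; rewrite /gauss !big_ord_recr big_ord0 /= Z.mul_0_r echar0 !Z.mul_1_r echar2_odd //.
by ring.
Qed.

Lemma gauss_1 a : gauss a 1 = 1.
Proof. by rewrite /gauss big_ord_recr big_ord0 /= Z.mul_0_r echar0; ring. Qed.

Lemma gauss_4 a : gauss a 4 = (2 * (1 + echar 4 a))%C.
Proof.
rewrite /gauss !big_ord_recr big_ord0 /= Z.mul_0_r echar0 !Z.mul_1_r.
have -> : echar 4 (a * 4) = 1 by rewrite Z.mul_comm (echar_mul_q (q := 4)).
have -> : echar 4 (a * 9) = echar 4 a by apply: echar_eqmod => //; exists (2 * a)%ZZ; ring.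
by ring.
Qed.

Lemma gauss_8 a : Z.odd a = true -> gauss a 8 = (4 * echar 8 a)%C.
Proof.
move=> h; rewrite /gauss !big_ord_recr big_ord0 /= Z.mul_0_r echar0 !Z.mul_1_r.
have e4 : echar 8 (a * 4) = -1.
  rewrite -(echar2_odd h) -(@echar_scale 4 2) //; congr echar; rewrite Z.mul_comm //.
have -> : echar 8 (a * 9) = echar 8 a by apply: echar_eqmod => //; exists a; ring.
have -> : echar 8 (a * 16) = 1 by rewrite -[RtoC 1](echar_mul_q (q := 8) (2 * a)) //;
  congr echar; lia.
have -> : echar 8 (a * 25) = echar 8 a by apply: echar_eqmod => //; exists (3 * a)%ZZ; ring.
have -> : echar 8 (a * 36) = echar 8 (a * 4) by apply: echar_eqmod => //; exists (4 * a)%ZZ; ring.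
have -> : echar 8 (a * 49) = echar 8 a by apply: echar_eqmod => //; exists (6 * a)%ZZ; ring.
by rewrite e4; ring.
Qed.

(** The same reduction at 2 needs [x = y + (d / 4) z] with [16 | d], since the
    factor 2 of the cross term is no longer invertible. The sum over [z] modulo 4
    leaves the even [y], and these run over half of the residues modulo [4 s]. *)
Lemma gauss_4t a s : (0 < s)%N -> Z.odd a = true -> gauss a (4 * (4 * s)) =
  (2 * gauss a (4 * s))%C.
Proof.
move=> s0 oa.
have even_half y : (Z.of_nat 2 | a * Z.of_nat y)%ZZ -> (2 %| y)%N.
  move=> [k hk]; rewrite dvdn2; apply/negP => oy.
  have : Z.odd (a * Z.of_nat y) = true.
    rewrite Z.odd_mul oa /=; have -> : y = (1 + y./2.*2)%N by rewrite -{1}(odd_double_half y) oy.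
    by rewrite ZofD -muln2 ZofM Z.odd_add Z.odd_mul andbF.
  by rewrite hk Z.odd_mul andbF.
rewrite /gauss.
have d0 : (0 < 4 * (4 * s))%N by rewrite !muln_gt0.
rewrite [(4 * (4 * s))%N]mulnC in d0 *.
set d := (4 * s * 4)%N in d0 *.
rewrite (csum_block (fun x => echar d (a * (Z.of_nat x * Z.of_nat x)))).
transitivity (\csum_(y < 2 * (2 * s)| (2 %| y)%N) (RtoC 4 * echar d (a * (Z.of_nat y * Z.of_nat
  y)))).
  rewrite [RHS]big_mkcond (_ : (2 * (2 * s) = 4 * s)%N); last by rewrite mulnA.
  apply: eq_bigr => y _.
  transitivity (echar d (a * (Z.of_nat y * Z.of_nat y)) *
     \csum_(z < 4) echar 2 (a * Z.of_nat y * Z.of_nat z))%C.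
    rewrite -csum_scale_const; apply: eq_bigr => z _.
    rewrite -(@echar_scale (4 * s * 2) 2) ?muln_gt0 ?s0 //.
    rewrite (_ : (4 * s * 2 * 2 = d)%N); last by rewrite /d -mulnA.
    rewrite -echar_add.
    apply: echar_eqmod => //; exists (a * Z.of_nat s * (Z.of_nat z * Z.of_nat z))%ZZ.
    by rewrite /d; zring.
  rewrite (csum_block (fun z => echar 2 (a * Z.of_nat y * Z.of_nat z)) 2 2).
  have -> : \csum_(z < 2) \csum_(w < 2) echar 2 (a * Z.of_nat y * Z.of_nat (z + 2 * w)%N) =
       (2 * (\csum_(z < 2) echar 2 (a * Z.of_nat y * Z.of_nat z)))%C.
    rewrite -csum_scale_const; apply: eq_bigr => z _; rewrite -[in RHS](csum_const 2).
    apply: eq_bigr => w _; apply: echar_eqmod => //.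
    by exists (a * Z.of_nat y * Z.of_nat w)%ZZ; zring.
  case: ifP => hy; last by rewrite echar_sum0 ?Cmult_0_r // => /even_half; rewrite hy.
  rewrite echar_sum1 //; first by rewrite -[INR 2]/2 -RtoC_mult Cmult_comm;
    congr (RtoC _ * _)%C; ring.
  by case/dvdnP: hy => k ->; exists (a * Z.of_nat k)%ZZ; zring.
rewrite csum_scale_const.
rewrite (csum_multiples (fun y => echar d (a * (Z.of_nat y * Z.of_nat y)))) //.
have -> : (4 * s = 2 * s * 2)%N by rewrite mulnAC.
rewrite (csum_block (fun x => echar (2 * s * 2) (a * (Z.of_nat x * Z.of_nat x)))).
have -> : RtoC 4 = (2 * 2)%C by rewrite -RtoC_mult; congr RtoC; ring.
rewrite -Cmult_assoc -!csum_scale_const; apply: eq_bigr => y _; congr (_ * _)%C.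
have -> : RtoC 2 = RtoC (INR 2) by [].
rewrite -csum_const; apply: eq_bigr => z _.
rewrite -(@echar_scale 4 (2 * s * 2)) // ?muln_gt0 ?s0 // .
rewrite (_ : (4 * (2 * s * 2) = d)%N); last by rewrite /d; lia.
apply: echar_eqmod => //; exists (- (a * Z.of_nat y * Z.of_nat z) - a * Z.of_nat s * (Z.of_nat
  z * Z.of_nat z))%ZZ.
by rewrite /d; zring.
Qed.

(** * Twisting Gauss sums by a quadratic non-residue *)

Lemma csum_crt (f : nat -> C) p t : (0 < p)%N -> (0 < t)%N -> coprime p t ->
  (forall x, f (x %% (p * t))%N = f x) ->
  \csum_(x < p * t) f x = \csum_(y < p) \csum_(z < t) f (t * y + p * z)%N.
Proof.
move=> p0 t0 cpt hf.
pose g x := (t * (x %% p) + p * (x %/ p))%N.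
rewrite -(@csum_reindex (p * t) f predT g hf) //; last first.
  move=> x y hx hy hg.
  have hxt : (x %/ p < t)%N by rewrite ltn_divLR // mulnC.
  have hyt : (y %/ p < t)%N by rewrite ltn_divLR // mulnC.
  have e1 : (x %% p = y %% p)%N.
    have cp : coprime t p by rewrite coprime_sym.
    apply: (mulmod_inj cp); rewrite ?ltn_mod //.
    have := congr1 (modn^~ p) hg; rewrite /g !modn_dvdm ?dvdn_mulr //.
    by rewrite ![(_ + p * _)%N]addnC !(mulnC p) !modnMDl ![(t * _)%N]mulnC.
  have e2 : (x %/ p = y %/ p)%N.
    apply: (mulmod_inj cpt) => //.
    have := congr1 (modn^~ t) hg; rewrite /g !modn_dvdm ?dvdn_mull //.
    by rewrite ![(t * _)%N]mulnC !modnMDl ![(p * _)%N]mulnC.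
  by rewrite (divn_eq x p) (divn_eq y p) e1 e2.
rewrite (csum_block (fun x => f (g x))); apply: eq_bigr => y _; apply: eq_bigr => z _.
congr f; rewrite /g; congr (_ * _ + _ * _)%N.
  by rewrite addnC mulnC modnMDl modn_small.
by rewrite addnC mulnC divnMDl // divn_small // addn0.
Qed.

Lemma echar_sq_mod q a x : (0 < q)%N ->
  echar q (a * (Z.of_nat (x %% q) * Z.of_nat (x %% q))) = echar q (a * (Z.of_nat x * Z.of_nat x)).
Proof.
move=> q0; symmetry; apply: echar_eqmod => //; rewrite {1 2}(divn_eq x q) ZofD ZofM.
set k := Z.of_nat (x %/ q); set r := Z.of_nat (x %% q).
by exists (a * (k * k * Z.of_nat q + 2 * k * r))%ZZ; ring.
Qed.

Lemma gauss_crt a p t : (0 < p)%N -> (0 < t)%N -> coprime p t ->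
  gauss a (p * t) = (gauss (a * Z.of_nat t)%ZZ p * gauss (a * Z.of_nat p)%ZZ t)%C.
Proof.
move=> p0 t0 cpt; have pt0 : (0 < p * t)%N by rewrite muln_gt0 p0.
rewrite /gauss (csum_crt (f := fun x => echar (p * t) (a * (Z.of_nat x * Z.of_nat x)))) // =>
  [|x]; last first.
  exact: echar_sq_mod.
rewrite big_distrlr; apply: eq_bigr => y _; apply: eq_bigr => z _ /=.
rewrite -(@echar_scale t p) // -(@echar_scale p t) // [(t * p)%N]mulnC -echar_add.
apply: echar_eqmod => //; exists (2 * a * Z.of_nat y * Z.of_nat z)%ZZ.
by rewrite !ZofD !ZofM; ring.
Qed.

Lemma sq_eq_mod p c x y : prime p -> coprime p c -> (x < p)%N -> (y < p)%N ->
  (c * (x * x) = c * (y * y) %[mod p])%N -> x = y \/ (p %| x + y)%N.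
Proof.
move=> pp cpc; wlog xy : x y / (y <= x)%N => [H hx hy e|hx hy /eqP].
  case/orP: (leq_total x y) => h; last exact: H.
  by case: (H y x h hy hx (esym e)) => [->|]; [left|rewrite addnC; right].
rewrite eqn_mod_dvd ?leq_mul // -mulnBr Gauss_dvdr //.
have -> : (x * x - y * y = (x - y) * (x + y))%N by rewrite mulnBl !mulnDr [(y * x)%N]mulnC
  subnDA addnK.
rewrite Euclid_dvdM // => /orP [h|]; [left|by right].
have : (x - y = 0)%N.
  by apply/eqP; move: h; apply: contraTT; rewrite -lt0n => h;
    rewrite gtnNdvd // ltn_subLR // ltn_addl.
by lia.
Qed.

Lemma card_roots_le2 p c t : prime p -> coprime p c ->
  (\sum_(x < p) ((c * (x * x)) %% p == t)%N <= 2)%N.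
Proof.
move=> pp cpc; have p0 := prime_gt0 pp.
have -> : (\sum_(x < p) ((c * (x * x)) %% p == t) =
  #|[pred x : 'I_p | (c * (x * x)) %% p == t]|)%N.
  by rewrite -sum1_card [RHS]big_mkcond /=; apply: eq_bigr => x _; rewrite inE; case: eqP.
case: (pickP [pred x : 'I_p | (c * (x * x)) %% p == t]%N) => [x0 /= /eqP h0|h];
  last by rewrite eq_card0.
have y0 : ((p - x0) %% p < p)%N by rewrite ltn_mod.
apply: (@leq_trans #|pred2 x0 (Ordinal y0)|); last by rewrite card2; case: eqP.
apply: subset_leq_card; apply/subsetP => x; rewrite !inE => /eqP hx.
have hxp := ltn_ord x; have hx0 := ltn_ord x0.
case: (sq_eq_mod pp cpc hxp hx0) => [|/val_inj ->|/dvdnP [k hk]]; first by rewrite hx h0.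
  by rewrite eqxx.
apply/orP; right; rewrite -val_eqE /=; apply/eqP.
have [k0|[k1|k2]] : (k = 0 \/ k = 1 \/ 2 <= k)%N by lia.
- have -> : (x0 = 0 :> nat)%N by lia.
  by rewrite subn0 modnn; lia.
- have [E|E] : ((x0 = 0 :> nat) \/ 0 < x0)%N by lia.
    by move: hk; rewrite E k1; lia.
  by rewrite modn_small; lia.
have : (2 * p <= k * p)%N by rewrite leq_mul2r k2 orbT.
by rewrite -hk; lia.
Qed.

(** Also excludes the multiples of [p], as [y = 0] is allowed. *)
Definition nonresidue p u := forall y, (y * y <> u %[mod p])%N.

(** Squaring modulo [p] identifies 1 and [p - 1], so it is not onto. *)
Lemma nonresidue_exists p : prime p -> odd p -> exists u, nonresidue p u.
Proof.
move=> pp op; apply: NNPP => H.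
have p0 := prime_gt0 pp; have p1 := prime_gt1 pp.
pose s (x : 'I_p) : 'I_p := Ordinal (ltn_pmod (x * x) p0).
have sj (u : 'I_p) : u \in codom s.
  have [y hy] : exists y, (y * y = u %[mod p])%N.
    by apply: NNPP => h; apply: H; exists u => y e; apply: h; exists y.
  apply/codomP; exists (Ordinal (ltn_pmod y p0)); apply: val_inj => /=.
  by rewrite modnMml modnMmr hy modn_small.
have : {in 'I_p &, injective s}.
  apply/image_injP; apply/eqP; apply: eq_card => u; rewrite -[u \in 'I_p]/true; exact: sj.
move=> /(_ (Ordinal p1)); have pm : (p.-1 < p)%N by rewrite prednK.
move=> /(_ (Ordinal pm) isT isT) h.
have : s (Ordinal p1) = s (Ordinal pm).
  apply: val_inj => /=.
  have [k ->] : exists k, p = k.+2 by exists p.-2; lia.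
  rewrite /= (_ : (k.+1 * k.+1 = k * k.+2 + 1 * 1)%N); last by lia.
  by rewrite modnMDl.
move=> /h /(congr1 val) /= e; have p3 : p = 2%N by lia.
by rewrite p3 in op.
Qed.

Lemma modM_inv p y : prime p -> ~~ (p %| y)%N -> exists w, (w * y = 1 %[mod p])%N.
Proof.
move=> pp ny; have y0 : (0 < y)%N by case: y ny => //; rewrite dvdn0.
have : coprime y p by rewrite coprime_sym prime_coprime.
move=> /(coprimeP _ y0) [[w v] /= h]; exists w.
have -> : (w * y = v * p + 1)%N by lia.
by rewrite modnMDl.
Qed.

(** Every [t] is hit at most twice by [x^2] and [u x^2] together: for nonzero [t]
    only one of the two can represent it, as otherwise [u] would be a square, and
    0 is hit once by each. The [2 p] values to distribute over [p] classes then
    force equality. *)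
Lemma roots_twist p u t : prime p -> nonresidue p u -> (t < p)%N ->
  (\sum_(x < p) ((1 * (x * x)) %% p == t)%N + \sum_(x < p) ((u * (x * x)) %% p == t)%N = 2)%N.
Proof.
move=> pp nu; have p0 := prime_gt0 pp.
have cu : coprime p u.
  by rewrite prime_coprime //; apply/negP => /eqP h; apply: (nu 0%N); rewrite h mod0n.
have c1 : coprime p 1 by rewrite coprimen1.
pose r c t := (\sum_(x < p) ((c * (x * x)) %% p == t)%N)%N.
rewrite -/(r 1%N t) -/(r u t) => tp.
have tot c : (\sum_(t < p) r c t = p)%N.
  rewrite exchange_big /= -[RHS]card_ord -sum1_card; apply: eq_bigr => x _.
  by rewrite (bigD1 (Ordinal (ltn_pmod (c * (x * x)) p0))) //= eqxx big1 // => i ne;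
    apply/eqP; rewrite eqb0 eq_sym.
have z1 c : coprime p c -> (r c 0 <= 1)%N.
  move=> cc; rewrite /r.
  rewrite (bigD1 (Ordinal p0)) //= big1 ?addn0; first by case: eqP.
  move=> i ne; apply/eqP; rewrite eqb0; apply/negP => h.
  have : (p %| c * (i * i))%N by [].
  rewrite Gauss_dvdr // Euclid_dvdM // orbb => /dvdn_leq; case: (posnP i) => [e|i0].
    by move: ne; rewrite -val_eqE /= e.
  by move=> /(_ isT); rewrite leqNgt ltn_ord.
have le2 t' : (r 1%N t' + r u t' <= 2)%N.
  have [->|t0] := posnP t'; first by have := z1 _ c1; have := z1 _ cu; lia.
  have h1 : (r 1%N t' <= 2)%N by apply: card_roots_le2.
  have h2 : (r u t' <= 2)%N by apply: card_roots_le2.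
  case: (posnP (r 1%N t')) => [->|r1]; first by rewrite add0n.
  case: (posnP (r u t')) => [->|r2]; first by rewrite addn0.
  exfalso.
  have ex c : (0 < r c t')%N -> exists x : nat, ((c * (x * x)) %% p = t')%N.
    rewrite lt0n /r sum_nat_eq0 negb_forall => /existsP [x]; rewrite /= eqb0 negbK => /eqP.
    by move=> <-; exists x.
  have [x hx] := ex _ r1; have [y hy] := ex _ r2.
  have ny : ~~ (p %| y)%N.
    apply/negP => py; have : (p %| u * (y * y))%N by rewrite dvdn_mull // dvdn_mull.
    by move=> /eqP; rewrite hy => e; rewrite e in t0.
  have [w hw] := modM_inv pp ny.
  apply: (nu (w * x)%N).
  have -> : ((w * x) * (w * x) = (w * w) * (1 * (x * x)))%N by lia.
  rewrite -modnMmr hx -hy modnMmr.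
  have -> : ((w * w) * (u * (y * y)) = u * ((w * y) * (w * y)))%N by lia.
  have e : ((w * y) * (w * y) = 1 %[mod p])%N by rewrite -modnMm hw modnMm.
  by rewrite -modnMmr e modnMmr muln1.
apply/eqP; rewrite eqn_leq le2 /= leqNgt; apply/negP => lt.
have : (\sum_(t < p) (r 1%N t + r u t) < \sum_(t < p) 2)%N.
  rewrite (bigD1 (Ordinal tp)) //= [X in (_ < X)%N](bigD1 (Ordinal tp)) //=.
  by rewrite -addSn; apply: leq_add => //; apply: leq_sum => i _; apply: le2.
by rewrite big_split /= !tot sum_nat_const card_ord muln2 addnn ltnn.
Qed.

Lemma csum_fibers (p : nat) (g : nat -> nat) (F : nat -> C) : (forall x, g x < p)%N ->
  \csum_(x < p) F (g x) = \csum_(t < p) (RtoC (INR (\sum_(x < p) (g x == t))) * F t).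
Proof.
move=> hg.
transitivity (\csum_(x < p) \csum_(t < p | g x == t) F t).
  by apply: eq_bigr => x _; rewrite (big_pred1 (Ordinal (hg x))) // => i; rewrite eq_sym.
rewrite (exchange_big_dep predT) //=; apply: eq_bigr => t _.
rewrite big_mkcond /=.
have -> : INR (\sum_(x < p) (g x == t)) = \rsum_(x < p) (if g x == t then 1 else 0).
  rewrite (big_morph INR plus_INR (erefl : INR 0 = 0)).
  by apply: eq_bigr => x _; case: eqP.
rewrite (big_morph RtoC RtoC_plus (erefl : RtoC 0 = RtoC 0)) big_distrl /=.
by apply: eq_bigr => x _; case: eqP => _; rewrite ?Cmult_1_l ?Cmult_0_l.
Qed.

(** By [roots_twist] the two Gauss sums add up to twice the sum of a nontrivial
    character over all residues, which is 0. *)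
Lemma gauss_nonresidue p u a : prime p -> nonresidue p u -> ~ (Z.of_nat p | a)%ZZ ->
  gauss (a * Z.of_nat u) p = (- gauss a p)%C.
Proof.
move=> pp nu npa; have p0 := prime_gt0 pp.
pose F t := echar p (a * Z.of_nat t).
have E c : gauss (a * Z.of_nat c) p = \csum_(x < p) F ((c * (x * x)) %% p)%N.
  apply: eq_bigr => x _; apply: echar_eqmod => //.
  exists (a * Z.of_nat ((c * (x * x)) %/ p))%ZZ.
  have -> : (a * Z.of_nat c * (Z.of_nat x * Z.of_nat x) = a * Z.of_nat (c * (x * x))%N)%ZZ.
    by rewrite !ZofM; ring.
  by rewrite {1}(divn_eq (c * (x * x)) p) ZofD ZofM; ring.
have -> : gauss a p = gauss (a * Z.of_nat 1) p by rewrite Z.mul_1_r.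
suff H : (gauss (a * Z.of_nat 1) p + gauss (a * Z.of_nat u) p = 0)%C.
  by rewrite -[LHS]Cplus_0_r -(Cplus_opp_r (gauss (a * Z.of_nat 1) p)) Cplus_assoc [(gauss _ _
    + gauss _ _)%C]Cplus_comm H Cplus_0_l.
have hm c x : ((c * (x * x)) %% p < p)%N by rewrite ltn_mod.
rewrite !E (csum_fibers F (hm 1%N)) (csum_fibers F (hm u)) -big_split /=.
transitivity (\csum_(t < p) (RtoC 2 * F t)).
  apply: eq_bigr => t _; rewrite -Cmult_plus_distr_r -RtoC_plus -plus_INR plusE.
  by rewrite (roots_twist pp nu (ltn_ord t)).
by rewrite csum_scale_const echar_sum0 // Cmult_0_r.
Qed.

(** * The sums over residues prime to the modulus *)

Definition coprimeZ (a : Z) (d : nat) := coprime (Z.abs_nat a) d.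

Lemma dvdZ_abs m a : (Z.of_nat m | a)%ZZ -> (m %| Z.abs_nat a)%N.
Proof.
move=> [k ->]; apply/dvdnP; exists (Z.abs_nat k).
by rewrite Zabs2Nat.inj_mul Zabs2Nat.id.
Qed.

Lemma odd_abs a : odd (Z.abs_nat a) = Z.odd a.
Proof.
have h k : Z.odd (Z.of_nat k) = odd k.
  elim: k => [//|k IH]; rewrite -addn1 oddD -IH ZofD Z.odd_add.
  by rewrite /= addbT; case: (Z.odd _).
have [E|E] : a = Z.of_nat (Z.abs_nat a) \/ a = (- Z.of_nat (Z.abs_nat a))%ZZ by lia.
  by rewrite {2}E h.
by rewrite {2}E Z.odd_opp h.
Qed.

Lemma coprimeZ_odd a d : coprimeZ a d -> ~~ odd d -> Z.odd a = true.
Proof.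
rewrite /coprimeZ -odd_abs => c ev; apply: contraTT c => ev'.
by apply/negP => /eqP g; have : (2 %| gcdn (Z.abs_nat a) d)%N;
  [rewrite dvdn_gcd !dvdn2 ev ev'|rewrite g].
Qed.

Lemma coprimeZ_cancel a m : coprimeZ a m -> odd m ->
  forall y, (Z.of_nat m | 2 * a * Z.of_nat y)%ZZ -> (m %| y)%N.
Proof.
move=> c om y /dvdZ_abs; rewrite !Zabs2Nat.inj_mul Zabs2Nat.id.
rewrite -[Z.abs_nat 2]/2%N !multE => h; rewrite -(@Gauss_dvdr _ (2 * Z.abs_nat a)) //.
by rewrite coprimeMr coprimen2 om /= coprime_sym.
Qed.

Lemma coprimeZ_dvd a d d' : (d' %| d)%N -> coprimeZ a d -> coprimeZ a d'.
Proof. exact: coprime_dvdr. Qed.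

Lemma gauss_sq a m t : odd m -> (0 < t)%N -> coprimeZ a m -> gauss a (m * m * t) =
  (RtoC (INR m) * gauss a t)%C.
Proof.
move=> om t0 c; have m0 : (0 < m)%N by case: (m) om.
by apply: gauss_odd_square => //; apply: coprimeZ_cancel.
Qed.

Lemma gauss_pow4 a j : Z.odd a = true -> gauss a (4 ^ j.+1) = (RtoC (INR (2 ^ j)) * gauss a 4)%C.
Proof.
move=> oa; elim: j => [|j IH]; first by rewrite Cmult_1_l.
rewrite [(4 ^ _)%N]expnS [(4 ^ j.+1)%N]expnS gauss_4t ?expn_gt0 // -expnS IH expnS -multE
  mult_INR RtoC_mult.
by rewrite -[INR 2]/2 Cmult_assoc.
Qed.

Lemma gauss_pow8 a j : Z.odd a = true -> gauss a (4 ^ j * 8) = (RtoC (INR (2 ^ j)) * gauss a 8)%C.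
Proof.
move=> oa; elim: j => [|j IH]; first by rewrite mul1n Cmult_1_l.
have E k : (4 ^ k * 8 = 4 * (4 ^ k * 2))%N by lia.
rewrite E expnS -mulnA gauss_4t ?muln_gt0 ?expn_gt0 // -E IH expnS -multE mult_INR RtoC_mult.
by rewrite -[INR 2]/2 Cmult_assoc.
Qed.

Lemma gauss_odd_sq a l : odd l -> coprimeZ a l -> gauss a (l * l) = RtoC (INR l).
Proof. by move=> ol c; rewrite -[(l * l)%N]muln1 gauss_sq // gauss_1 Cmult_1_r. Qed.

Lemma even_decomp l : (0 < l)%N -> exists j m, odd m /\ l = (2 ^ j * m)%N.
Proof.
move=> l0; have [m cm lm] := pfactor_coprime (isT : prime 2) l0.
by exists (logn 2 l), m; split; [rewrite -coprime2n|rewrite mulnC].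
Qed.

(** Powers of 4 reduce to the modulus 4, where the sum is explicit. *)
Lemma gauss_even_sq a l : (0 < l)%N -> ~~ odd l -> coprimeZ a l -> gauss a (l * l) =
  (RtoC (INR l) * (1 + echar 4 a))%C.
Proof.
move=> l0 el c; have oa := coprimeZ_odd c el.
have [j [m [om lE]]] := even_decomp l0.
case: j lE => [|j] lE; first by move: el; rewrite lE mul1n om.
have cm : coprimeZ a m by apply: coprimeZ_dvd c; rewrite lE dvdn_mull.
have -> : (l * l = m * m * 4 ^ j.+1)%N.
  by rewrite lE mulnACA -expnMn mulnC.
rewrite gauss_sq ?expn_gt0 // gauss_pow4 // gauss_4 lE expnS -!multE !mult_INR !RtoC_mult -[INR
  2]/2.
by ring.
Qed.

Section Form.

Variables (n : nat) (b : 'I_n -> Z).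
Hypothesis hb : forall i, b i = 1%ZZ \/ b i = (-1)%ZZ.
Hypothesis on : odd n.

(** The sum of [e (a F(x) / d)] over all [x] modulo [d], as a product of
    one-variable Gauss sums. *)
Definition gauss_prod (a : Z) (d : nat) : C := \big[Cmult/RtoC 1]_(i < n) gauss (a * b i) d.

Definition prim_sum (d : nat) : C := \csum_(a < d | coprime a d) gauss_prod (Z.of_nat a) d.

Lemma abs_mulb a i : Z.abs_nat (a * b i) = Z.abs_nat a.
Proof. by case: (hb i) => ->; lia. Qed.

Lemma coprimeZ_mulb a i d : coprimeZ (a * b i) d = coprimeZ a d.
Proof. by rewrite /coprimeZ abs_mulb. Qed.

Lemma coprimeZ_nat a d : coprimeZ (Z.of_nat a) d = coprime a d.
Proof. by rewrite /coprimeZ Zabs2Nat.id. Qed.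

Lemma gauss_prod_eqmod a a' d : (Z.of_nat d | a - a')%ZZ -> gauss_prod a d = gauss_prod a' d.
Proof.
move=> [k hk]; apply: eq_bigr => i _; apply: gauss_eqmod.
by exists (k * b i)%ZZ; rewrite -Z.mul_sub_distr_r hk; ring.
Qed.

Lemma gauss_prod_mod a d : gauss_prod (Z.of_nat (a %% d)) d = gauss_prod (Z.of_nat a) d.
Proof.
symmetry; apply: gauss_prod_eqmod; exists (Z.of_nat (a %/ d)).
by rewrite {1}(divn_eq a d) ZofD ZofM; ring.
Qed.

Lemma prod_const (c : C) k : \big[Cmult/RtoC 1]_(i < k) c = (c ^ k)%C.
Proof. by elim: k => [|k IH]; rewrite ?big_ord0 // big_ord_recl IH. Qed.

Lemma prod_scale (c : C) (f : 'I_n -> C) :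
  \big[Cmult/RtoC 1]_(i < n) (c * f i)%C = (c ^ n * \big[Cmult/RtoC 1]_(i < n) f i)%C.
Proof. by rewrite big_split prod_const. Qed.

Lemma Cpow_m1_odd k : odd k -> ((-1) ^ k = -1)%C.
Proof.
move=> ok; have -> : k = (2 * k./2).+1 by rewrite mul2n -{1}(odd_double_half k) ok.
rewrite Cpow_S -multE Cpow_mult_r.
have -> : ((-1) ^ 2 = 1)%C by rewrite /=; ring.
by rewrite Cpow_1_l; ring.
Qed.

(** The substitution [a -> a u] permutes the residues prime to [d] and multiplies
    each product of [n] Gauss sums by [(-1)^n = -1], so the sum equals its
    opposite. This is where the parity of [n] matters. *)
Lemma prim_sum_twist d u : coprime u d ->
  (forall a, coprimeZ a d -> gauss (a * Z.of_nat u) d = (- gauss a d)%C) -> prim_sum d = 0.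
Proof.
move=> cu tw.
have : prim_sum d = (- prim_sum d)%C.
  rewrite {1}/prim_sum -(@csum_reindex d (fun a => gauss_prod (Z.of_nat a) d) (coprime^~ d)
    (fun a => a * u)%N).
  - rewrite (eq_bigl (fun a : 'I_d => coprime a d)); last by move=> a; rewrite coprimeMl cu andbT.
    have -> : (- prim_sum d = -1 * prim_sum d)%C by ring.
    rewrite -csum_scale_const; apply: eq_bigr => a ca.
    rewrite -(Cpow_m1_odd on) /gauss_prod -prod_scale; apply: eq_bigr => i _.
    rewrite ZofM (_ : (Z.of_nat a * Z.of_nat u * b i = Z.of_nat a * b i * Z.of_nat u)%ZZ);
      last by ring.
    by rewrite tw ?coprimeZ_mulb ?coprimeZ_nat //; ring.
  - by move=> x; rewrite gauss_prod_mod.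
  - by move=> x; rewrite coprime_modl.
  exact: mulmod_inj.
move=> h; have two : RtoC 2 <> 0 by move/RtoC_inj; lra.
apply: (Cmult_cancel two); rewrite Cmult_0_r.
have -> : (2 * prim_sum d = prim_sum d + prim_sum d)%C by ring.
by rewrite {1}h; ring.
Qed.

(** Extracting square factors until the cofactor is squarefree. *)
Lemma square_decomp d : (0 < d)%N ->
  exists s m, [/\ d = (s * (m * m))%N, (0 < m)%N & forall p, prime p -> ~~ (p * p %| s)%N].
Proof.
elim/ltn_ind: d => d IH d0.
case: (classic (exists p, prime p /\ (p * p %| d)%N)) => [[p [pp /dvdnP [d' hd]]]|H].
  have p1 := prime_gt1 pp.
  have d'0 : (0 < d')%N by move: d0; rewrite hd muln_gt0 => /andP [].
  have pp1 : (1 < p * p)%N by rewrite (leq_trans p1) // leq_pmull // ltnW.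
  have lt : (d' < d)%N by rewrite hd ltn_Pmulr.
  have [s [m [e m0 sf]]] := IH d' lt d'0.
  exists s, (m * p)%N; split=> //; last by rewrite muln_gt0 m0 ltnW.
  by rewrite hd e -!mulnA; congr (_ * _)%N; rewrite mulnCA !mulnA.
exists d, 1%N; split=> //; first by lia.
by move=> p pp; apply/negP => h; apply: H; exists p.
Qed.

(** Write [d = s m^2] with [s > 1] squarefree. If an odd prime [p] divides [s], then
    [d = q^2 p t] with [q] a power of [p] and [p] prime to [t], and the sign change
    comes from [u] which is a non-residue modulo [p] and 1 modulo [t]. Otherwise
    [s = 2]: either [d = 2 m^2] with [m] odd, and all Gauss sums vanish, or
    [d = 2^(2 j + 3) m^2] with [m] odd, and the Gauss sums are multiples of
    [e (a / 8)], which changes sign under [u = 1 + 4 m]. *)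
Lemma prim_sum_nonsquare d : (0 < d)%N -> (forall l, d <> l * l)%N -> prim_sum d = 0.
Proof.
move=> d0 ns; have [s [m [dE m0 sf]]] := square_decomp d0.
have s0 : (0 < s)%N by move: d0; rewrite dE muln_gt0 => /andP [].
case: (classic (exists p, [/\ prime p, odd p & p %| s]%N)) => [[p [pp op /dvdnP [t' sE]]]|H].
  have p0 := prime_gt0 pp.
  have cpt' : coprime p t'.
    rewrite prime_coprime //; apply/negP => /dvdnP [k hk].
    by have := sf p pp; rewrite sE hk -mulnA dvdn_mull.
  have [m' cm mE] := pfactor_coprime pp m0.
  set q := (p ^ _)%N in mE.
  have oq : odd q by rewrite oddX op orbT.
  pose t := (t' * (m' * m'))%N.
  have t0 : (0 < t)%N by rewrite /t; move: s0 m0;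
    rewrite sE mE !muln_gt0 => /andP [-> _] /andP [-> _].
  have cpt : coprime p t by rewrite /t !coprimeMr cpt' cm.
  have dE' : d = (q * q * (p * t))%N.
    by rewrite dE sE mE /t; move: (q) => q'; lia.
  have [u0 nu] := nonresidue_exists pp op.
  clearbody t; pose u := chinese p t u0 1.
  have up : (u = u0 %[mod p])%N by apply: chinese_modl.
  have ut : (u = 1 %[mod t])%N by apply: chinese_modr.
  have nu' : nonresidue p u by move=> y; rewrite up; apply: nu.
  have cup : coprime u p.
    rewrite coprime_sym prime_coprime //; apply/negP => /eqP h; apply: (nu 0%N).
    by rewrite -up h mod0n.
  have cut : coprime u t by rewrite -coprime_modl ut coprime_modl coprime1n.
  have cuq : coprime u q by rewrite coprimeXr.
  apply: (@prim_sum_twist d u); first by rewrite dE' !coprimeMr cuq cup cut.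
  move=> a; rewrite dE' => ca.
  have caq : coprimeZ a q by apply: coprimeZ_dvd ca; rewrite -!mulnA dvdn_mulr.
  have cap : coprimeZ a p by apply: coprimeZ_dvd ca; rewrite mulnA mulnAC dvdn_mull.
  have cauq : coprimeZ (a * Z.of_nat u) q.
    by rewrite /coprimeZ Zabs2Nat.inj_mul Zabs2Nat.id multE coprimeMl cuq andbT.
  rewrite !gauss_sq ?muln_gt0 ?p0 // !gauss_crt //.
  have -> : (a * Z.of_nat u * Z.of_nat t = a * Z.of_nat t * Z.of_nat u)%ZZ by ring.
  rewrite gauss_nonresidue //; last first.
    move=> /dvdZ_abs; rewrite Zabs2Nat.inj_mul Zabs2Nat.id multE.
    rewrite Gauss_dvdl //; have := cap;
      rewrite /coprimeZ coprime_sym prime_coprime // => /negP; exact.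
  have -> : gauss (a * Z.of_nat u * Z.of_nat p) t = gauss (a * Z.of_nat p) t.
    apply: gauss_eqmod; have /eqP := ut.
    have u0' : (0 < u)%N.
      by case: posnP cup => // ->; rewrite /coprime gcd0n => /eqP p1; move: pp; rewrite p1 //.
    rewrite eqn_mod_dvd // => /dvdnP [k hk].
    exists (a * Z.of_nat p * Z.of_nat k)%ZZ.
    have -> : Z.of_nat u = (1 + Z.of_nat k * Z.of_nat t)%ZZ by rewrite -ZofM -hk; lia.
    by ring.
  by ring.
have s2 : s = 2%N.
  have s1 : s <> 1%N by move=> e; apply: (ns m); rewrite dE e mul1n.
  have lt1 : (1 < s)%N by lia.
  have es : ~~ odd s.
    apply/negP => os; apply: H; exists (pdiv s); split;
      [exact: pdiv_prime|exact: dvdn_odd (pdiv_dvd s) os|exact: pdiv_dvd].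
  have [k sk] : exists k, s = (k * 2)%N by exists s./2; rewrite muln2;
    move: (odd_double_half s); rewrite (negbTE es).
  have ok : odd k.
    apply: contraT => ek; have := sf 2%N isT; rewrite sk dvdn_pmul2r // dvdn2 ek //.
  case: (ltnP 1 k) => [k1|]; last by case: (k) ok sk => [|[|]].
  case: H; exists (pdiv k); split; [exact: pdiv_prime|exact: dvdn_odd (pdiv_dvd k) ok|].
  by rewrite sk dvdn_mulr // pdiv_dvd.
have [j [m' [om mE]]] := even_decomp m0.
have m'0 : (0 < m')%N by case: (m') om.
case: j mE => [|j] mE.
  have dE' : d = (m' * m' * 2)%N by rewrite dE s2 mE mul1n mulnC.
  apply: (@prim_sum_twist d 1); first exact: coprime1n.
  move=> a; rewrite dE' Z.mul_1_r => ca.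
  have oa : Z.odd a = true by apply: coprimeZ_odd ca _; rewrite oddM andbF.
  have cam : coprimeZ a m' by apply: coprimeZ_dvd ca; rewrite -mulnA dvdn_mulr.
  by rewrite gauss_sq // gauss_2 //; ring.
have dE' : d = (m' * m' * (4 ^ j * 8))%N.
  rewrite dE s2 mE (_ : 4 = 2 * 2)%N // expnMn expnS; lia.
pose u := (1 + 4 * m')%N.
have ou : odd u by rewrite /u oddD oddM.
have cum : coprime u m' by rewrite coprime_sym /coprime /u addnC gcdnMDl gcdn1.
have cu2 : coprime u 2 by rewrite coprimen2.
apply: (@prim_sum_twist d u).
  rewrite dE' !coprimeMr cum (_ : 4 = 2 ^ 2)%N // (_ : 8 = 2 ^ 3)%N // -expnM.
  by rewrite !coprimeXr.
move=> a; rewrite dE' => ca.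
have oa : Z.odd a = true by apply: coprimeZ_odd ca _; rewrite !oddM !andbF.
have cam : coprimeZ a m' by apply: coprimeZ_dvd ca; rewrite -mulnA dvdn_mulr.
have oau : Z.odd (a * Z.of_nat u) = true.
  by rewrite -odd_abs Zabs2Nat.inj_mul Zabs2Nat.id multE oddM odd_abs oa ou.
have caum : coprimeZ (a * Z.of_nat u) m'.
  by rewrite /coprimeZ Zabs2Nat.inj_mul Zabs2Nat.id multE coprimeMl cum andbT.
rewrite !gauss_sq ?muln_gt0 ?expn_gt0 // !gauss_pow8 // !gauss_8 //.
have -> : (a * Z.of_nat u = a + Z.of_nat 4 * (a * Z.of_nat m'))%ZZ by rewrite /u ZofD ZofM; ring.
rewrite echar_add (@echar_scale 4 2) // echar2_odd; first by ring.
by rewrite -odd_abs Zabs2Nat.inj_mul Zabs2Nat.id multE oddM odd_abs oa om.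
Qed.

Lemma csum_cond_const d (Q : pred nat) (c : C) :
  \csum_(a < d | Q a) c = (RtoC (INR (\sum_(a < d) Q a)) * c)%C.
Proof.
elim: d => [|d IH]; first by rewrite !big_ord0 Cmult_0_l.
rewrite big_mkcond (csumS (fun a => if Q a then c else RtoC 0)) -big_mkcond IH.
by rewrite big_ord_recr plus_INR RtoC_plus; case: (Q d) => /=; ring.
Qed.

Lemma csum_totient d (c : C) : \csum_(a < d | coprime a d) c = (RtoC (INR (totient d)) * c)%C.
Proof.
rewrite (csum_cond_const d (coprime^~ d)) totient_count_coprime big_mkord.
by congr (RtoC (INR _) * _)%C; apply: eq_bigr => i _; rewrite coprime_sym.
Qed.

Lemma csum_totient_sq l (c : C) :
  \csum_(a < l * l | coprime a (l * l)) c = (RtoC (INR l) * RtoC (INR (totient l)) * c)%C.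
Proof.
rewrite big_mkcond (csum_block (fun a => if coprime a (l * l) then c else RtoC 0)).
transitivity (\csum_(y < l | coprime y l) (RtoC (INR l) * c)); last by rewrite csum_totient; ring.
rewrite [RHS]big_mkcond; apply: eq_bigr => y _.
have E z : coprime (y + l * z) (l * l) = coprime y l.
  by rewrite coprimeMr andbb addnC mulnC coprime_sym /coprime gcdnMDl gcdnC.
case: ifP => h; last by apply: big1 => z _; rewrite E h.
by rewrite -csum_const; apply: eq_bigr => z _; rewrite E h.
Qed.

Lemma prim_sum_sq_odd l : odd l ->
  prim_sum (l * l) = (RtoC (INR l) * RtoC (INR (totient l)) * RtoC (INR l) ^ n)%C.
Proof.
move=> ol; rewrite -csum_totient_sq; apply: eq_bigr => a.
rewrite coprimeMr andbb => ca.
rewrite -(prod_const _ n); apply: eq_bigr => i _.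
by rewrite gauss_odd_sq // coprimeZ_mulb coprimeZ_nat.
Qed.

(** The real part of the product of the [1 + i b_k], since [echar 4 1 = i]: the
    mean of the values at [a = 1] and [a = -1] modulo 4. *)
Definition dyadic_const : C :=
  ((\big[Cmult/RtoC 1]_(i < n) (1 + echar 4 (b i)) +
    \big[Cmult/RtoC 1]_(i < n) (1 + echar 4 (- b i))) / 2)%C.

(** The product of the [1 + i^(a b_k)] only depends on [a] modulo 4; pairing [a]
    with [-a] replaces it by its mean [dyadic_const]. *)
Lemma prim_sum_sq_even l : (0 < l)%N -> ~~ odd l ->
  prim_sum (l * l) = (dyadic_const * (RtoC (INR l) * RtoC (INR (totient l)) * RtoC (INR l) ^
    n))%C.
Proof.
move=> l0 el.
pose w (a : Z) : C := \big[Cmult/RtoC 1]_(i < n) (1 + echar 4 (a * b i))%C.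
pose W := \csum_(a < l * l | coprime a (l * l)) w (Z.of_nat a).
have AE : prim_sum (l * l) = (RtoC (INR l) ^ n * W)%C.
  rewrite /W -csum_scale_const; apply: eq_bigr => a.
  rewrite coprimeMr andbb => ca.
  by rewrite -prod_scale; apply: eq_bigr => i _;
    rewrite gauss_even_sq // coprimeZ_mulb coprimeZ_nat.
have l4 : (4 %| l * l)%N by rewrite (_ : 4 = 2 * 2)%N // dvdn_mul // dvdn2.
have w4 a a' : (Z.of_nat 4 | a - a')%ZZ -> w a = w a'.
  move=> [k hk]; apply: eq_bigr => i _; congr (_ + _)%C; apply: echar_eqmod => //.
  by exists (k * b i)%ZZ; rewrite -Z.mul_sub_distr_r hk; ring.
pose u := (l * l - 1)%N.
have ll : (0 < l * l)%N by rewrite muln_gt0 l0.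
have cu : coprime u (l * l).
  by rewrite /u subn1 coprimePn.
have WE : W = \csum_(a < l * l | coprime a (l * l)) w (Z.opp (Z.of_nat a)).
  rewrite /W -(@csum_reindex (l * l) (fun a => w (Z.of_nat a)) (coprime^~ (l * l)%N) (fun a =>
    a * u)%N).
  - apply: eq_big => [a|a _]; first by rewrite coprimeMl cu andbT.
    apply: w4; have /dvdnP [k hk] := l4; exists (Z.of_nat a * Z.of_nat k)%ZZ.
    rewrite ZofM (_ : Z.of_nat u = Z.of_nat k * Z.of_nat 4 - 1)%ZZ; first by ring.
    by rewrite -ZofM -hk /u; lia.
  - move=> x; apply: w4; have /dvdnP [k hk] := l4.
    exists (- (Z.of_nat (x %/ (l * l)) * Z.of_nat k))%ZZ.
    move: (divn_eq x (l * l)); move: (x %/ _)%N (x %% _)%N => q r ->.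
    by rewrite hk !ZofD !ZofM; ring.
  - by move=> x; rewrite coprime_modl.
  exact: mulmod_inj.
have two : RtoC 2 <> 0 by move/RtoC_inj; lra.
have : (2 * W = 2 * (dyadic_const * (RtoC (INR l) * RtoC (INR (totient l)))))%C.
  have -> : (2 * W = W + W)%C by ring.
  rewrite {2}WE -big_split /=.
  have -> : (2 * (dyadic_const * (RtoC (INR l) * RtoC (INR (totient l)))) =
     RtoC (INR l) * RtoC (INR (totient l)) * (2 * dyadic_const))%C by ring.
  rewrite -csum_totient_sq; apply: eq_bigr => a.
  rewrite coprimeMr andbb => ca.
  have oa : odd a by move: ca; apply: contraTT => ea; apply/negP => /eqP g;
     have : (2 %| gcdn a l)%N; [rewrite dvdn_gcd !dvdn2 ea el|rewrite g].
  have -> : (2 * dyadic_const = w 1%ZZ + w (-1)%ZZ)%C.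
    rewrite /dyadic_const; have -> : forall z, (2 * (z / 2) = z)%C by move=> z; field.
    congr (_ + _)%C; apply: eq_bigr => i _; congr (_ + echar _ _)%C; lia.
  have [[k hk]|[k hk]] : (exists k, Z.of_nat a = 1 + 4 * k)%ZZ \/ (exists k, Z.of_nat a =
    3 + 4 * k)%ZZ.
  - move: (divn_eq a 4) (ltn_pmod a (isT : 0 < 4)%N) oa; move: (nat_of_ord a) => {ca}a.
    move: (a %/ 4)%N (a %% 4)%N => q r ->; rewrite oddD oddM andbF addFb.
    by case: r => [|[|[|[|r]]]] // _ _; [left|right]; exists (Z.of_nat q); lia.
  - congr (_ + _)%C; apply: w4; [exists k|exists (- k)%ZZ]; rewrite hk -[Z.of_nat 4]/4%ZZ; ring.
  - rewrite [RHS]Cplus_comm; congr (_ + _)%C; apply: w4;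
    [exists (k + 1)%ZZ|exists (- k - 1)%ZZ]; rewrite hk -[Z.of_nat 4]/4%ZZ; ring.
move=> /(Cmult_cancel two) WW; rewrite AE WW; ring.
Qed.

Definition sq_weight (l : nat) : C := if odd l then RtoC 1 else dyadic_const.

Lemma prim_sum_sq l : (0 < l)%N ->
  prim_sum (l * l) = (sq_weight l * (RtoC (INR l) * RtoC (INR (totient l)) * RtoC (INR l) ^ n))%C.
Proof.
move=> l0; rewrite /sq_weight; case: ifP => ol; first by rewrite prim_sum_sq_odd // Cmult_1_l.
by rewrite prim_sum_sq_even // ol.
Qed.

(** * Reduction of the complete sums to the primitive ones *)

Lemma gauss_scale g d a : (0 < g)%N -> (0 < d)%N ->
  gauss (Z.of_nat g * a) (g * d) = (RtoC (INR g) * gauss a d)%C.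
Proof.
move=> g0 d0; rewrite /gauss [(g * d)%N]mulnC (csum_block (fun x => echar (d * g) (Z.of_nat g *
  a * (Z.of_nat x * Z.of_nat x)))).
rewrite -csum_scale_const; apply: eq_bigr => y _; rewrite -csum_const; apply: eq_bigr => z _.
rewrite -(@echar_scale g d) // [(g * d)%N]mulnC; apply: echar_eqmod; first by rewrite muln_gt0 d0.
exists (a * (2 * Z.of_nat y * Z.of_nat z + Z.of_nat d * Z.of_nat z * Z.of_nat z))%ZZ.
by rewrite ZofD !ZofM; ring.
Qed.

Lemma gauss_prod_scale g d a : (0 < g)%N -> (0 < d)%N ->
  gauss_prod (Z.of_nat g * a) (g * d) = (RtoC (INR g) ^ n * gauss_prod a d)%C.
Proof.
move=> g0 d0; rewrite /gauss_prod -prod_scale; apply: eq_bigr => i _.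
by rewrite -Z.mul_assoc gauss_scale.
Qed.

(** Residues modulo [q] are sorted by their gcd [g] with [q], as [g a] with [a]
    prime to [q / g]. *)
Lemma csum_gcd q (f : nat -> C) : (0 < q)%N ->
  \csum_(a < q) f a = \csum_(g < q.+1 | (g %| q)%N) \csum_(a < q %/ g | coprime a (q %/ g)) f
    (g * a)%N.
Proof.
move=> q0.
transitivity (\csum_(a < q) \csum_(g < q.+1 | gcdn a q == g) f a).
  apply: eq_bigr => a _.
  have h : (gcdn a q < q.+1)%N by rewrite ltnS dvdn_leq // dvdn_gcdr.
  by rewrite (big_pred1 (Ordinal h)) // => i; rewrite eq_sym.
rewrite (exchange_big_dep predT) //= [RHS]big_mkcond; apply: eq_bigr => g _.
case: ifP => [/dvdnP [d hd]|ng]; last first.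
  by apply: big_pred0 => a; apply/negP => /eqP e; move: ng; rewrite -e dvdn_gcdr.
move: (nat_of_ord g) hd => {}g hd.
have g0 : (0 < g)%N by move: q0; rewrite hd muln_gt0 => /andP [].
rewrite hd mulnK // mulnC.
transitivity (\csum_(a < g * d | (g %| a)%N) (if gcdn a (g * d) == g then f a else RtoC 0)).
  rewrite -big_mkcondr; apply: eq_bigl => a.
  case: eqP => [e|_]; last by rewrite andbF.
  by have := dvdn_gcdl a (g * d); rewrite e => ->.
rewrite (csum_multiples (fun a => if gcdn a (g * d) == g then f a else RtoC 0)) //.
rewrite [RHS]big_mkcond; apply: eq_bigr => a _.
by rewrite -muln_gcdr -{2}[g]muln1 eqn_pmul2l.
Qed.

Lemma gauss_prod_sum_divisors q : (0 < q)%N ->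
  \csum_(a < q) gauss_prod (Z.of_nat a) q =
    \csum_(g < q.+1 | (g %| q)%N) (RtoC (INR g) ^ n * prim_sum (q %/ g)%N).
Proof.
move=> q0; rewrite (csum_gcd (fun a => gauss_prod (Z.of_nat a) q)) //.
apply: eq_bigr => g /dvdnP [d]; move: (nat_of_ord g) => {}g hd.
move: q0; rewrite {}hd => q0; have g0 : (0 < g)%N by move: q0; rewrite muln_gt0 => /andP [].
rewrite mulnK // /prim_sum -csum_scale_const; apply: eq_bigr => a _.
by rewrite [(d * g)%N]mulnC ZofM gauss_prod_scale //; move: q0; rewrite muln_gt0 => /andP [].
Qed.

End Form.

Lemma F_sum n (b : 'rV[Z]_n) (x : 'cV[Z]_n) :
  F b x = (\sum_(i < n) (x i ord0 * b ord0 i * x i ord0))%R.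
Proof.
rewrite /F mul_mx_diag mxE; apply: eq_bigr => i _.
by rewrite !mxE.
Qed.

Lemma Ssum_gauss_prod n (b : 'rV[Z]_n) q : (0 < q)%N ->
  Ssum b q 0%R = \csum_(a < q) gauss_prod (fun i => b ord0 i) (Z.of_nat a) q.
Proof.
move=> q0; apply: eq_bigr => a _.
rewrite /gauss_prod /gauss (bigA_distr_bigA (fun (i : 'I_n) (j : 'I_q) =>
   echar q (Z.of_nat a * b ord0 i * (Z.of_nat j * Z.of_nat j)))) /=.
rewrite (reindex (fun f : {ffun 'I_n -> 'I_q} => (\col_i f i)%R)) /=; last first.
  apply: onW_bij; exists (fun M : 'cV_n => [ffun i => M i ord0]).
    by move=> f; apply/ffunP => i; rewrite ffunE mxE.
  by move=> M; apply/colP => i; rewrite mxE ffunE.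
apply: eq_bigr => f _.
set x := map_mx _ _.
rewrite trmx0 mul0mx mxE.
transitivity (echar q (Z.of_nat a * F b x)).
  by rewrite /echar; congr (e (IZR _ / _)); rewrite -[LHS]/(Z.of_nat a * F b x + 0)%ZZ Z.add_0_r.
rewrite F_sum.
rewrite (big_morph (fun z => echar q (Z.of_nat a * z)) (id1 := RtoC 1) (op1 := Cmult));
  first last.
- by rewrite -[X in (_ * X)%ZZ]/0%ZZ Z.mul_0_r echar0.
- by move=> y z; rewrite -echar_add -Z.mul_add_distr_l.
apply: eq_bigr => i _; rewrite !mxE; congr echar.
rewrite -[LHS]/(Z.of_nat a * (Z.of_nat (f i) * b ord0 i * Z.of_nat (f i)))%ZZ; ring.
Qed.

Lemma Ssum_divisors n (b : 'rV[Z]_n) q : signs b -> odd n -> (0 < q)%N ->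
  Ssum b q 0%R = \csum_(g < q.+1 | (g %| q)%N) (RtoC (INR g) ^ n * prim_sum (fun i => b ord0 i)
    (q %/ g)%N).
Proof. by move=> hb on q0; rewrite Ssum_gauss_prod // gauss_prod_sum_divisors. Qed.

(** * Complex powers *)

Lemma cpow_plus x z w : cpow x (z + w) = (cpow x z * cpow x w)%C.
Proof. by rewrite /cpow -Cexp_plus; congr Cexp; ring. Qed.

Lemma Cexp_0 : Cexp 0 = 1.
Proof. by rewrite /Cexp /= exp_0 cos_0 sin_0 Cmult_1_l. Qed.

Lemma cpow_0 x : cpow x 0 = 1.
Proof. by rewrite /cpow Cmult_0_l Cexp_0. Qed.

Lemma cpow_opp_mul x z : (cpow x (- z) * cpow x z = 1)%C.
Proof. by rewrite -cpow_plus Cplus_comm Cplus_opp_r cpow_0. Qed.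

Lemma cpow_neq0 x z : cpow x z <> 0.
Proof. by move=> h; have := cpow_opp_mul x z; rewrite h Cmult_0_r => /RtoC_inj; lra. Qed.

Lemma cpow_opp x z : cpow x (- z) = (/ cpow x z)%C.
Proof.
by rewrite -[LHS]Cmult_1_r -(Cinv_r _ (@cpow_neq0 x z)) Cmult_assoc cpow_opp_mul Cmult_1_l.
Qed.

Lemma cpow_mul x y z : 0 < x -> 0 < y -> cpow (x * y) z = (cpow x z * cpow y z)%C.
Proof. by move=> x0 y0; rewrite /cpow -Cexp_plus ln_mult // RtoC_plus; congr Cexp; ring. Qed.

Lemma Cexp_R x : Cexp (RtoC x) = RtoC (exp x).
Proof. by rewrite /Cexp /= cos_0 sin_0 Cmult_1_r. Qed.

Lemma cpow_nat x k : 0 < x -> cpow x (RtoC (INR k)) = (RtoC x ^ k)%C.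
Proof.
move=> x0; elim: k => [|k IH]; first exact: cpow_0.
rewrite S_INR RtoC_plus cpow_plus IH Cpow_S Cmult_comm; congr (_ * _)%C.
by rewrite /cpow Cmult_1_l Cexp_R exp_ln.
Qed.

Lemma cpow_mulnat x z k : cpow x (RtoC (INR k) * z) = (cpow x z ^ k)%C.
Proof.
elim: k => [|k IH]; first by rewrite Cmult_0_l cpow_0.
rewrite S_INR RtoC_plus Cpow_S -IH -cpow_plus; congr cpow; ring.
Qed.

Lemma Cmod_cpow x z : Cmod (cpow x z) = exp (Re z * ln x).
Proof. by rewrite /cpow Cmod_Cexp; congr exp; rewrite /= Rmult_0_r Rminus_0_r. Qed.

Lemma RtoC_pow2 k : RtoC (INR (2 ^ k)) = (RtoC 2 ^ k)%C.
Proof. by elim: k => [//|k IH]; rewrite expnS -multE mult_INR RtoC_mult IH. Qed.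

(** The term [m^(-z)] of a Dirichlet series, written without a quotient so that
    it is additive in the exponent. *)
Definition npow (m : nat) (z : C) : C := cpow (INR m) (- z).

Lemma npowE m z : npow m z = (1 / cpow (INR m) z)%C.
Proof. by rewrite /npow cpow_opp /Cdiv Cmult_1_l. Qed.

Lemma npow1 z : npow 1 z = 1.
Proof. by rewrite /npow /cpow /= ln_1 Cmult_0_r Cexp_0. Qed.

Lemma npow_mul m k z : (0 < m)%N -> (0 < k)%N -> npow (m * k) z = (npow m z * npow k z)%C.
Proof. by move=> /INR_gt0 m0 /INR_gt0 k0; rewrite /npow -multE mult_INR cpow_mul. Qed.

Lemma npow_plus m z w : npow m (z + w) = (npow m z * npow m w)%C.
Proof. by rewrite /npow -cpow_plus; congr cpow; ring. Qed.

Lemma npow_nat m k : (0 < m)%N -> (npow m (RtoC (INR k)) * RtoC (INR m) ^ k = 1)%C.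
Proof. by move=> /INR_gt0 m0; rewrite /npow -cpow_nat // cpow_opp_mul. Qed.

Lemma Cmod_npow m z k : (0 < m)%N -> INR k <= Re z -> Cmod (npow m z) <= / INR m ^ k.
Proof.
move=> m0 hk; have mp := INR_gt0 m0.
have l0 : 0 <= ln (INR m).
  have : 1 <= INR m by rewrite -[1]/(INR 1); apply: le_INR; apply/leP.
  case=> [h|<-]; last by rewrite ln_1; lra.
  by left; rewrite -ln_1; apply: ln_increasing; lra.
have -> : / INR m ^ k = Cmod (npow m (RtoC (INR k))).
  have := congr1 Cmod (npow_nat k m0); rewrite Cmod_mult Cmod_pow Cmod_R Rabs_pos_eq; last lra.
  rewrite Cmod_1 => h; have p0 : 0 < INR m ^ k by apply: pow_lt.
  by apply: (Rmult_eq_reg_r (INR m ^ k)); rewrite ?h ?Rinv_l //; lra.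
rewrite !Cmod_cpow /=.
have : - Re z * ln (INR m) <= - INR k * ln (INR m) by nra.
move: z hk => [x y] /= hk [h|->]; last lra.
by left; apply: exp_increasing.
Qed.

Lemma inv_sq_bdd n : \rsum_(k < n) / INR k.+1 ^ 2 <= 2.
Proof.
suff h m : \rsum_(k < m.+1) / INR k.+1 ^ 2 <= 2 - / INR m.+1.
  case: n => [|n]; first by rewrite big_ord0; lra.
  have := h n; have : 0 < / INR n.+1 by apply/Rinv_0_lt_compat/INR_gt0.
  lra.
elim: m => [|m IH]; first by rewrite big_ord_recr big_ord0 /= !Rmult_1_r Rinv_1; lra.
rewrite (rsumS (fun k => / INR k.+1 ^ 2)) [INR m.+2]S_INR; move: IH.
have := INR_gt0 (ltn0Sn m); move: (bigop.body _ _ _) (INR m.+1) => x y y0 IH.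
have E : / (y + 1) ^ 2 <= / y - / (y + 1).
  have -> : / y - / (y + 1) = / (y * (y + 1)) by field; lra.
  apply: Rinv_le_contravar; first by apply: Rmult_lt_0_compat; lra.
  simpl; nra.
lra.
Qed.

Lemma dirichlet_abs (f : nat -> C) B z : 0 <= B -> (forall k, Cmod (f k.+1) <= B * INR k.+1) ->
  3 <= Re z -> abs_bdd (fun k => f k.+1 * npow k.+1 z)%C (2 * B).
Proof.
move=> B0 hf hz n.
apply: (Rle_trans _ (B * (\rsum_(k < n) / INR k.+1 ^ 2))).
  rewrite big_distrr; apply: ler_rsum => k _;
    rewrite Cmod_mult -[X in _ <= X]/(B * / INR k.+1 ^ 2).
  have h3 := @Cmod_npow k.+1 z 3 isT; have k0 := INR_gt0 (ltn0Sn k).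
  apply: (Rle_trans _ (B * INR k.+1 * / INR k.+1 ^ 3)).
    apply: Rmult_le_compat; [exact: Cmod_ge_0|exact: Cmod_ge_0|exact: hf|].
    by apply: h3; simpl; lra.
  by right; field; lra.
by have := inv_sq_bdd n; nra.
Qed.

Lemma dirichlet_abs1 (f : nat -> C) B z : 0 <= B -> (forall k, Cmod (f k.+1) <= B) ->
  2 <= Re z -> abs_bdd (fun k => f k.+1 * npow k.+1 z)%C (2 * B).
Proof.
move=> B0 hf hz n.
apply: (Rle_trans _ (B * (\rsum_(k < n) / INR k.+1 ^ 2))).
  rewrite big_distrr; apply: ler_rsum => k _;
    rewrite Cmod_mult -[X in _ <= X]/(B * / INR k.+1 ^ 2).
  apply: Rmult_le_compat; [exact: Cmod_ge_0|exact: Cmod_ge_0|exact: hf|].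
  by apply: Cmod_npow => //; simpl; lra.
by have := inv_sq_bdd n; nra.
Qed.

(** * Dirichlet products *)

Definition dsum (f : nat -> C) z l := sums (fun k => f k.+1 * npow k.+1 z)%C l.

Definition dconv (f g : nat -> C) (m : nat) : C :=
  \csum_(d < m.+1 | (d %| m)%N) (f d * g (m %/ d)%N).

Lemma csum_divisors (F : nat -> C) m :
  \csum_(d < m.+2 | (d %| m.+1)%N) F d = \csum_(i < m.+1 | (i.+1 %| m.+1)%N) F i.+1.
Proof.
rewrite big_mkcond (csumSl (fun d => if (d %| m.+1)%N then F d else RtoC 0)) -big_mkcond.
by rewrite dvd0n; apply: Cplus_0_l.
Qed.

Lemma dirichlet_mul f g z A B alpha beta :
  abs_bdd (fun k => f k.+1 * npow k.+1 z)%C alpha ->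
  abs_bdd (fun k => g k.+1 * npow k.+1 z)%C beta ->
  dsum f z A -> dsum g z B -> dsum (dconv f g) z (A * B)%C.
Proof.
move=> ha hb sa sb.
pose h i j := (i.+1 * j.+1).-1.
have hh i j m : (h i j == m) = (i.+1 * j.+1 == m.+1)%N by rewrite /h;
  case: (i.+1 * j.+1)%N (muln_gt0 i.+1 j.+1).
have h1 i j : (i <= h i j)%N by rewrite -ltnS /h prednK ?muln_gt0 // leq_pmulr.
have h2 i j : (j <= h i j)%N by rewrite -ltnS /h prednK ?muln_gt0 // leq_pmull.
apply: sums_ext (prod_sums h1 h2 ha hb sa sb) => m.
rewrite /dconv (csum_divisors (fun d => f d * g (m.+1 %/ d)%N)%C) big_distrl [RHS]big_mkcond.
apply: eq_bigr => i _; move: (nat_of_ord i) => {}i.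
case: ifP => [/dvdnP [q hq]|nd]; last first.
  apply: big_pred0 => j; rewrite hh; apply/negP => /eqP e.
  by move: nd; rewrite -e dvdn_mulr.
have q0 : (0 < q)%N by case: (q) hq.
have qm : (q.-1 < m.+1)%N by rewrite prednK // hq leq_pmulr.
rewrite (big_pred1 (Ordinal qm)) => [|j]; last first.
  rewrite /= hh; apply/eqP/eqP => [e1|->]; last by rewrite /= prednK // mulnC -hq.
  have /eqP : (j.+1 * i.+1)%N = (q * i.+1)%N by rewrite -hq mulnC.
  by rewrite eqn_pmul2r // => /eqP jq; apply: val_inj; rewrite /= -jq.
rewrite /= prednK //; move: hq {qm} => ->; rewrite mulnK // npow_mul //; ring.
Qed.

(** The coefficients of [1 + c 2^(-z)]. *)
Definition fin2 (c : C) (d : nat) : C := if d == 1%N then RtoC 1 else if d == 2%N then c else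
  RtoC 0.

Lemma fin2_abs c z : exists B, abs_bdd (fun k => fin2 c k.+1 * npow k.+1 z)%C B.
Proof.
exists (\rsum_(k < 2) Cmod (fin2 c k.+1 * npow k.+1 z)) => n.
have p k : 0 <= Cmod (fin2 c k.+1 * npow k.+1 z) by apply: Cmod_ge_0.
have -> : \rsum_(k < 2) Cmod (fin2 c k.+1 * npow k.+1 z) =
  \rsum_(k < n.+2) Cmod (fin2 c k.+1 * npow k.+1 z).
  elim: n => [//|n IH]; rewrite [RHS](rsumS (fun k => Cmod (fin2 c k.+1 * npow k.+1 z))) -IH.
  by rewrite Cmult_0_l Cmod_0 Rplus_0_r.
exact: (rsum_mono p (leqW (leqnSn n))).
Qed.

Lemma fin2_sum c z : dsum (fin2 c) z (1 + c * npow 2 z)%C.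
Proof.
have -> : (1 + c * npow 2 z)%C = \csum_(k < 2) (fin2 c k.+1 * npow k.+1 z).
  by rewrite !big_ord_recr big_ord0 /= /fin2 /= npow1; ring.
by apply: sums_finite => -[|[|n]] // _; rewrite Cmult_0_l.
Qed.

Lemma dconv_fin2 c g m : (0 < m)%N ->
  dconv (fin2 c) g m = (g m + (if (2 %| m)%N then c * g (m %/ 2)%N else 0))%C.
Proof.
case: m => // m _; rewrite /dconv (csum_divisors (fun d => fin2 c d * g (m.+1 %/ d)%N)%C).
rewrite big_mkcond (csumSl (fun i => if (i.+1 %| m.+1)%N then (fin2 c i.+1 * g (m.+1 %/
  i.+1)%N)%C else RtoC 0)).
rewrite dvd1n divn1 Cmult_1_l; congr (_ + _)%C.
case: m => [|m]; first by rewrite big_ord0.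
rewrite (csumSl (fun i => if (i.+2 %| m.+2)%N then (fin2 c i.+2 * g (m.+2 %/ i.+2)%N)%C else
  RtoC 0)).
rewrite [X in (_ + X)%C]big1 ?Cplus_0_r // => i _.
by rewrite /fin2 Cmult_0_l; case: ifP.
Qed.

Lemma big_totient_C m : (0 < m)%N ->
  \csum_(d < m.+1 | (d %| m)%N) RtoC (INR (totient d)) = RtoC (INR m).
Proof.
move=> m0; rewrite -[in RHS](sum_totient_dvd m).
rewrite (big_morph INR plus_INR (erefl : INR 0 = 0)).
by rewrite (big_morph RtoC RtoC_plus (erefl : RtoC 0 = RtoC 0)).
Qed.

Section Coefficients.

Variable cc : C.

Definition weight (l : nat) : C := ((if odd l then RtoC 1 else cc) * RtoC (INR (totient l)))%C.

(** The coefficients of [zeta(z) (1 - 2^(-z))]. *)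
Definition oddind (m : nat) : C := if odd m then RtoC 1 else RtoC 0.

Lemma dconv_oddind m : (0 < m)%N -> dconv (fin2 (-1)) (fun=> RtoC 1) m = oddind m.
Proof.
move=> m0; rewrite dconv_fin2 // /oddind dvdn2.
by case: (odd m) => /=; ring.
Qed.

(** Both sides equal [m] when [m] is odd, where the weights are 1 and the totients
    of the divisors sum to [m]. When [m = 2 k], the divisors [d] with [m / d] odd are
    the divisors of [m] that do not divide [k]; they are even and their totients
    sum to [m - k = k], giving [cc * k = m + (cc - 2) k]. *)
Lemma dconv_weight m : (0 < m)%N ->
  dconv weight oddind m = dconv (fin2 (cc - 2)) (fun m => RtoC (INR m)) m.
Proof.
move=> m0; rewrite dconv_fin2 // dvdn2.
have od d : (d %| m)%N -> odd m -> odd d by move=> dm; apply: dvdn_odd.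
case om: (odd m) => /=.
  rewrite Cplus_0_r -big_totient_C //; apply: eq_bigr => d dm.
  rewrite /weight /oddind (od _ dm om) (dvdn_odd (dvdn_div dm) om); ring.
have [k mk] : exists k, m = (2 * k)%N by exists m./2; rewrite mul2n -{1}(odd_double_half m) om.
have k0 : (0 < k)%N by move: m0; rewrite mk muln_gt0.
transitivity (cc * (\csum_(d < m.+1 | (d %| m)%N && ~~ (d %| k)%N) RtoC (INR (totient d))))%C.
  rewrite -csum_scale_const /dconv [RHS]big_mkcondr; apply: eq_bigr => d dm.
  have d0 : (0 < d)%N by apply: dvdn_gt0 dm.
  case/dvdnP: dm => q; move: (nat_of_ord d) d0 => {}d d0 hq; rewrite hq mulnK //.
  have -> : (d %| k)%N = ~~ odd q.
    apply/idP/idP => [/dvdnP [r kr]|].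
      have : (q * d == 2 * r * d)%N by rewrite -hq mk kr mulnA.
      by rewrite eqn_pmul2r // => /eqP ->; rewrite oddM.
    rewrite -dvdn2 => /dvdnP [r qr]; apply/dvdnP; exists r.
    by apply/eqP; rewrite -(eqn_pmul2l (isT : 0 < 2)%N) -mk hq qr mulnA [(r * 2)%N]mulnC.
  rewrite negbK /weight /oddind; case oq: (odd q); last by rewrite Cmult_0_r.
  suff -> : odd d = false by ring.
  by have := om; rewrite hq oddM oq.
have E : (\csum_(d < m.+1 | (d %| m)%N && ~~ (d %| k)%N) RtoC (INR (totient d)) + RtoC (INR k)
  = RtoC (INR m))%C.
  rewrite -(big_totient_C m0) [RHS](bigID (fun d : 'I_m.+1 => (d %| k)%N)) /= Cplus_comm
    -[RHS]/(Cplus _ _); congr Cplus.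
  rewrite -(big_totient_C k0).
  rewrite (big_ord_widen_cond m.+1 (fun d => d %| k)%N (fun d => RtoC (INR (totient d))));
    last by rewrite mk ltnS leq_pmull.
  have km : (k %| m)%N by rewrite mk dvdn_mull.
  apply: eq_bigl => d; apply/andP/andP => [[h1 h2]|[h1 h2]]; split=> //.
    exact: dvdn_trans h1 km.
  by rewrite ltnS dvdn_leq.
have -> : (m %/ 2 = k)%N by rewrite mk mulKn.
move: E; rewrite mk -multE mult_INR multE RtoC_mult -mk -[INR 2]/2.
move: (bigop.body _ _ _) => X E.
have -> : X = RtoC (INR k).
  have -> : X = (X + RtoC (INR k) - RtoC (INR k))%C by ring.
  by rewrite E; ring.
ring.
Qed.

Lemma weight_bound k : Cmod (weight k.+1) <= (1 + Cmod cc) * INR k.+1.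
Proof.
rewrite /weight Cmod_mult; have c0 := Cmod_ge_0 cc.
have h : Cmod (INR (totient k.+1)) <= INR k.+1.
  rewrite Cmod_R Rabs_pos_eq; last exact: pos_INR.
  apply: le_INR; apply/leP; rewrite totient_count_coprime big_mkord.
  have : (\sum_(i < k.+1) coprime k.+1 i <= \sum_(i < k.+1) 1)%N.
    by apply: leq_sum => i _; apply: leq_b1.
  by rewrite [X in (_ <= X)%N -> _]sum_nat_const card_ord muln1.
apply: Rmult_le_compat => //; [exact: Cmod_ge_0|exact: Cmod_ge_0|].
by case: (odd _); rewrite ?Cmod_1; lra.
Qed.

(** In Dirichlet series: the series of [weight] times that of [oddind], compared with
    that of [m] times [1 + (cc - 2) 2^(-tau)]. For the weight [totient], that is
    [cc = 1], this is the classical [zeta(tau - 1) / zeta(tau)]. *)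
Lemma weight_sum tau z1 z2 : 3 <= Re tau ->
  dsum (fun=> RtoC 1) tau z1 -> dsum (fun m => RtoC (INR m)) tau z2 ->
  exists L, dsum weight tau L /\
    (L * (z1 * (1 - npow 2 tau)) = (1 + (cc - 2) * npow 2 tau) * z2)%C.
Proof.
move=> ht s1 s2.
have c0 := Cmod_ge_0 cc.
have cc1 : 0 <= 1 + Cmod cc by lra.
have aw := dirichlet_abs cc1 weight_bound ht.
have [L sL] := abs_bdd_sums aw; exists L; split=> //.
have a1 : abs_bdd (fun k => (fun=> RtoC 1) k.+1 * npow k.+1 tau)%C (2 * 1).
  by apply: (dirichlet_abs1 (f := fun=> RtoC 1)); [lra|move=> k; rewrite Cmod_1; lra|lra].
have a2 : abs_bdd (fun k => RtoC (INR k.+1) * npow k.+1 tau)%C (2 * 1).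
  apply: (dirichlet_abs (f := fun m => RtoC (INR m))) => //; first lra.
  by move=> k; rewrite Cmod_R Rabs_pos_eq; [lra|exact: pos_INR].
have [B1 b1] := fin2_abs (-1) tau; have [B2 b2] := fin2_abs (cc - 2) tau.
have t1 := dirichlet_mul b1 a1 (fin2_sum (-1) tau) s1.
have t2 := dirichlet_mul b2 a2 (fin2_sum (cc - 2) tau) s2.
have t3 : dsum oddind tau ((1 + -1 * npow 2 tau) * z1)%C.
  by apply: sums_ext t1 => k; rewrite dconv_oddind.
have a3 : abs_bdd (fun k => oddind k.+1 * npow k.+1 tau)%C (2 * 1).
  apply: (dirichlet_abs1 (f := oddind)); [lra| |lra].
  by move=> k; rewrite /oddind; case: (odd _); rewrite ?Cmod_1 ?Cmod_0; lra.
have t4 := dirichlet_mul aw a3 sL t3.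
have -> : (z1 * (1 - npow 2 tau) = (1 + -1 * npow 2 tau) * z1)%C by ring.
apply: sums_unique t4 _; apply: sums_ext t2 => k; by rewrite dconv_weight.
Qed.

End Coefficients.

(** * Summation of D and of its dyadic factor for Re s > 1 *)

Lemma Re_plus z w : Re (z + w) = Re z + Re w. Proof. by []. Qed.
Lemma Re_opp z : Re (- z) = - Re z. Proof. by []. Qed.
Definition ReE := (Re_plus, Re_opp, re_scal_l, re_RtoC).

Section Series.

Variables (n : nat) (b : 'rV[Z]_n).
Hypotheses (hb : signs b) (on : odd n).

Let B (i : 'I_n) : Z := b ord0 i.
Let cc : C := dyadic_const B.

Lemma npow_shift m s k : (0 < m)%N ->
  (RtoC (INR m) ^ k * npow m (s + RtoC (INR k)) = npow m s)%C.
Proof.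
move=> m0; rewrite npow_plus.
have -> : (RtoC (INR m) ^ k * (npow m s * npow m (RtoC (INR k))) =
  npow m s * (npow m (RtoC (INR k)) * RtoC (INR m) ^ k))%C by ring.
by rewrite npow_nat // Cmult_1_r.
Qed.

Lemma nonsquare_or q : (exists l, q = l * l)%N \/ (forall l, q <> l * l)%N.
Proof.
case: (classic (exists l, q = l * l)%N) => h; [by left|right => l e; apply: h; by exists l].
Qed.

(** The factor [l^(n + 1)] in [prim_sum_sq] shifts the exponent [2 (w + n)] of the
    square [l^2] down to [2 w + n - 1]. *)
Lemma prim_sum_sq_weight l w : (0 < l)%N ->
  (prim_sum B (l * l) * npow (l * l) (w + RtoC (INR n)) =
    weight cc l * npow l (2 * w + RtoC (INR n) - 1))%C.
Proof.
move=> l0; rewrite prim_sum_sq // npow_mul // -npow_plus.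
have -> : (w + INR n + (w + INR n) = (2 * w + INR n - 1 + RtoC (INR 1)) + RtoC (INR n))%C.
  by rewrite -[RtoC (INR 1)]/(RtoC 1); ring.
rewrite /weight /sq_weight -/cc.
set t := (2 * w + INR n - 1)%C; set W := (if odd l then _ else _).
rewrite -[npow l t](npow_shift t 1 l0) -(npow_shift (t + RtoC (INR 1)) n l0) Cpow_1_r; ring.
Qed.

(** The coefficient of [q^(-s-n-1)] is a sum over the factorizations [q = g d];
    only squares [d = l^2] contribute, so the series is the product, regrouped along
    [i l^2], of the series of [zeta (s + 1)] and of [weight]. *)
Lemma D_series s z1 L : 1 < Re s -> dsum (fun=> RtoC 1) (s + 1) z1 ->
  dsum (weight cc) (2 * s + RtoC (INR n) + 1) L ->
  sums (fun k => Ssum b k.+1 0%R / cpow (INR k.+1) (s + RtoC (INR n) + 1))%C (z1 * L)%C.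
Proof.
move=> hs s1 s2.
have n0 := pos_INR n.
pose h i l := (i.+1 * (l.+1 * l.+1)).-1.
have h0 i l : (0 < i.+1 * (l.+1 * l.+1))%N by rewrite !muln_gt0.
have hh i l m : (h i l == m) = (i.+1 * (l.+1 * l.+1) == m.+1)%N.
  by rewrite /h; case: (i.+1 * (l.+1 * l.+1))%N (h0 i l).
have h1 i l : (i <= h i l)%N by rewrite -ltnS /h prednK // leq_pmulr // muln_gt0.
have h2 i l : (l <= h i l)%N.
  by rewrite -ltnS /h prednK // (leq_trans (leq_pmulr l.+1 (ltn0Sn l))) // leq_pmull.
have a1 : abs_bdd (fun k => (fun=> RtoC 1) k.+1 * npow k.+1 (s + 1))%C (2 * 1).
  by apply: (dirichlet_abs1 (f := fun=> RtoC 1)); [lra|move=> k; rewrite Cmod_1;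
    lra|rewrite !ReE; lra].
have cc0 := Cmod_ge_0 cc; have cc1 : 0 <= 1 + Cmod cc by lra.
have a2 : abs_bdd (fun k => weight cc k.+1 * npow k.+1 (2 * s + RtoC (INR n) + 1))%C (2 * (1 +
  Cmod cc)).
  by apply: (dirichlet_abs cc1 (weight_bound cc)); rewrite !ReE; lra.
apply: sums_ext (prod_sums h1 h2 a1 a2 s1 s2) => m.
rewrite Ssum_divisors // (csum_divisors (fun g => RtoC (INR g) ^ n * prim_sum B (m.+1 %/ g)%N)%C).
rewrite /Cdiv -cpow_opp -/(npow m.+1 _) big_distrl [RHS]big_mkcond; apply: eq_bigr => i _.
move: (nat_of_ord i) => {}i; rewrite -[Monoid.MulLaw.sort _]/Cmult.
case: ifP => [/dvdnP [q hq]|nd]; last first.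
  apply: big_pred0 => j; rewrite hh; apply/negP => /eqP e.
  by move: nd; rewrite -e dvdn_mulr.
have q0 : (0 < q)%N by case: (q) hq.
case: (nonsquare_or q) => [[l ql]|nq]; last first.
  rewrite (_ : m.+1 %/ i.+1 = q)%N; last by rewrite hq mulnK.
  rewrite (prim_sum_nonsquare _ on q0 nq) //.
  rewrite big_pred0; first by rewrite -[RHS]/(_ * _ * _)%C; ring.
  move=> j; rewrite hh; apply/negP => /eqP e; apply: (nq j.+1).
  by apply/eqP; rewrite -(eqn_pmul2r (ltn0Sn i)) [(j.+1 * j.+1 * i.+1)%N]mulnC e -hq.
have l0 : (0 < l)%N by move: q0; rewrite ql muln_gt0 => /andP [].
have lm : (l.-1 < m.+1)%N.
  by rewrite prednK // hq ql -mulnA leq_pmulr // muln_gt0 l0.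
rewrite (big_pred1 (Ordinal lm)) => [|j]; last first.
  rewrite /= hh; apply/eqP/eqP => [e1|->]; last by rewrite /= prednK // mulnC -ql -hq.
  have /eqP : (j.+1 * j.+1 * i.+1)%N = (l * l * i.+1)%N by rewrite -ql -hq mulnC.
  rewrite eqn_pmul2r // => /eqP jq; apply: val_inj => /=.
  by move/eqP: jq; rewrite !mulnn eqn_exp2r // => /eqP <-.
rewrite -[nat_of_ord (Ordinal lm)]/(l.-1) prednK // Cmult_1_l.
rewrite -[RHS]/(RtoC (INR i.+1) ^ n * prim_sum B (m.+1 %/ i.+1)%N * npow m.+1 (s + INR n + 1))%C.
move: hq {lm} => ->; rewrite mulnK // ql.
have E : (s + INR n + 1 = (s + 1) + INR n)%C by ring.
rewrite E [(l * l * i.+1)%N]mulnC npow_mul ?muln_gt0 ?l0 //.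
rewrite -(npow_shift (s + 1) n (ltn0Sn i)).
have -> : (2 * s + INR n + 1 = 2 * (s + 1) + INR n - 1)%C by ring.
rewrite -prim_sum_sq_weight //; ring.
Qed.

Lemma csum_pow2_divisors (F : nat -> C) k :
  \csum_(g < (2 ^ k).+1 | (g %| 2 ^ k)%N) F g = \csum_(i < k.+1) F (2 ^ i)%N.
Proof.
have lt (i : 'I_k.+1) : (2 ^ i < (2 ^ k).+1)%N by rewrite ltnS leq_exp2l // -ltnS.
rewrite (reindex_onto (fun i => Ordinal (lt i)) (fun g => inord (logn 2 g))) /=; last first.
  move=> g /(dvdn_pfactor _ _ (isT : prime 2)) [i ik e]; apply: val_inj.
  by rewrite /= e pfactorK // inordK.
apply: eq_bigl => i; rewrite pfactorK // inord_val eqxx andbT dvdn_exp2l //.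
by rewrite -ltnS.
Qed.

Lemma sums_geom x : Cmod x <= 1 / 2 -> sums (fun k => x ^ k)%C (/ (1 - x))%C.
Proof.
move=> hx.
have bd : abs_bdd (fun k => x ^ k)%C (2 * 1).
  apply: geo_abs_bdd; first lra.
  by move=> k; rewrite Rmult_1_l Cmod_pow; apply: pow_incr; split=> //; apply: Cmod_ge_0.
have [l sl] := abs_bdd_sums bd.
have ne : (1 - x <> 0)%C.
  move=> /(proj2 (Ceq_minus _ _)) e; move: hx; rewrite -e Cmod_1; lra.
suff -> : (/ (1 - x) = l)%C by [].
have E : l = (1 + x * l)%C.
  apply: (@cvs_unique (fun N => \csum_(k < N.+1) x ^ k)).
    by move=> eps /sl [N HN]; exists N => m hm; apply: HN; apply: leqW.
  apply: cvs_ext (cvs_plus (cvs_const 1) (cvs_scal x sl)) => N.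
  rewrite (csumSl (fun k => x ^ k)%C) -csum_scale_const; congr (_ + _)%C.
apply: (Cmult_cancel ne); rewrite Cinv_r //.
have -> : ((1 - x) * l = l - x * l)%C by ring.
by rewrite {1}E; ring.
Qed.

Lemma Cmod_cpow2 z : Re z <= -1 -> Cmod (cpow 2 z) <= 1 / 2.
Proof.
move=> hz; rewrite Cmod_cpow.
have l2 : 0 < ln 2 by rewrite -ln_1; apply: ln_increasing; lra.
have -> : 1 / 2 = exp (- ln 2) by rewrite exp_Ropp exp_ln; lra.
have : Re z * ln 2 <= - ln 2 by nra.
by case=> [h|->]; [left; apply: exp_increasing|lra].
Qed.

Lemma pow2_odd_nonsquare j l : (2 ^ (j.*2.+1) <> l * l)%N.
Proof.
move=> e; have l0 : (0 < l)%N by case: l e => //; rewrite muln0 => /eqP; rewrite expn_eq0.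
have := congr1 (logn 2) e; rewrite pfactorK // lognM // => /(congr1 odd).
by rewrite addnn /= !odd_double.
Qed.

(** As for [D_series], with the exponents of 2 as indices: the regrouping is along
    [i + 2 j] and both factors are geometric series, in [x = 2^(-(s+1))] and in
    [v = 2^(-(2s+n))]. *)
Lemma D2_series s : 1 < Re s ->
  sums (fun k => Ssum b (2 ^ k)%N 0%R *
          cpow (INR 2) (- (RtoC (INR k) * (s + RtoC (INR n) + 1))))%C
   ((1 + (cc / 2 - 1) * cpow 2 (- (2 * s + RtoC (INR n)))) /
    ((1 - cpow 2 (- (s + 1))) * (1 - cpow 2 (- (2 * s + RtoC (INR n))))))%C.
Proof.
move=> hs; have n0 := pos_INR n.
pose y := cpow 2 (- (s + INR n + 1)).
set x := cpow 2 (- (s + 1)); set v := cpow 2 (- (2 * s + INR n)).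
have xE : x = (RtoC 2 ^ n * y)%C.
  rewrite /y (_ : (s + INR n + 1 = (s + 1) + INR n)%C); last by ring.
  by rewrite -[cpow 2 _]/(npow 2 _) (npow_shift (s + 1) n (isT : 0 < 2)%N).
have vE : v = (RtoC 2 ^ 2 * RtoC 2 ^ n * (y * y))%C.
  have two : RtoC (INR 2) = RtoC 2 by [].
  rewrite /y -cpow_plus.
  have -> : (- (s + INR n + 1) + - (s + INR n + 1) = - (((2 * s + INR n) + INR n) + INR 2))%C.
    by rewrite two; ring.
  rewrite -[v]/(npow 2 (2 * s + INR n)) -(npow_shift (2 * s + INR n) n (isT : 0 < 2)%N).
  rewrite -(npow_shift (2 * s + INR n + INR n) 2 (isT : 0 < 2)%N) two /npow.
  by rewrite -[INR 2]/2; ring.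
have x1 : Cmod x <= 1 / 2 by apply: Cmod_cpow2; rewrite !ReE; lra.
have v1 : Cmod v <= 1 / 2 by apply: Cmod_cpow2; rewrite !ReE; lra.
have yE : cpow (INR 2) (- (s + INR n + 1)) = y by [].
clearbody x y v.
have nx : (1 - x <> 0)%C by move=> /(proj2 (Ceq_minus _ _)) e; move: x1; rewrite -e Cmod_1; lra.
have nv : (1 - v <> 0)%C by move=> /(proj2 (Ceq_minus _ _)) e; move: v1; rewrite -e Cmod_1; lra.
(* The totient of [2^j] is [2^(j-1)] only for positive [j]: the term [j = 0] deviates
   from the geometric progression of ratio [v] and first term [cc / 2]. *)
pose be j := (prim_sum B (2 ^ j * 2 ^ j) * y ^ j.*2)%C.
have beE j : be j = (cc / 2 * v ^ j + (1 - cc / 2) * (if j is 0%N then 1 else 0))%C.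
  rewrite /be prim_sum_sq ?expn_gt0 //; case: j => [|j].
    by rewrite /sq_weight /= Cpow_1_l; field.
  have T : totient (2 ^ j.+1) = (2 ^ j)%N by rewrite totient_pfactor // mul1n.
  have O : odd (2 ^ j.+1) = false by rewrite oddX.
  rewrite /sq_weight O T -/cc doubleS vE.
  have Y k : (y ^ k.*2 = (y * y) ^ k)%C.
    elim: k => [//|k IH]; by rewrite doubleS !Cpow_S IH; ring.
  have P2 : (RtoC 2 ^ 2 = 2 * 2)%C by rewrite /=; ring.
  have X : ((RtoC 2 ^ j) ^ n = (RtoC 2 ^ n) ^ j)%C by rewrite -!Cpow_mult_r Nat.mul_comm.
  rewrite !RtoC_pow2 P2 !Cpow_S Y !Cpow_mult_l X; field.
have E0 : sums (fun j => (1 - cc / 2) * (if j is 0%N then RtoC 1 else RtoC 0))%C (1 - cc / 2)%C.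
  rewrite -[X in sums _ X]Cmult_1_r; apply: sums_scal.
  pose d0 (j : nat) := if j is 0%N then RtoC 1 else RtoC 0.
  suff : sums d0 (\csum_(j < 1) d0 j) by rewrite big_ord_recr big_ord0 /= Cplus_0_l.
  by apply: sums_finite => -[].
have sb : sums be ((1 + (cc / 2 - 1) * v) / (1 - v))%C.
  have -> : ((1 + (cc / 2 - 1) * v) / (1 - v) = cc / 2 * / (1 - v) + (1 - cc / 2))%C by field.
  by apply: sums_ext (sums_plus (sums_scal (cc / 2) (sums_geom v1)) E0) => j; rewrite beE.
have bx : abs_bdd (fun k => x ^ k)%C (2 * 1).
  apply: geo_abs_bdd; first lra.
  by move=> k; rewrite Rmult_1_l Cmod_pow; apply: pow_incr; split=> //; apply: Cmod_ge_0.
have bb : abs_bdd be (2 * (Cmod (cc / 2) + Cmod (1 - cc / 2))).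
  have p1 := Cmod_ge_0 (cc / 2); have p2 := Cmod_ge_0 (1 - cc / 2).
  apply: geo_abs_bdd; first lra.
  move=> k; rewrite beE Rmult_plus_distr_r.
  apply: (Rle_trans _ (Cmod (cc / 2) * Cmod (v ^ k) + Cmod (1 - cc / 2) * Cmod (if k is 0%N
    then 1 else 0))).
    by rewrite -!Cmod_mult; apply: Cmod_triangle.
  apply: Rplus_le_compat; apply: Rmult_le_compat_l => //.
    by rewrite Cmod_pow; apply: pow_incr; split=> //; apply: Cmod_ge_0.
  case: k => [|k]; first by rewrite Cmod_1 /=; lra.
  by rewrite Cmod_0; apply: pow_le; lra.
have h1 i j : (i <= i + j.*2)%N by rewrite leq_addr.
have h2 i j : (j <= i + j.*2)%N by rewrite -addnn addnA leq_addl.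
have := prod_sums h1 h2 bx bb (sums_geom x1) sb.
have -> : (/ (1 - x) * ((1 + (cc / 2 - 1) * v) / (1 - v)) =
  (1 + (cc / 2 - 1) * v) / ((1 - x) * (1 - v)))%C by field.
apply: sums_ext => k.
rewrite Ssum_divisors // ?expn_gt0 //.
rewrite (csum_pow2_divisors (fun g => RtoC (INR g) ^ n * prim_sum B (2 ^ k %/ g)%N)%C).
rewrite (_ : (- (INR k * (s + INR n + 1)) = INR k * (- (s + INR n + 1)))%C); last by ring.
rewrite cpow_mulnat yE big_distrl; apply: eq_bigr => i _.
have hi : (i <= k)%N by rewrite -ltnS.
rewrite -[Monoid.MulLaw.sort _]/Cmult.
move: (nat_of_ord i) hi => {}i hi.
rewrite -expnB //.
have XI : ((RtoC (INR (2 ^ i)) ^ n * prim_sum B (2 ^ (k - i))%N * y ^ k) =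
  x ^ i * (prim_sum B (2 ^ (k - i))%N * y ^ (k - i)%N))%C.
  rewrite -[in LHS](subnKC hi) Cpow_add_r xE Cpow_mult_l RtoC_pow2 -!Cpow_mult_r [(i *
    n)%coq_nat]Nat.mul_comm addKn; ring.
rewrite -[RHS]/(RtoC (INR (2 ^ i)) ^ n * prim_sum B (2 ^ (k - i))%N * y ^ k)%C XI.
have [[j ej]|[j ej]] : (exists j, k - i = j.*2)%N \/ (exists j, k - i = j.*2.+1)%N.
- have := odd_double_half (k - i); case: (odd _) => /= <-; [right|left]; by eexists.
- have jk : (j < k.+1)%N by move: ej; rewrite -addnn; lia.
  rewrite (big_pred1 (Ordinal jk)) => [|l]; last first.
    apply/eqP/eqP => [e|->]; last by rewrite /= -ej subnKC.
    have : (k - i = l.*2)%N by rewrite -[X in (X - _)%N]e addKn.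
    by rewrite ej => /double_inj jl; apply: val_inj.
  by rewrite /be /= ej -expnD addnn.
rewrite ej (prim_sum_nonsquare _ on) ?expn_gt0 //; last by move=> l; apply: pow2_odd_nonsquare.
rewrite big_pred0; first by ring.
move=> l; apply/negP => /eqP e.
have : (k - i = l.*2)%N by rewrite -[X in (X - _)%N]e addKn.
rewrite ej => /(congr1 odd).
by rewrite /= !odd_double.
Qed.

(** Each of the [n] factors has modulus at most 2. The bound does not depend on
    the signs, which gives uniformity in the form. *)
Lemma Cmod_dyadic_const : Cmod cc <= 2 ^ n.
Proof.
have hp (f : 'I_n -> Z) : Cmod (\big[Cmult/RtoC 1]_(i < n) (1 + echar 4 (f i))%C) <= 2 ^ n.
  have -> : 2 ^ n = \big[Rmult/1]_(i < n) 2.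
    by elim: (n) => [|k IH]; rewrite ?big_ord0 // big_ord_recl -IH.
  apply: (big_ind2 (fun x y => Cmod x <= y)) => [|x1 y1 x2 y2 g1 g2|i _].
  - by rewrite Cmod_1; lra.
  - rewrite Cmod_mult; apply: Rmult_le_compat => //; exact: Cmod_ge_0.
  apply: Rle_trans (Cmod_triangle _ _) _; rewrite Cmod_1 /echar Cmod_e; lra.
rewrite /cc /dyadic_const Cmod_div; last by move/RtoC_inj; lra.
have := Cmod_triangle (\big[Cmult/RtoC 1]_(i < n) (1 + echar 4 (B i))%C) (\big[Cmult/RtoC 1]_(i
  < n) (1 + echar 4 (- B i))%C).
have := hp B; have := hp (fun i => - B i)%ZZ.
rewrite Cmod_R Rabs_pos_eq; last lra.
move=> p1 p2 p3; lra.
Qed.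

End Series.

(** * The zeta function to the right of the line Re s = 2 *)

Lemma near_Re_gt c s : c < Re s -> near s (fun z => c < Re z).
Proof.
move=> h; exists (Re s - c); split; first lra.
move=> z hz; have h1 : Rabs (Re z - Re s) <= Cmod (z - s) := re_le_Cmod (z - s).
have := Rle_abs (- (Re z - Re s)); rewrite Rabs_Ropp; lra.
Qed.

Section Zeta.

Variable zeta : C -> C.
Hypothesis hzeta : is_riemann_zeta zeta.

Lemma zeta_dsum s : 1 < Re s -> dsum (fun=> RtoC 1) s (zeta s).
Proof.
move=> hs; have [_ /(_ s hs) /is_series_sums] := hzeta.
by apply: sums_ext => k; rewrite npowE Cmult_1_l.
Qed.

Lemma zeta_dsum_shift s : 1 < Re s -> dsum (fun m => RtoC (INR m)) (s + 1) (zeta s).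
Proof.
move=> /zeta_dsum; apply: sums_ext => k.
rewrite Cmult_1_l -[RtoC 1]/(RtoC (INR 1)) -(npow_shift s 1 (ltn0Sn k)) Cpow_1_r //.
Qed.

Lemma zeta_bounded s : 2 <= Re s -> Cmod (zeta s) <= 2 * 1.
Proof.
move=> hs; apply: sums_bound (zeta_dsum _); last lra.
by apply: (dirichlet_abs1 (f := fun=> RtoC 1)); [lra|move=> k; rewrite Cmod_1; lra|].
Qed.

(** The series bounds [zeta] by 2 near [s], whereas a pole would force the
    numerator [g] of its polar form, which is [zeta] times a power of [z - s], to
    vanish at [s]. *)
Lemma zeta_analytic s : 2 < Re s -> analytic_at zeta s.
Proof.
move=> hs; have [/(_ s) [//|[k [g [k0 ag gs /locally'_near H]]]] _] := hzeta.
exfalso; have g0 : 0 < Cmod (g s) by apply/Cmod_gt_0.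
have gc := analytic_cont ag (Rlt_gt _ _ (Rmult_lt_0_compat _ _ g0 (Rinv_0_lt_compat 2 Rlt_0_2))).
have small : near s (fun z => Cmod (z - s) < Rmin 1 (Cmod (g s) / 4)).
  by exists (Rmin 1 (Cmod (g s) / 4)); split=> //; apply: Rmin_glb_lt; lra.
have [z [nz [[/(_ nz) h1 /(_ nz) h2] [h3 h4]]]] := exists_near (near_and (near_and H gc)
  (near_and (near_Re_gt hs) small)).
have zb := zeta_bounded (Rlt_le _ _ h3).
have e : g z = (zeta z * (z - s) ^ k)%C by rewrite h1; field; apply: pow_neq0.
have d1 : Cmod (z - s) < 1 by apply: Rlt_le_trans h4 (Rmin_l _ _).
have d2 : Cmod (z - s) < Cmod (g s) / 4 by apply: Rlt_le_trans h4 (Rmin_r _ _).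
have p : Cmod ((z - s) ^ k) <= Cmod (z - s).
  rewrite Cmod_pow; case: (k) k0 => // j _; rewrite /=.
  have c0 := Cmod_ge_0 (z - s).
  have : Cmod (z - s) ^ j <= 1 by rewrite -(pow1 j); apply: pow_incr; lra.
  have : 0 <= Cmod (z - s) ^ j by apply: pow_le.
  nra.
have gz : Cmod (g z) <= 2 * Cmod (z - s).
  rewrite e Cmod_mult; apply: Rmult_le_compat; [exact: Cmod_ge_0|exact: Cmod_ge_0|lra|exact: p].
have := Cmod_triangle (g z) (- (g z - g s)); rewrite Cmod_opp.
have -> : (g z + - (g z - g s) = g s)%C by ring.
lra.
Qed.

(** If [zeta s = 0], the terms from [2^(-s)] on would sum to [-1], but
    [m^(-3) <= m^(-2) / 2] for [m >= 2] bounds their sum by 1/2. *)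
Lemma zeta_neq0 s : 3 <= Re s -> zeta s <> 0.
Proof.
move=> hs z0.
have h : sums (fun k => npow k.+2 s) (-1)%C.
  have := zeta_dsum (s := s) ltac:(lra); rewrite z0 => h eps /h [N HN]; exists N => m hm.
  have := HN m.+1 (leqW hm); rewrite (csumSl (fun k => RtoC 1 * npow k.+1 s)%C) npow1.
  have -> : \csum_(i < m) (1 * npow i.+2 s) = \csum_(i < m) npow i.+2 s.
    by apply: eq_bigr => i _; rewrite Cmult_1_l.
  move: (bigop.body _ _ _) => X; congr (Cmod _ < _); ring.
have : Cmod (-1) <= 1 / 2.
  apply: sums_bound h => m.
  apply: (Rle_trans _ (\rsum_(k < m) (1 / 2 * / INR k.+2 ^ 2))).
    apply: ler_rsum => k _; have h3 := @Cmod_npow k.+2 s 3 isT.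
    apply: Rle_trans (h3 _) _; first by simpl; lra.
    have h2 : 2 <= INR k.+2 by rewrite !S_INR; have := pos_INR k; lra.
    have -> : / INR k.+2 ^ 3 = / INR k.+2 * / INR k.+2 ^ 2 by field; lra.
    apply: Rmult_le_compat_r; first by left; apply/Rinv_0_lt_compat/pow_lt; lra.
    by rewrite /Rdiv Rmult_1_l; apply: Rinv_le_contravar; lra.
  rewrite -(big_distrr (times := Rmult)) /=.
  have := inv_sq_bdd m.+1; rewrite big_ord_recl [INR (nat_of_ord ord0).+1]/(INR 1) /=.
  rewrite !Rmult_1_r Rinv_1.
  move: (bigop.body _ _ _) => X; lra.
by rewrite Cmod_R Rabs_left1; lra.
Qed.

End Zeta.

(** * Affine substitutions *)

Definition affine (g : C -> C) := exists al be, RtoC al <> 0 /\ forall z, g z =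
  (RtoC al * z + be)%C.

Lemma germ_comp f g z : (forall w, germ f w) -> affine g -> germ (fun z => f (g z)) z.
Proof.
move=> gf [al [be [al0 E]]].
apply: (germ_ext (f := fun z => f (RtoC al * z + be)%C)); last exact: germ_affine.
by exists 1; split; [lra|move=> w _ _; rewrite E].
Qed.

Lemma analytic_comp f g z : affine g -> analytic_at f (g z) -> analytic_at (fun z => f (g z)) z.
Proof.
move=> [al [be [al0 E]]]; rewrite E => af.
apply: (analytic_ext (f := fun z => f (RtoC al * z + be)%C)); last exact: analytic_affine.
by exists 1; split; [lra|move=> w _; rewrite E].
Qed.

Lemma analytic_cpow2_affine g c z : affine g -> analytic_at (fun z => 1 + c * cpow 2 (g z))%C z.
Proof.
move=> hg; apply: analytic_plus; first exact: analytic_const.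
apply: analytic_mult; first exact: analytic_const.
apply: (analytic_comp (f := cpow 2)) => //.
apply: (analytic_ext (f := fun z => cpow 2 (1 * z + 0))); last exact: analytic_cpow.
by exists 1; split; [lra|move=> w _; congr cpow; ring].
Qed.

Lemma analytic_one_minus_cpow2 g z : affine g -> analytic_at (fun z => 1 - cpow 2 (g z))%C z.
Proof.
move=> hg; apply: (analytic_ext (f := fun z => 1 + (-1) * cpow 2 (g z))%C).
  by exists 1; split; [lra|move=> w _; ring].
exact: analytic_cpow2_affine.
Qed.

(** A zero has [Re (g w) = 0], which fails after a small real displacement; so the
    function is not locally zero. *)
Lemma one_minus_cpow2_isolated g z : affine g ->
  near z (fun w => w <> z -> (1 - cpow 2 (g w) <> 0)%C).
Proof.
move=> hg; have l2 : 0 < ln 2 by rewrite -ln_1; apply: ln_increasing; lra.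
have re0 w : (1 - cpow 2 (g w) = 0)%C -> Re (g w) = 0.
  move=> /(proj2 (Ceq_minus _ _)) e; have := congr1 Cmod e; rewrite Cmod_1 Cmod_cpow -exp_0.
  by move=> /exp_inv h; nra.
case: (analytic_factor (analytic_one_minus_cpow2 z hg)) => [[r [r0 H]]|[k [h [ah h0 H]]]].
  exfalso; have [al [be [al0 E]]] := hg.
  have e1 := re0 _ (near_at (ex_intro _ r (conj r0 H))).
  have := H (z + RtoC (r / 2))%C.
  have -> : (z + RtoC (r / 2) - z = RtoC (r / 2))%C by ring.
  rewrite Cmod_R Rabs_pos_eq; last lra.
  move=> /(_ ltac:(lra)) /re0; move: e1; rewrite !E !ReE => e1 e2.
  by apply: al0; congr RtoC; nra.
apply: near_imp (near_and H (analytic_neq0 ah h0)) => w [-> hw] nw.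
by apply: Cmult_neq_0 => //; apply: pow_neq0.
Qed.

Lemma affineP al be g : al <> 0 -> (forall z, g z = (RtoC al * z + be)%C) -> affine g.
Proof. by move=> al0 E; exists al, be; split=> // /RtoC_inj. Qed.

(** * The rational functions of powers of 2 *)

Section Dyadic.

Variables (n : nat) (cc : C).

Lemma affine_x : affine (fun s => - (s + 1))%C.
Proof. by apply: (@affineP (-1) (-1)); [lra|move=> z; ring]. Qed.

Lemma affine_v : affine (fun s => - (2 * s + RtoC (INR n)))%C.
Proof.
have E : RtoC (-2) = (- (2))%C by rewrite -RtoC_opp.
by apply: (@affineP (-2) (- RtoC (INR n))); [lra|move=> z; rewrite E; ring].
Qed.

Lemma affine_w : affine (fun s => - (2 * s + RtoC (INR n) + 1))%C.
Proof.
have E : RtoC (-2) = (- (2))%C by rewrite -RtoC_opp.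
by apply: (@affineP (-2) (- RtoC (INR n) - 1)); [lra|move=> z; rewrite E; ring].
Qed.

Lemma affine_z1 : affine (fun s => s + 1)%C.
Proof. by apply: (@affineP 1 1); [lra|move=> z; ring]. Qed.

Lemma affine_z2 : affine (fun s => 2 * s + RtoC (INR n))%C.
Proof. by apply: (@affineP 2 (RtoC (INR n))); [lra|move=> z; ring]. Qed.

Lemma affine_z3 : affine (fun s => 2 * s + RtoC (INR n) + 1)%C.
Proof. by apply: (@affineP 2 (RtoC (INR n) + 1)); [lra|move=> z; ring]. Qed.

Definition numer (s : C) : C := (1 + (cc / 2 - 1) * cpow 2 (- (2 * s + RtoC (INR n))))%C.

Definition D2_formula (s : C) : C :=
  (numer s / ((1 - cpow 2 (- (s + 1))) * (1 - cpow 2 (- (2 * s + RtoC (INR n))))))%C.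

Definition E_formula (s : C) : C :=
  (numer s / (1 - cpow 2 (- (2 * s + RtoC (INR n) + 1))))%C.

Lemma numer_analytic s : analytic_at numer s.
Proof. exact: (analytic_cpow2_affine _ _ affine_v). Qed.

Lemma cpow2_neq1 z : Re z <> 0 -> (1 - cpow 2 z <> 0)%C.
Proof.
move=> hz /(proj2 (Ceq_minus _ _)) e.
have l2 : 0 < ln 2 by rewrite -ln_1; apply: ln_increasing; lra.
have := congr1 Cmod e; rewrite Cmod_1 Cmod_cpow -exp_0 => /exp_inv h; nra.
Qed.

Lemma D2_formula_germ s : germ D2_formula s.
Proof.
apply: germ_mult; first exact/germ_analytic/numer_analytic.
apply: germ_inv; apply: germ_mult; apply: germ_analytic.
  exact: (analytic_one_minus_cpow2 _ affine_x).
exact: (analytic_one_minus_cpow2 _ affine_v).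
Qed.

Lemma D2_formula_analytic s : 1 < Re s -> analytic_at D2_formula s.
Proof.
move=> hs; have n0 := pos_INR n.
apply: analytic_mult; first exact: numer_analytic.
apply: analytic_inv.
  apply: analytic_mult; first exact: (analytic_one_minus_cpow2 _ affine_x).
  exact: (analytic_one_minus_cpow2 _ affine_v).
by apply: Cmult_neq_0; apply: cpow2_neq1; rewrite !ReE; lra.
Qed.

Lemma dyadic_factor_germ s : germ (dyadic_factor n) s.
Proof.
apply: germ_mult.
  apply: germ_mult; apply: germ_analytic.
    exact: (analytic_one_minus_cpow2 _ affine_x).
  exact: (analytic_one_minus_cpow2 _ affine_v).
by apply: germ_inv; apply: germ_analytic; exact: (analytic_one_minus_cpow2 _ affine_w).
Qed.

Lemma dyadic_factor_analytic s : 1 < Re s -> analytic_at (dyadic_factor n) s.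
Proof.
move=> hs; have n0 := pos_INR n.
apply: analytic_mult.
  apply: analytic_mult; first exact: (analytic_one_minus_cpow2 _ affine_x).
  exact: (analytic_one_minus_cpow2 _ affine_v).
apply: analytic_inv; first exact: (analytic_one_minus_cpow2 _ affine_w).
by apply: cpow2_neq1; rewrite !ReE; lra.
Qed.

(** The factor [1 - 2^(-(2 s + n + 1))] may vanish: the division by it is the same
    on both sides. *)
Lemma D2_dyadic s : (1 - cpow 2 (- (s + 1)) <> 0)%C ->
  (1 - cpow 2 (- (2 * s + RtoC (INR n))) <> 0)%C ->
  (D2_formula s * dyadic_factor n s = E_formula s)%C.
Proof.
rewrite /D2_formula /dyadic_factor /E_formula /Cdiv => a0 b0.
by move: (/ (1 - cpow 2 _))%C => X; field.
Qed.

Lemma cpow2_half s : (cpow 2 (- (2 * s + RtoC (INR n))) =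
  2 * cpow 2 (- (2 * s + RtoC (INR n) + 1)))%C.
Proof.
have := npow_shift (2 * s + RtoC (INR n)) 1 (isT : 0 < 2)%N.
by rewrite Cpow_1_r /npow -[RtoC (INR 1)]/(RtoC 1) -[INR 2]/2 => ->.
Qed.

(** With [w = 2^(-(2 s + n + 1))] the condition says [|w| <= 1/2], so the
    denominator is at least 1/2 in modulus and [|2 w| <= 1] in the numerator. *)
Lemma E_formula_bound s : 0 <= Re (2 * s + RtoC (INR n)) ->
  Cmod (E_formula s) <= 2 * (2 + Cmod (cc / 2)).
Proof.
move=> hs; have l2 : 0 < ln 2 by rewrite -ln_1; apply: ln_increasing; lra.
set w := cpow 2 (- (2 * s + RtoC (INR n) + 1)).
have w1 : Cmod w <= 1 / 2 by apply: Cmod_cpow2; move: hs; rewrite !ReE; lra.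
have nw : 1 / 2 <= Cmod (1 - w).
  have := Cmod_triangle (1 - w) w; have -> : (1 - w + w = 1)%C by ring.
  rewrite Cmod_1; lra.
have nz : (1 - w <> 0)%C by move=> e; move: nw; rewrite e Cmod_0; lra.
rewrite /E_formula -/w Cmod_div //.
have hn : Cmod (numer s) <= 2 + Cmod (cc / 2).
  rewrite /numer cpow2_half -/w.
  apply: Rle_trans (Cmod_triangle _ _) _; rewrite Cmod_1 Cmod_mult.
  have h1 : Cmod (cc / 2 - 1) <= Cmod (cc / 2) + 1.
    by have := Cmod_triangle (cc / 2) (- (1)); rewrite Cmod_opp Cmod_1.
  have h2 : Cmod (2 * w) <= 1 by rewrite Cmod_mult Cmod_R Rabs_pos_eq; lra.
  have := Cmod_ge_0 (cc / 2 - 1); have := Cmod_ge_0 (2 * w).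
  move: (Cmod (cc / 2 - 1)) (Cmod (2 * w)) (Cmod (cc / 2)) h1 h2 => p q r h1 h2 p0 q0; nra.
have c0 := Cmod_ge_0 (cc / 2).
apply: (Rmult_le_reg_r (Cmod (1 - w))); first lra.
rewrite /Rdiv Rmult_assoc Rinv_l; last lra.
nra.
Qed.

Lemma E_formula_analytic s : 0 <= Re (2 * s + RtoC (INR n)) -> analytic_at E_formula s.
Proof.
move=> hs; apply: analytic_mult; first exact: numer_analytic.
apply: analytic_inv; first exact: (analytic_one_minus_cpow2 _ affine_w).
by apply: cpow2_neq1; move: hs; rewrite !ReE; lra.
Qed.

Definition D2_mero : C -> C := regularize D2_formula.

Lemma D2_mero_meromorphic : meromorphic D2_mero.
Proof. exact: regularize_meromorphic D2_formula_germ. Qed.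

Lemma D2_mero_eq s : 1 < Re s -> D2_mero s = D2_formula s.
Proof. by move=> hs; apply/regularize_cont/analytic_cont/D2_formula_analytic. Qed.

Lemma D2_dyadic_germ s : germ (fun z => D2_mero z * dyadic_factor n z)%C s.
Proof.
apply: germ_mult; last exact: dyadic_factor_germ.
exact: germ_meromorphic D2_mero_meromorphic.
Qed.

(** The cancelled factors have isolated zeros, so the product agrees with
    [E_formula] near [s] except possibly at [s], and the limit is the value of the
    analytic [E_formula]. *)
Lemma D2_dyadic_regular s : 0 <= Re (2 * s + RtoC (INR n)) ->
  regularize (fun z => D2_mero z * dyadic_factor n z)%C s = E_formula s.
Proof.
move=> hs; apply: regularize_lim; apply: plim_ext (analytic_cont (E_formula_analytic hs)).
have := near_and (one_minus_cpow2_isolated s affine_x) (one_minus_cpow2_isolated s affine_v).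
move=> /(near_and (regularize_near (D2_formula_germ s))).
apply: near_imp => z [e [h1 h2]] nz; rewrite /D2_mero e // D2_dyadic //; [exact: h1|exact: h2].
Qed.

End Dyadic.

(** * The continuations and the bound *)

Lemma D2_is_Dp n (b : 'rV[Z]_n) : signs b -> odd n ->
  is_Dp b 2 0%R (D2_mero n (dyadic_const (fun i => b ord0 i))).
Proof.
move=> hb on; split=> [|s hs]; first exact: D2_mero_meromorphic.
by apply/is_series_sums; rewrite D2_mero_eq //; apply: D2_series.
Qed.

Section MainFormula.

Variables (n : nat) (b : 'rV[Z]_n) (zeta : C -> C).
Hypotheses (hb : signs b) (on : odd n) (hn3 : (3 <= n)%N) (hzeta : is_riemann_zeta zeta).

Let cc := dyadic_const (fun i => b ord0 i).

Let zeta_factor (s : C) : C :=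
  (zeta (s + 1) * zeta (2 * s + RtoC (INR n)) / zeta (2 * s + RtoC (INR n) + 1))%C.

Let D_formula (s : C) : C := (D2_mero n cc s * dyadic_factor n s * zeta_factor s)%C.

Lemma zeta_germ w : germ zeta w.
Proof. by apply: germ_meromorphic; case: hzeta. Qed.

Lemma D_formula_germ s : germ D_formula s.
Proof.
apply: germ_mult; first exact: D2_dyadic_germ.
apply: germ_mult.
  apply: germ_mult; apply: germ_comp zeta_germ _; [exact: affine_z1|exact: affine_z2].
by apply: germ_inv; apply: germ_comp zeta_germ _; exact: affine_z3.
Qed.

Lemma INR_ge3 : 3 <= INR n.
Proof. by have -> : 3 = INR 3 by [simpl; lra]; apply: le_INR; apply/leP. Qed.

(** For [Re s > 1] every factor is analytic with a nonzero denominator, so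
    regularizing changes nothing. *)
Lemma D_formula_regular s : 1 < Re s ->
  regularize D_formula s = (D2_formula n cc s * dyadic_factor n s * zeta_factor s)%C.
Proof.
move=> hs; have n3 := INR_ge3.
apply: regularize_lim.
apply: (plim_ext (f := fun z => D2_formula n cc z * dyadic_factor n z * zeta_factor z)%C).
  by apply: near_imp (near_Re_gt hs) => z hz _; rewrite /D_formula D2_mero_eq.
apply: (@analytic_cont (fun z => D2_formula n cc z * dyadic_factor n z * zeta_factor z)%C).
apply: analytic_mult.
  by apply: analytic_mult; [exact: D2_formula_analytic|exact: dyadic_factor_analytic].
apply: analytic_mult.
  apply: analytic_mult; apply: analytic_comp.
  - exact: affine_z1.
  - by apply: (zeta_analytic hzeta); rewrite !ReE; lra.
  - exact: affine_z2.
  - by apply: (zeta_analytic hzeta); rewrite !ReE; lra.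
apply: analytic_inv; last by apply: (zeta_neq0 hzeta); rewrite !ReE; lra.
apply: analytic_comp; first exact: affine_z3.
by apply: (zeta_analytic hzeta); rewrite !ReE; lra.
Qed.

(** The two expressions for the series agree: [D_series] gives [zeta (s + 1) L],
    and [weight_sum] solves for [L] because [zeta] has no zero at
    [2 s + n + 1]. *)
Lemma D_is_D : is_D b 0%R (regularize D_formula).
Proof.
split=> [|s hs]; first exact: regularize_meromorphic D_formula_germ.
apply/is_series_sums; have n3 := INR_ge3.
have [L [sL eL]] : exists L, dsum (weight cc) (2 * s + RtoC (INR n) + 1) L /\
    (L * (zeta (2 * s + INR n + 1) * (1 - npow 2 (2 * s + INR n + 1))) =
     (1 + (cc - 2) * npow 2 (2 * s + INR n + 1)) * zeta (2 * s + INR n))%C.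
  apply: weight_sum; first by rewrite !ReE; lra.
    by apply: (zeta_dsum hzeta); rewrite !ReE; lra.
  by apply: (zeta_dsum_shift hzeta); rewrite !ReE; lra.
suff -> : regularize D_formula s = (zeta (s + 1) * L)%C.
  by apply: D_series => //; apply: (zeta_dsum hzeta); rewrite !ReE; lra.
rewrite D_formula_regular // D2_dyadic; [|by apply: cpow2_neq1; rewrite !ReE; lra..].
have zn : zeta (2 * s + INR n + 1) <> 0 by apply: (zeta_neq0 hzeta); rewrite !ReE; lra.
have wn : (1 - cpow 2 (- (2 * s + INR n + 1)) <> 0)%C by apply: cpow2_neq1; rewrite !ReE; lra.
rewrite /zeta_factor /E_formula /numer cpow2_half.
move: eL; rewrite /npow -[INR 2]/2; set w := cpow 2 _ => eL.
have {eL} -> : L = ((1 + (cc - 2) * w) * zeta (2 * s + INR n) / (zeta (2 * s + INR n + 1) * (1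
  - w)))%C.
  by rewrite -eL; field.
by field.
Qed.

Lemma D_factorization :
  exists D D2 : C -> C,
    [/\ is_D b 0%R D, is_Dp b 2 0%R D2 &
        mero_eq D (fun s => D2 s * dyadic_factor n s * zeta_factor s)%C].
Proof.
exists (regularize D_formula), (D2_mero n cc); split; first exact: D_is_D.
  exact: D2_is_Dp.
exact: regularize_mero_eq D_formula_germ.
Qed.

End MainFormula.

Lemma dyadic_part_bounded n (b : 'rV[Z]_n) (eps : R) : signs b -> odd n -> 0 < eps ->
  exists D2 E : C -> C,
    [/\ is_Dp b 2 0%R D2, meromorphic E,
        mero_eq E (fun s => D2 s * dyadic_factor n s)%C &
        forall s, - (INR n / 2) + eps <= Re s -> Cmod (E s) <= 2 * (2 + 2 ^ n)].
Proof.
move=> hb on he; set cc := dyadic_const (fun i => b ord0 i).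
exists (D2_mero n cc), (regularize (fun s => D2_mero n cc s * dyadic_factor n s)%C); split.
- exact: D2_is_Dp.
- exact: regularize_meromorphic (D2_dyadic_germ n cc).
- exact: regularize_mero_eq (D2_dyadic_germ n cc).
move=> s hs; have h0 : 0 <= Re (2 * s + RtoC (INR n)) by rewrite !ReE; lra.
rewrite D2_dyadic_regular //; apply: Rle_trans (E_formula_bound cc h0) _.
have hc : Cmod cc <= 2 ^ n by exact: Cmod_dyadic_const.
have -> : Cmod (cc / 2) = Cmod cc / 2.
  by rewrite Cmod_div ?Cmod_R ?Rabs_pos_eq; [|lra|move/RtoC_inj; lra].
have := Cmod_ge_0 cc; lra.
Qed.

Theorem theorem4p1 (n : nat) (hn3 : (3 <= n)%N) (hnodd : odd n)
    (zeta : C -> C) (hzeta : is_riemann_zeta zeta) :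
  (forall b : 'rV[Z]_n, signs b ->
     exists D D2 : C -> C,
       [/\ is_D b 0%R D,
           is_Dp b 2 0%R D2 &
           mero_eq D (fun s : C =>
             (D2 s * dyadic_factor n s *
              (zeta (s + 1) * zeta (2 * s + RtoC (INR n)) /
               zeta (2 * s + RtoC (INR n) + 1)))%C)]) /\
  (forall eps : R, Rlt 0 eps ->
     exists K : R, forall b : 'rV[Z]_n, signs b ->
       exists D2 E : C -> C,
         [/\ is_Dp b 2 0%R D2,
             meromorphic E,
             mero_eq E (fun s : C => (D2 s * dyadic_factor n s)%C) &
             forall s : C, Rle (- (INR n / 2) + eps) (Re s) ->
               Rle (Cmod (E s)) K]).
Proof.
split=> [b hb|eps he]; first exact: D_factorization.
by exists (2 * (2 + 2 ^ n)) => b hb; apply: dyadic_part_bounded.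
Qed.
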